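(* Let $X$ be a finite $(q+1)$-regular graph and let $Y$ be a regular covering graph of $X$ with covering transformation group $\pi=\mathbb{Z}$. Let $\Omega$ be the polynomial defined below and assume $\Omega$ is irreducible over $\mathbb{C}(u)$. If the field extension $\mathbb{C}(u)[T]/(\Omega(T))$ of $\mathbb{C}(u)$ is Galois, then the branched covering $\Pi:S\to\mathbb{C}P^1$ (the Riemann surface to which $Z^{(2)}_Y$ extends meromorphically) has all of its branch points over the set \[ C=\{u\in\mathbb{C} : |u| = q^{-1/2}\}\cup\left[-1,-\tfrac{1}{q}\right]\cup\left[\tfrac1q,1\right]. \]
   Context: Let $\mathbb{Z}=\langle t\rangle$ act freely on $Y$ with quotient $X$. The $L^2$ zeta function is $Z^{(2)}_Y(u)^{-1}=\prod_{\gamma}(1-u^{\mathrm{len}(\gamma)})^{1/|\pi_\gamma|}$, the product over $\mathbb{Z}$-orbits of free homotopy classes $\gamma$ of primitive closed paths in $Y$, with $\mathrm{len}(\gamma)$ the length of a shortest representative and $\pi_\gamma$ the stabilizer; it converges for small $|u|$. Choose a lift in $Y$ of each of the $v$ vertices of $X$, identifying $\ell^2(VY)$ with $\bigoplus_v\ell^2(\mathbb{Z})$, so that the adjacency operator $\delta$ of $Y$ is a $v\times v$ matrix over $\mathbb{Z}[t,t^{-1}]$. Put $\Delta_u=I-\delta u+qu^2 I$. Then $\det\Delta_u = P_u\bigl(\frac{t+t^{-1}}{2}\bigr)$ for a polynomial $P_u(x)$ of degree $n$ in $x$ with coefficients in $\mathbb{Z}[u]$; write $P_u(x)=\alpha(u)\prod_{i=1}^n(r_i(u)-x)$.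 Put $s_i=\sqrt{r_i+1}\sqrt{r_i-1}$, $W_I=\prod_{i=1}^n(r_i+\iota_is_i)$ for $I=(\iota_1,\dots,\iota_n)\in\{\pm1\}^n$, and $\Omega(T)=\prod_{I\in\{\pm1\}^n}(T-W_I)\in\mathbb{C}(u)[T]$. For small $u\neq 0$, $Z^{(2)}_Y(u)=(1-u^2)^{\chi(X)}\frac{2^n}{\alpha(u)}W_{(-1,\dots,-1)}(u)$ (principal square roots). When $\Omega$ is irreducible, $(S,\Pi,f)$ is the algebraic function defined by $\Omega$: a compact Riemann surface $S$, a branched covering $\Pi:S\to\mathbb{C}P^1$ and a meromorphic $f$ with $(\Pi^*\Omega)(f)=0$, such that near some point of $\Pi^{-1}(0)$ the function $\tilde Z(z)=(1-u^2)^{\chi(X)}\frac{2^n}{\alpha(u)}f(z)$, $u=\Pi(z)$, agrees with $Z^{(2)}_Y(\Pi(z))$. *)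

(* Defs.v *)
From HB Require Import structures.
From mathcomp Require Import all_boot all_order all_algebra all_field.
From mathcomp Require Import qfpoly complex.
From mathcomp Require Import all_classical all_reals all_analysis.

Set Implicit Arguments.
Unset Strict Implicit.
Unset Printing Implicit Defensive.
Import Order.TTheory GRing.Theory Num.Theory.
Import numFieldNormedType.Exports.

Local Open Scope classical_set_scope.
Local Open Scope complex_scope.
Local Open Scope ring_scope.

(* The normed topology of the complex plane; the library provides it on R[i]^o
   only. *)
HB.instance Definition _ (R : realType) := PseudoPointedMetric.copy R[i] R[i]^o.
HB.instance Definition _ (R : realType) := NormedModule.copy R[i] R[i]^o.

(* ** Graphs and free Z-actions *)

(* Graphs in the sense of Serre: [edge] ranges over oriented edges, and loops
   and multiple edges are allowed.  A loop consists of two oriented edges, so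
   it contributes 2 to the degree of its vertex. *)
Record graph (V E : Type) := Graph {
  source : E -> V;
  target : E -> V;
  reverse : E -> E;
  reverseK : involutive reverse;
  reverse_neq : forall e, reverse e <> e;
  source_reverse : forall e, source (reverse e) = target e }.

Definition regular_graph (V E : finType) (X : graph V E) (d : nat) : Prop :=
  forall v : V, #|[set e : E | source X e == v]%SET| = d.

(* [shiftV k] and [shiftE k] are the actions of t ^ k.  Freeness on edges, and
   the absence of inversions, follow from freeness on vertices. *)
Record free_Zaction (V E : Type) (Y : graph V E) := FreeZaction {
  shiftV : int -> V -> V;
  shiftE : int -> E -> E;
  shiftV0 : forall v, shiftV 0 v = v;
  shiftE0 : forall e, shiftE 0 e = e;
  shiftVD : forall k l v, shiftV (k + l) v = shiftV k (shiftV l v);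
  shiftED : forall k l e, shiftE (k + l) e = shiftE k (shiftE l e);
  source_shift : forall k e, source Y (shiftE k e) = shiftV k (source Y e);
  target_shift : forall k e, target Y (shiftE k e) = shiftV k (target Y e);
  reverse_shift : forall k e, reverse Y (shiftE k e) = shiftE k (reverse Y e);
  shiftV_free : forall k v, shiftV k v = v -> k = 0 }.

(* (pV, pE) : Y -> X is the quotient map by the action; as the action is free
   it is then a regular covering with covering transformation group Z. *)
Record quotient_map (VY EY VX EX : Type) (Y : graph VY EY)
    (act : free_Zaction Y) (X : graph VX EX)
    (pV : VY -> VX) (pE : EY -> EX) : Prop := QuotientMap {
  quotient_source : forall e, source X (pE e) = pV (source Y e);
  quotient_target : forall e, target X (pE e) = pV (target Y e);
  quotient_reverse : forall e, reverse X (pE e) = pE (reverse Y e);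
  quotient_surjV : forall x, exists v, pV v = x;
  quotient_surjE : forall x, exists e, pE e = x;
  quotient_orbitV : forall v w, pV v = pV w <-> exists k, w = shiftV act k v;
  quotient_orbitE : forall e f, pE e = pE f <-> exists k, f = shiftE act k e }.

(* ** The determinant of Delta_u *)

Section Determinant.
Context {R : realType} {VY EY : choiceType} {VX : finType}.
Variables (Y : graph VY EY) (act : free_Zaction Y) (lift : VX -> VY).

(* The (i, j) entry of the adjacency operator is the sum of t ^ k over the
   edges of Y going from the lift of the i-th vertex of X to the translate by
   t ^ k of the lift of the j-th one.  It is a Laurent polynomial in t, which
   is represented here by its values at nonzero complex numbers. *)
Definition adjacency_mx (t : R[i]) : 'M[R[i]]_#|VX| :=
  \matrix_(i < #|VX|, j < #|VX|)
    \sum_(ke \in [set ke : int * EY |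
        source Y ke.2 = lift (enum_val i) /\
        target Y ke.2 = shiftV act ke.1 (lift (enum_val j))]) t ^ ke.1.

Definition Delta_mx (q : nat) (u t : R[i]) : 'M[R[i]]_#|VX| :=
  1%:M - u *: adjacency_mx t + (q%:R * u ^+ 2) *: 1%:M.

(* [P : {poly {poly int}}] is a polynomial in x (the outer indeterminate) with
   coefficients in Z[u]; [specialize P u] is P_u(x). *)
Definition specialize (P : {poly {poly int}}) (u : R[i]) : {poly R[i]} :=
  map_poly (fun a : {poly int} => (map_poly intr a).[u]) P.

Definition determinant_poly (q : nat) (P : {poly {poly int}}) : Prop :=
  forall u t : R[i], t != 0 ->
    \det (Delta_mx q u t) = (specialize P u).[(t + t^-1) / 2].

End Determinant.

(* ** The polynomial Omega *)

Section Omega.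
Context {R : realType}.
Local Notation Cu := {fraction {poly R[i]}}.

Definition ratfun_value (F : Cu) (u w : R[i]) : Prop :=
  exists p d : {poly R[i]},
    [/\ F = tofrac p / tofrac d, d.[u] != 0 & w = p.[u] / d.[u]].

(* No coefficient of Om has a pole at u, and g is the specialization at u. *)
Definition polyfun_value (Om : {poly Cu}) (u : R[i]) (g : {poly R[i]}) : Prop :=
  forall k, ratfun_value Om`_k u g`_k.

(* [sqrtc] is the principal square root; false stands for the sign +1 and true
   for -1. *)
Definition W_ n (r : 'I_n -> R[i]) (I : {ffun 'I_n -> bool}) : R[i] :=
  \prod_(i < n) (r i + (-1) ^+ I i * (sqrtc (r i + 1) * sqrtc (r i - 1))).

(* The equation in T determines Om, as it holds at all but finitely many u. *)
Definition is_Omega (P : {poly {poly int}}) (Om : {poly Cu}) : Prop :=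
  Om \is monic /\
  forall (u alpha : R[i]) (r : 'I_(size P).-1 -> R[i]) (g : {poly R[i]}),
    alpha != 0 ->
    specialize P u = alpha *: \prod_(i < (size P).-1) ((r i)%:P - 'X) ->
    polyfun_value Om u g ->
    g = \prod_(I : {ffun 'I_(size P).-1 -> bool}) ('X - (W_ r I)%:P).

End Omega.

(* ** Galois extensions *)

Definition splitting_field_pack (F : fieldType) (L : fieldExtType F)
    (axL : splitting_field_axiom L) : splittingFieldType F :=
  HB.pack L (FieldExt_isSplittingField.Build F L axL).

(* [galois] is only available for subfields of a [splittingFieldType], that is
   of a normal extension of the base field. *)
Definition galois_extension (F : fieldType) (L : fieldExtType F) : Prop :=
  exists axL : splitting_field_axiom L,
    galois 1%VS {: splitting_field_pack axL}%VS.

(* ** Riemann surfaces *)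

Section RiemannSurfaces.
Context {R : realType}.

(* [param i] is the inverse of the chart [coord i : dom i -> C]; the values of
   [coord i] outside of [dom i], and of [param i] outside of the image of
   [coord i], are irrelevant. *)
Record atlas (S : Type) := Atlas {
  chart : Type;
  dom : chart -> set S;
  coord : chart -> S -> R[i];
  param : chart -> R[i] -> S }.

Definition is_chart (S : topologicalType) (A : atlas S) (i : chart A) : Prop :=
  [/\ open (dom i), open (coord i @` dom i),
      forall x, dom i x -> param i (coord i x) = x,
      forall x, dom i x -> {for x, continuous (coord i)}
    & forall x, dom i x -> {for coord i x, continuous (param i)}].

Definition riemann_surface (S : topologicalType) (A : atlas S) : Prop :=
  [/\ [set: S] !=set0, connected [set: S], hausdorff_space S,
      (forall i : chart A, is_chart i) /\
      (forall x : S, exists i : chart A, dom i x)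
    & forall (i j : chart A) (x : S), dom i x -> dom j x ->
        derivable (coord j \o param i) (coord i x) 1].

(* As F is continuous, the local expression of F is complex differentiable on
   an open set. *)
Definition holomorphic (S T : topologicalType) (A : atlas S) (B : atlas T)
    (F : S -> T) : Prop :=
  continuous F /\
  forall (i : chart A) (j : chart B) (x : S), dom i x -> dom j (F x) ->
    derivable (coord j \o F \o param i) (coord i x) 1.

(* CP^1, with its point at infinity None and its charts z (index true) and
   1/z (index false). *)
Definition CP1 : topologicalType := one_point_compactification R[i].

Definition CP1_atlas : atlas CP1 := {|
  chart := bool;
  dom b := if b then [set Some z | z in [set: R[i]]] else ~` [set Some 0];
  coord b x := if x is Some z then (if b then z else z^-1) else 0;
  param b z := if b then Some z else if z == 0 then None else Some z^-1 |}.

Definition branch_point (S : topologicalType) (F : S -> CP1) (p : S) : Prop :=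
  forall V : set S, nbhs p V -> ~ set_inj V F.

(* Any holomorphic map from a compact surface is proper.  Over a value which is
   not the image of a branch point all multiplicities are 1, so that n-sheeted
   means that the fibre has n points. *)
Definition branched_covering (S : topologicalType) (A : atlas S)
    (F : S -> CP1) (n : nat) : Prop :=
  [/\ holomorphic A CP1_atlas F,
      forall c, exists p, F p != c
    & forall c, (forall p, F p = c -> ~ branch_point F p) ->
        (F @^-1` [set c] #= `I_n)%card].

Definition meromorphic (S : topologicalType) (A : atlas S)
    (f : S -> CP1) : Prop :=
  holomorphic A CP1_atlas f /\ exists p, f p != None.

(* The last clause is (Pi^* Om)(f) = 0, expressed at the points where neither
   Pi, nor f, nor the coefficients of Pi^* Om have a pole. *)
Definition algebraic_function (Om : {poly {fraction {poly R[i]}}})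
    (S : topologicalType) (A : atlas S) (Pi f : S -> CP1) : Prop :=
  [/\ compact [set: S], riemann_surface A,
      branched_covering A Pi (size Om).-1, meromorphic A f
    & forall (p : S) (u w : R[i]) (g : {poly R[i]}),
        Pi p = Some u -> f p = Some w -> polyfun_value Om u g -> g.[w] = 0].

End RiemannSurfaces.

Definition critical_set {R : realType} (q : nat) : set R[i] :=
  [set u | `|u| = ((Num.sqrt (q%:R : R))^-1)%:C] `|`
  [set x%:C | x in `[-1, - (q%:R)^-1]] `|`
  [set x%:C | x in `[(q%:R)^-1, 1]].

(* Main.v *)
(** The rows of the adjacency matrix have absolute sum at most [q + 1] for [t] on
    the unit circle, where the matrix is Hermitian; hence for [u] outside of [C]
    the polynomial [P_u] has no zero in [-1, 1], so that [|r_i - s_i| < |r_i + s_i|]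
    for all [i] and [W_(-1,...,-1)] is the only root of least modulus of [Om] at [u].

    As the extension is Galois, [Om] is the product of the [T - h_j(f)] for some
    polynomials [h_j] over [C(u)], and [f] is conversely a polynomial in each
    [h_j(f)].  Near a point [p0] of [S] with [Pi p0] outside of [C], the index [j]
    for which [h_j(f)] is the root of least modulus is locally constant on a
    punctured disc around [p0], hence constant.  If [Pi p = Pi p'] in this disc,
    then [h_j(f)], and so [f], takes the same value at [p] and at [p'].  Since [f]
    separates the points of the fibres of [Pi] over all but finitely many values,
    [p = p'], and [Pi] is injective near [p0].

    That [f] separates the fibres is seen on the polynomial with roots [f p], for
    [Pi p = u].  Its coefficients are holomorphic in [u] outside of a finite set
    and of polynomial growth, hence rational by Cauchy's formula and Liouville's
    theorem.  It has a root in common with the irreducible polynomial [Om], hence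
    equals [Om], which is separable. *)

Require Import Defs.
From mathcomp Require Import all_boot all_order all_algebra all_field.
From mathcomp Require Import qfpoly complex ring lra.
From mathcomp Require Import all_classical all_reals all_analysis.
Set Implicit Arguments.
Unset Strict Implicit.
Unset Printing Implicit Defensive.
Import Order.TTheory GRing.Theory Num.Theory.
Import numFieldNormedType.Exports.
Local Open Scope classical_set_scope.
Local Open Scope complex_scope.
Local Open Scope ring_scope.

(** * Complex differentiability *)

(** Near [p0] the function [f] need not be the root of least modulus, and that some conjugate of [f]
    is a single-valued function of [u] says nothing about the branching at [p0]. The Galois
    hypothesis supplies the missing link: whichever conjugate is least near [p0], it determines [f],
    and with it the point of the fibre.

    Identities over C(u) can be read at a number [u] only away from the zeros of denominators, so
    each of them is specialized outside of the zeros of a nonzero polynomial. This is harmless: a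
    punctured disc around [p0] avoids all these values, and [Pi] does not take the value [Pi p0] on
    it. Infinity is treated like any other value outside of [C], because [C] is bounded.

    The number of sheets of [Pi] is the degree of [Om]; this is why divisibility of the polynomial
    of a fibre by [Om] amounts to equality.

    Line integrals are taken along segments only, and contours are squares. Hence a constant [kappa]
    in the place of 2 pi i, and crude rational constants in the place of sharp ones. *)

Notation cabs := Normc.normc.

Section Modulus.
Context {R : realType}.
Implicit Types z w : R[i].

Lemma normE z : `|z| = (cabs z)%:C.
Proof. by case: z. Qed.

Lemma cabsE z : cabs z = Num.sqrt (complex.Re z ^+ 2 + complex.Im z ^+ 2).
Proof. by case: z. Qed.

Lemma cabs_ge0 z : 0 <= cabs z.
Proof. by rewrite cabsE sqrtr_ge0. Qed.

Lemma cabs0 : cabs (0 : R[i]) = 0. Proof. exact: Normc.normc0. Qed.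
Lemma cabs1 : cabs (1 : R[i]) = 1. Proof. exact: Normc.normc1. Qed.

Lemma cabs_eq0 z : (cabs z == 0) = (z == 0).
Proof. by apply/eqP/eqP => [/Normc.eq0_normc//|->]; rewrite cabs0. Qed.

Lemma cabs_gt0 z : (0 < cabs z) = (z != 0).
Proof. by rewrite lt_def cabs_eq0 cabs_ge0 andbT. Qed.

Lemma cabsM z w : cabs (z * w) = cabs z * cabs w.
Proof. exact: Normc.normcM. Qed.

Lemma cabsV z : cabs z^-1 = (cabs z)^-1.
Proof. exact: Normc.normcV. Qed.

Lemma cabsX z n : cabs (z ^+ n) = cabs z ^+ n.
Proof. by elim: n => [|n IH]; rewrite ?cabs1 // !exprS cabsM IH. Qed.

Lemma cabsN z : cabs (- z) = cabs z.
Proof. exact: (@normcN R z). Qed.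

Lemma cabsD z w : cabs (z + w) <= cabs z + cabs w.
Proof. exact: (@le_normcD R z w). Qed.

Lemma cabsB z w : cabs (z - w) <= cabs z + cabs w.
Proof. by rewrite -(cabsN w); exact: cabsD. Qed.

Lemma cabsC z w : cabs (z - w) = cabs (w - z).
Proof. by rewrite -cabsN opprB. Qed.

Lemma cabs_real (x : R) : cabs x%:C = `|x|.
Proof. by rewrite /= expr0n /= addr0 sqrtr_sqr. Qed.

Lemma cabs_i : cabs ('i : R[i]) = 1.
Proof. by rewrite /= expr0n /= add0r expr1n sqrtr1. Qed.

Lemma cabs_Re z : `|complex.Re z| <= cabs z.
Proof. by rewrite cabsE -sqrtr_sqr ler_wsqrtr // lerDl sqr_ge0. Qed.

Lemma cabs_Im z : `|complex.Im z| <= cabs z.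
Proof. by rewrite cabsE -sqrtr_sqr ler_wsqrtr // lerDr sqr_ge0. Qed.

Lemma cabs_le z : cabs z <= `|complex.Re z| + `|complex.Im z|.
Proof.
rewrite {1}[z]complexE; apply: le_trans (cabsD _ _) _.
by rewrite cabsM cabs_i mul1r !cabs_real.
Qed.

Lemma cabs_sub z w : cabs z - cabs w <= cabs (z - w).
Proof. by have := cabsD (z - w) w; rewrite subrK; lra. Qed.

Lemma cabs_sum I (r : seq I) (P : pred I) (F : I -> R[i]) :
  cabs (\sum_(i <- r | P i) F i) <= \sum_(i <- r | P i) cabs (F i).
Proof.
elim/big_rec2: _ => [|i y x _ h]; first by rewrite cabs0.
by apply: le_trans (cabsD _ _) _; lra.
Qed.

Lemma cabs_prod I (r : seq I) (P : pred I) (F : I -> R[i]) :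
  cabs (\prod_(i <- r | P i) F i) = \prod_(i <- r | P i) cabs (F i).
Proof.
by elim/big_rec2: _ => [|i y x _ h]; rewrite ?cabs1 // cabsM h.
Qed.

Lemma nbhs_cabs z (A : set R[i]) :
  nbhs z A <-> exists2 e : R, 0 < e & forall w, cabs (w - z) < e -> A w.
Proof.
split.
  move/nbhs_ballP => [e /= e0 eA]; exists (complex.Re e).
    by move: e0; rewrite ltcE => /andP[].
  move=> w wz; apply: eA; rewrite -ball_normE /= normE cabsC.
  move: e0; rewrite ltcE => /andP[/eqP e0 _].
  by rewrite ltcE /= e0 eqxx.
move=> [e e0 eA]; apply/nbhs_ballP; exists e%:C => /=; first by rewrite ltcR.
by move=> w; rewrite -ball_normE /= normE ltcR cabsC; exact: eA.
Qed.

(** Continuity at a point with real radii, so that estimates become goals of real arithmetic;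
    [nbhs_cabs] links it to the topology of [R[i]]. *)
Definition ccont (f : R[i] -> R[i]) z := forall e : R, 0 < e ->
  exists2 d : R, 0 < d & forall w, cabs (w - z) < d -> cabs (f w - f z) < e.

Lemma ccont_cst (c z : R[i]) : ccont (fun=> c) z.
Proof. by move=> e e0; exists 1 => // w _; rewrite subrr cabs0. Qed.

Lemma ccont_id z : ccont id z.
Proof. by move=> e e0; exists e. Qed.

Lemma ccontD (f g : R[i] -> R[i]) z : ccont f z -> ccont g z ->
  ccont (fun w => f w + g w) z.
Proof.
move=> fz gz e e0; have e2 : 0 < e / 2 by lra.
have [a a0 af] := fz _ e2; have [b b0 bg] := gz _ e2.
exists (Num.min a b); first by rewrite lt_min a0.
move=> w; rewrite lt_min => /andP[/af wa /bg wb].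
have -> : f w + g w - (f z + g z) = (f w - f z) + (g w - g z) by ring.
by apply: le_lt_trans (cabsD _ _) _; lra.
Qed.

Lemma ccontM (f g : R[i] -> R[i]) z : ccont f z -> ccont g z ->
  ccont (fun w => f w * g w) z.
Proof.
move=> fz gz e e0; have f0 := cabs_ge0 (f z); have g0 := cabs_ge0 (g z).
pose k := cabs (f z) + cabs (g z) + 1.
have k0 : 0 < k by rewrite /k; lra.
pose h := Num.min 1 (e / (2 * k)).
have h0 : 0 < h by rewrite lt_min ltr01 divr_gt0 //; lra.
have h1 : h <= 1 by rewrite ge_min lexx.
have hk : h * k <= e / 2.
  have : h <= e / (2 * k) by rewrite ge_min lexx orbT.
  by rewrite ler_pdivlMr; lra.
have [a a0 af] := fz _ h0; have [b b0 bg] := gz _ h0.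
exists (Num.min a b); first by rewrite lt_min a0.
move=> w; rewrite lt_min => /andP[/af wa /bg wb].
have -> : f w * g w - f z * g z =
  (f w - f z) * (g w - g z) + (f z * (g w - g z) + (f w - f z) * g z) by ring.
apply: le_lt_trans (cabsD _ _) _.
apply: (@le_lt_trans _ _ (h * h + (cabs (f z) * h + h * cabs (g z)))); last first.
  by move: hk; rewrite /k; nra.
apply: lerD; first by rewrite cabsM; apply: ler_pM; rewrite ?cabs_ge0 // ltW.
apply: le_trans (cabsD _ _) _; rewrite !cabsM.
by apply: lerD; [apply: ler_wpM2l|apply: ler_wpM2r] => //; exact: ltW.
Qed.

Lemma ccont_sum I (s : seq I) (F : I -> R[i] -> R[i]) z :
  (forall i, ccont (F i) z) -> ccont (fun x => \sum_(i <- s) F i x) z.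
Proof.
move=> Fc; elim: s => [|i s IH].
  have -> : (fun x => \sum_(i <- [::]) F i x) = (fun=> 0) by apply/funext => x; rewrite big_nil.
  exact: ccont_cst.
have -> : (fun x => \sum_(i <- i :: s) F i x) = (fun x => F i x + \sum_(i <- s) F i x).
  by apply/funext => x; rewrite big_cons.
by apply: ccontD.
Qed.

Lemma ccontX (g : R[i] -> R[i]) z n : ccont g z -> ccont (fun x => g x ^+ n) z.
Proof.
move=> gc; elim: n => [|n IH]; first exact: ccont_cst.
have -> : (fun x => g x ^+ n.+1) = (fun x => g x * g x ^+ n) by apply/funext => x; rewrite exprS.
exact: ccontM.
Qed.

Lemma ccontN (f : R[i] -> R[i]) z : ccont f z -> ccont (fun w => - f w) z.
Proof.
move=> fz e e0; have [d d0 df] := fz e e0; exists d => // w wz.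
by rewrite -opprD cabsN; exact: df.
Qed.

Lemma ccontB (f g : R[i] -> R[i]) z : ccont f z -> ccont g z ->
  ccont (fun w => f w - g w) z.
Proof. by move=> fz gz; apply: ccontD => //; exact: ccontN. Qed.

Lemma ccont_neq0 (f : R[i] -> R[i]) z : ccont f z -> f z != 0 ->
  exists2 d : R, 0 < d & forall w, cabs (w - z) < d -> cabs (f z) / 2 < cabs (f w).
Proof.
move=> fz fz0; have f0 : 0 < cabs (f z) by rewrite cabs_gt0.
have f2 : 0 < cabs (f z) / 2 by lra.
have [d d0 df] := fz _ f2; exists d => // w /df; rewrite cabsC.
by have := cabs_sub (f z) (f w); lra.
Qed.

Lemma ccontV (f : R[i] -> R[i]) z : ccont f z -> f z != 0 ->
  ccont (fun w => (f w)^-1) z.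
Proof.
move=> fz fz0 e e0; have [d d0 df] := ccont_neq0 fz fz0.
have f0 : 0 < cabs (f z) by rewrite cabs_gt0.
have e2 : 0 < e * cabs (f z) ^+ 2 / 2.
  by rewrite divr_gt0 // mulr_gt0 // exprn_gt0.
have [a a0 af] := fz _ e2.
exists (Num.min d a); first by rewrite lt_min d0.
move=> w; rewrite lt_min => /andP[/df wd /af wa].
have fw0 : f w != 0 by rewrite -cabs_gt0; lra.
have -> : (f w)^-1 - (f z)^-1 = (f z - f w) / (f w * f z).
  by field; rewrite fz0 fw0.
rewrite cabsM cabsV cabsM cabsC ltr_pdivrMr ?mulr_gt0 ?cabs_gt0 //.
by apply: lt_le_trans wa _; rewrite expr2; nra.
Qed.

Lemma open_cabs (A : set R[i]) z : open A -> A z ->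
  exists2 e : R, 0 < e & forall w, cabs (w - z) < e -> A w.
Proof. by move=> oA Az; apply/nbhs_cabs; exact: open_nbhs_nbhs. Qed.

End Modulus.

Section Caratheodory.
Context {R : realType}.
Implicit Types (f g : R[i] -> R[i]) (z d : R[i]).

(* Caratheodory's form of the complex derivative: the slope of [f] at [z] extends
   continuously to [z] with value [d]. *)
Definition cdiff f z d := exists p : R[i] -> R[i],
  [/\ forall w, f w - f z = p w * (w - z), ccont p z & p z = d].

Lemma cdiffP f z d : cdiff f z d <-> forall e : R, 0 < e ->
  exists2 r : R, 0 < r & forall w, cabs (w - z) < r ->
    cabs (f w - f z - d * (w - z)) <= e * cabs (w - z).
Proof.
split=> [[p [pE pz <-]] e e0|fz].
  have [r r0 rp] := pz e e0; exists r => // w wz.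
  by rewrite pE -mulrBl cabsM ler_wpM2r ?cabs_ge0 // ltW // rp.
exists (fun w => if w == z then d else (f w - f z) / (w - z)); split.
- move=> w; case: eqVneq => [->|wz]; first by rewrite !subrr mulr0.
  by rewrite divfK // subr_eq0.
- move=> e e0; have e2 : 0 < e / 2 by lra.
  have [r r0 rf] := fz _ e2.
  exists r => // w wz; rewrite eqxx; case: eqVneq => [_|nwz].
    by rewrite subrr cabs0.
  have w0 : 0 < cabs (w - z) by rewrite cabs_gt0 subr_eq0.
  have -> : (f w - f z) / (w - z) - d = (f w - f z - d * (w - z)) / (w - z).
    by rewrite [RHS]mulrBl mulfK // subr_eq0.
  rewrite cabsM cabsV; apply: (@le_lt_trans _ _ (e / 2)); last lra.
  by rewrite ler_pdivrMr //; exact: rf.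
- by rewrite eqxx.
Qed.

Lemma cdiff_cont f z d : cdiff f z d -> ccont f z.
Proof.
move=> [p [pE pz _]].
have -> : f = (fun w => f z + p w * (w - z)).
  by apply/funext => w; rewrite -pE addrC subrK.
apply: ccontD; first exact: ccont_cst.
by apply: ccontM => //; apply: ccontB; [exact: ccont_id|exact: ccont_cst].
Qed.

Lemma cdiff_near f g z d (r : R) : 0 < r ->
  (forall w, cabs (w - z) < r -> f w = g w) -> cdiff f z d -> cdiff g z d.
Proof.
move=> r0 fg /cdiffP fz; apply/cdiffP => e e0; have [s s0 sf] := fz e e0.
exists (Num.min r s); first by rewrite lt_min r0.
move=> w; rewrite lt_min => /andP[wr ws].
by rewrite -!fg ?subrr ?cabs0 //; exact: sf.
Qed.

Lemma cdiff_cst (c : R[i]) z : cdiff (fun=> c) z 0.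
Proof.
exists (fun=> 0); split=> //; last exact: ccont_cst.
by move=> w; rewrite subrr mul0r.
Qed.

Lemma cdiff_id z : cdiff id z 1.
Proof.
exists (fun=> 1); split=> //; last exact: ccont_cst.
by move=> w; rewrite mul1r.
Qed.

Lemma cdiffD f g z a b : cdiff f z a -> cdiff g z b ->
  cdiff (fun w => f w + g w) z (a + b).
Proof.
move=> [p [pE pz pa]] [q [qE qz qb]]; exists (fun w => p w + q w); split.
- by move=> w; rewrite mulrDl -pE -qE; ring.
- exact: ccontD.
- by rewrite pa qb.
Qed.

Lemma cdiffM f g z a b : cdiff f z a -> cdiff g z b ->
  cdiff (fun w => f w * g w) z (a * g z + f z * b).
Proof.
move=> fz gz; have gc := cdiff_cont gz.
case: fz gz => [p [pE pz pa]] [q [qE qz qb]].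
exists (fun w => p w * g w + f z * q w); split.
- by move=> w; rewrite mulrDl mulrAC -pE -mulrA -qE; ring.
- apply: ccontD; first exact: ccontM.
  by apply: ccontM; [exact: ccont_cst|].
- by rewrite pa qb.
Qed.

Lemma cdiffN f z a : cdiff f z a -> cdiff (fun w => - f w) z (- a).
Proof.
move=> [p [pE pz pa]]; exists (fun w => - p w); split.
- by move=> w; rewrite mulNr -pE; ring.
- exact: ccontN.
- by rewrite pa.
Qed.

Lemma cdiffB f g z a b : cdiff f z a -> cdiff g z b ->
  cdiff (fun w => f w - g w) z (a - b).
Proof. by move=> fz gz; apply: cdiffD => //; exact: cdiffN. Qed.

Lemma cdiffV f z a : f z != 0 -> cdiff f z a ->
  cdiff (fun w => (f w)^-1) z (- a / f z ^+ 2).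
Proof.
move=> fz0 fz; have fc := cdiff_cont fz.
have [r r0 rf] : exists2 r : R, 0 < r & forall w, cabs (w - z) < r -> f w != 0.
  have [r r0 rf] := fc (cabs (f z)) (etrans (cabs_gt0 _) fz0).
  exists r => // w /rf; apply: contraTneq => ->.
  by rewrite sub0r cabsN ltxx.
case: fz => p [pE pz pa].
(* The slope factorization is required at all [w], so the inverse is redefined at the zeros of [f]
   by the value that the slope prescribes; this changes nothing near [z]. *)
apply: (@cdiff_near (fun w => if f w == 0 then (f z)^-1 + (w - z) * (- p w / (f z * f w)) else (f w)^-1) _ _ _ r) => //.
  by move=> w /rf/negPf ->.
exists (fun w => - p w / (f z * f w)); split.
- move=> w; rewrite (negPf fz0); case: ifPn => [_|fw0].
    by rewrite [LHS]addrC addKr mulrC.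
  rewrite mulrAC mulNr -pE.
  by field; rewrite fz0 fw0.
- apply: ccontM; first exact: ccontN.
  apply: ccontV; last by rewrite mulf_neq0.
  by apply: ccontM; [exact: ccont_cst|].
- by rewrite pa expr2.
Qed.

Lemma cdiff_eq f z a b : cdiff f z a -> a = b -> cdiff f z b.
Proof. by move=> ? <-. Qed.

Lemma cdiffX f z a n : cdiff f z a ->
  cdiff (fun w => f w ^+ n) z (n%:R * f z ^+ n.-1 * a).
Proof.
move=> fz; elim: n => [|n IH]; first by rewrite !mul0r; exact: cdiff_cst.
have -> : (fun w => f w ^+ n.+1) = (fun w => f w * f w ^+ n).
  by apply/funext => w; rewrite exprS.
apply: cdiff_eq (cdiffM fz IH) _; case: n {IH} => [|n] /=.
  by rewrite !expr0 !mul0r mulr0 addr0 !mul1r mulr1.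
by rewrite [in RHS]mulrSr !exprS; ring.
Qed.

Lemma cdiff_uniq f z a b : cdiff f z a -> cdiff f z b -> a = b.
Proof.
move=> /cdiffP fa /cdiffP fb; apply/eqP; rewrite -subr_eq0 -cabs_eq0.
apply/negPn/negP => ab.
have e0 : 0 < cabs (a - b) / 4 by rewrite divr_gt0 // lt_def ab cabs_ge0.
have [r r0 rf] := fa _ e0; have [s s0 sf] := fb _ e0.
pose t := Num.min r s / 2.
have m0 : 0 < Num.min r s by rewrite lt_min r0 s0.
have t0 : 0 < t by rewrite /t; lra.
have wz : cabs ((z + t%:C) - z) = t by rewrite addrC addKr cabs_real gtr0_norm.
have tr : t < Num.min r s by rewrite /t; lra.
move: tr; rewrite lt_min => /andP[tr ts].
have := rf (z + t%:C); have := sf (z + t%:C); rewrite wz => /(_ ts) h1 /(_ tr) h2.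
have := cabsB (f (z + t%:C) - f z - b * (z + t%:C - z)) (f (z + t%:C) - f z - a * (z + t%:C - z)).
have -> : f (z + t%:C) - f z - b * (z + t%:C - z) - (f (z + t%:C) - f z - a * (z + t%:C - z)) = (a - b) * (z + t%:C - z) by ring.
rewrite cabsM wz; nra.
Qed.

Lemma derivable_cdiff f z : derivable f z 1 -> exists d, cdiff f z d.
Proof.
move=> /cvg_ex[d fd]; exists d; apply/cdiffP => e e0.
have /= := fd [set w | cabs (w - d) < e].
have nd : nbhs d [set w | cabs (w - d) < e] by apply/nbhs_cabs; exists e.
move=> /(_ nd); rewrite /nbhs /= /dnbhs /within /= => /nbhs_cabs[r r0 rf].
exists r => // w wz; case: (eqVneq w z) => [->|nwz].
  by rewrite !subrr mulr0 subrr cabs0 mulr0.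
have wz0 : w - z != 0 by rewrite subr_eq0.
have := rf (w - z); rewrite subr0 => /(_ wz wz0).
rewrite scaler1 subrK => h.
have -> : f w - f z - d * (w - z) = ((w - z)^-1 *: (f w - f z) - d) * (w - z).
  by rewrite /GRing.scale /= mulrBl [(w - z)^-1 * _]mulrC divfK.
by rewrite cabsM ler_wpM2r ?cabs_ge0 // ltW.
Qed.

End Caratheodory.

(** * Bisection and line integrals *)

Section Bisection.
Context {R : realType}.

Lemma expr_small (q e : R) : 0 <= q < 1 -> 0 < e -> exists n, q ^+ n < e.
Proof.
move=> /andP[q0 q1] e0.
have qn : `|q| < 1 by rewrite ger0_norm.
have /cvgrPdist_lt /(_ e e0) [n _ h] := cvg_expr qn.
exists n; have := h n (leqnn n).
by rewrite /= sub0r normrN ger0_norm // exprn_ge0.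
Qed.

(** A failing square has a failing quarter; the nested failing squares shrink to a point, where the
    local hypothesis is contradicted. Here [Q a b s] speaks of the square with lower left corner
    [(a, b)] and side [s]. This is the compactness argument behind the mean value inequality,
    Goursat's theorem and boundedness on contours. *)
Lemma square_bisection (Q : R -> R -> R -> Prop) :
  (forall a b s, 0 < s -> 0 <= a -> a + s <= 1 -> 0 <= b -> b + s <= 1 ->
    Q a b (s / 2) -> Q (a + s / 2) b (s / 2) -> Q a (b + s / 2) (s / 2) ->
    Q (a + s / 2) (b + s / 2) (s / 2) -> Q a b s) ->
  (forall a0 b0, 0 <= a0 <= 1 -> 0 <= b0 <= 1 -> exists2 d : R, 0 < d &
    forall a b s, 0 < s < d -> 0 <= a -> a <= a0 <= a + s -> a + s <= 1 ->
      0 <= b -> b <= b0 <= b + s -> b + s <= 1 -> Q a b s) ->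
  Q 0 0 1.
Proof.
move=> Qsplit Qloc; apply: contrapT => nQ.
pose ok (x : R * R * R) := [/\ 0 < x.2, 0 <= x.1.1, x.1.1 + x.2 <= 1, 0 <= x.1.2 & x.1.2 + x.2 <= 1]
  /\ ~ Q x.1.1 x.1.2 x.2.
pose rel (x y : R * R * R) := [/\ y.2 = x.2 / 2, x.1.1 <= y.1.1 <= x.1.1 + x.2 / 2 &
  x.1.2 <= y.1.2 <= x.1.2 + x.2 / 2].
have step (x : {x | ok x}) : exists y : {x | ok x}, rel (sval x) (sval y).
  case: x => -[[a b] s] [/= [s0 a0 a1 b0 b1] nq].
  have s2 : 0 < s / 2 by lra.
  have [q1|q1] := pselect (Q a b (s / 2)); last first.
    have o : ok (a, b, s / 2) by split=> //; split=> /=; lra.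
    by exists (exist _ _ o); split=> //=; lra.
  have [q2|q2] := pselect (Q (a + s / 2) b (s / 2)); last first.
    have o : ok (a + s / 2, b, s / 2) by split=> //; split=> /=; lra.
    by exists (exist _ _ o); split=> //=; lra.
  have [q3|q3] := pselect (Q a (b + s / 2) (s / 2)); last first.
    have o : ok (a, b + s / 2, s / 2) by split=> //; split=> /=; lra.
    by exists (exist _ _ o); split=> //=; lra.
  have [q4|q4] := pselect (Q (a + s / 2) (b + s / 2) (s / 2)); last first.
    have o : ok (a + s / 2, b + s / 2, s / 2) by split=> //; split=> /=; lra.
    by exists (exist _ _ o); split=> //=; lra.
  by case: nq; exact: Qsplit.
have [next nextP] := choice step.
have o0 : ok (0, 0, 1) by split=> //; split=> //=; lra.
pose x n := sval (iter n next (exist _ _ o0)).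
have xok n : ok (x n) by rewrite /x; case: (iter _ _ _).
have xrel n : rel (x n) (x n.+1) by rewrite /x iterS; exact: nextP.
have xs n : (x n).2 = 2^-1 ^+ n.
  by elim: n => [//|n IH]; have [-> _ _] := xrel n; rewrite IH exprSr.
have bnd m n : (x m).1.1 <= (x (m + n)%N).1.1 /\ (x (m + n)%N).1.1 + (x (m + n)%N).2 <= (x m).1.1 + (x m).2 /\
    (x m).1.2 <= (x (m + n)%N).1.2 /\ (x (m + n)%N).1.2 + (x (m + n)%N).2 <= (x m).1.2 + (x m).2.
  elim: n => [|n [h1 [h2 [h3 h4]]]]; first by rewrite addn0.
  rewrite addnS; have [e1 e2 e3] := xrel (m + n)%N.
  by rewrite !e1; move: e2 e3; lra.
(* Stated for a coordinate [p], to be used for both: the limit is the supremum of the left ends,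
   each of which lies below every right end. *)
have limit (p : R * R * R -> R) : (forall n, 0 <= p (x n)) ->
    (forall m n, p (x m) <= p (x (m + n)%N) /\ p (x (m + n)%N) + (x (m + n)%N).2 <= p (x m) + (x m).2) ->
    exists c, forall n, p (x n) <= c <= p (x n) + (x n).2.
  move=> p0 pb; pose A := range (fun n => p (x n)).
  have Aub n : ubound A (p (x n) + (x n).2).
    move=> _ [m _ <-]; have sm k : 0 < (x k).2 by have [[]] := xok k.
    have [mn|nm] := leqP m n.
      have := pb m (n - m)%N; rewrite subnKC // => -[h _]; have := sm n; lra.
    have := pb n (m - n)%N; rewrite subnKC ?(ltnW nm) // => -[_ h]; have := sm m; lra.
  exists (sup A) => n; apply/andP; split.
    by apply: ub_le_sup; [exists (p (x 0) + (x 0).2); exact: Aub|exists n].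
  by apply: ge_sup; [exists (p (x 0)); exists 0|exact: Aub].
have [a0 a0P] : exists c, forall n, (x n).1.1 <= c <= (x n).1.1 + (x n).2.
  apply: (limit (fun x => x.1.1)) => [n|m n]; first by have [[]] := xok n.
  by have [? [? _]] := bnd m n.
have [b0 b0P] : exists c, forall n, (x n).1.2 <= c <= (x n).1.2 + (x n).2.
  apply: (limit (fun x => x.1.2)) => [n|m n]; first by have [[]] := xok n.
  by have [_ [_ ?]] := bnd m n.
have [||d d0 dQ] := Qloc a0 b0; [by have := a0P 0%N; rewrite /= add0r|by have := b0P 0%N; rewrite /= add0r|].
have [|n nd] := @expr_small 2^-1 d _ d0; first lra.
have [[s0 h1 h2 h3 h4] nq] := xok n; apply: nq; apply: dQ => //.
by rewrite s0 xs.
Qed.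

(* Additivity of the increments turns the mean value inequality into a local
   statement; [square_bisection] is used with an idle second coordinate. *)
Lemma mean_value_bound (F : R -> R[i]) (M : R) :
  (forall t : R, 0 <= t <= 1 -> forall e : R, 0 < e -> exists2 d : R, 0 < d &
    forall s : R, 0 <= s <= 1 -> `|s - t| < d ->
      cabs (F s - F t) <= (M + e) * `|s - t|) ->
  cabs (F 1 - F 0) <= M.
Proof.
move=> FM; apply/ler_addgt0Pr => e e0.
pose Q (a b s : R) := cabs (F (a + s) - F a) <= (M + e) * s.
suff : Q 0 0 1 by rewrite /Q add0r mulr1.
apply: (square_bisection (Q := Q)) => [a b s s0 _ _ _ _ h1 h2 _ _|a0 b0 a01 _].
  move: h1 h2; rewrite /Q.
  have -> : a + s / 2 + s / 2 = a + s by field.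
  have -> : F (a + s) - F a = (F (a + s) - F (a + s / 2)) + (F (a + s / 2) - F a) by ring.
  by move=> h1 h2; apply: le_trans (cabsD _ _) _; lra.
have [d d0 Fd] := FM a0 a01 e e0; exists d => // a b s /andP[s0 sd] a1 a2 a3 _ _ _.
rewrite /Q.
have -> : F (a + s) - F a = (F (a + s) - F a0) - (F a - F a0) by ring.
apply: le_trans (cabsB _ _) _.
have := Fd (a + s); rewrite ger0_norm; last lra.
have := Fd a; rewrite ler0_norm; last lra.
move=> h1 h2; have := h1 ltac:(lra) ltac:(lra).
by have := h2 ltac:(lra) ltac:(lra); lra.
Qed.

End Bisection.

Import lebesgue_integral_differentiation.

Section RealPrimitive.
Context {R : realType}.

Lemma derivable_approx (F : R -> R^o) (t : R) : derivable F t 1 ->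
  forall e : R, 0 < e -> exists2 r : R, 0 < r & forall s : R, `|s - t| < r ->
    `|F s - F t - (s - t) * 'D_1 F t| <= e * `|s - t|.
Proof.
move=> dF e e0.
have /cvgrPdist_le /(_ e e0) := dF.
rewrite /prop_near1 /= /nbhs /= /dnbhs /within /= => /nbhs_ballP [r /= r0 rF].
exists r => // s st; have [->|nst] := eqVneq s t.
  by rewrite !subrr mul0r subrr normr0 mulr0.
have st0 : s - t != 0 by rewrite subr_eq0.
have := rF (s - t); rewrite /ball /= sub0r normrN => /(_ st st0).
rewrite -[lim _]/('D_1 F t) /GRing.scale /= mulr1 subrK distrC => h.
have -> : F s - F t - (s - t) * 'D_1 F t = ((s - t)^-1 * (F s - F t) - 'D_1 F t) * (s - t).
  by rewrite [RHS]mulrBl [(s - t)^-1 * _]mulrC divfK // [(s - t) * _]mulrC.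
by rewrite normrM ler_wpM2r.
Qed.

(** The function is extended continuously by constants outside of [0, 1], and integrated from -1, so
    that the fundamental theorem of calculus applies at interior points of [-1, 2], the ends 0 and 1
    included. *)
Lemma primitive_real (f : R -> R) :
  (forall t : R, 0 <= t <= 1 -> forall e : R, 0 < e -> exists2 d : R, 0 < d &
    forall s : R, 0 <= s <= 1 -> `|s - t| < d -> `|f s - f t| < e) ->
  exists F : R -> R, forall t : R, 0 <= t <= 1 -> forall e : R, 0 < e ->
    exists2 d : R, 0 < d & forall s : R, `|s - t| < d ->
      `|F s - F t - (s - t) * f t| <= e * `|s - t|.
Proof.
move=> fc; pose clamp (t : R) := Num.max 0 (Num.min 1 t).
have clamp01 t : 0 <= clamp t <= 1.
  by rewrite le_max lexx /= ge_max ler01 ge_min lexx.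
have clampid t : 0 <= t <= 1 -> clamp t = t.
  by move=> /andP[t0 t1]; rewrite /clamp (min_idPr t1) (max_idPr t0).
have clampL s t : `|clamp s - clamp t| <= `|s - t|.
  have cl x : [\/ clamp x = 0 /\ x <= 0, clamp x = 1 /\ 1 <= x | clamp x = x /\ 0 <= x <= 1].
    rewrite /clamp /Num.max /Num.min.
    by case: (ltP 1 x) => h1; case: ltP => h2;
      (apply: Or31; split; lra) || (apply: Or32; split; lra) || (apply: Or33; split; lra).
  case: (cl s) => -[-> hs]; case: (cl t) => -[-> ht];
  by rewrite ler_norml; apply/andP; split; clear -hs ht; case: (ler0P (s - t)); lra.
pose g : R -> R^o := f \o clamp.
have gc : continuous g.
  move=> t; apply/cvgrPdist_lt => e e0.
  have [d d0 df] := fc _ (clamp01 t) e e0.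
  apply/nbhs_ballP; exists d => //= s; rewrite /ball /= => st.
  by rewrite distrC; apply: df => //; apply: le_lt_trans (clampL _ _) _; rewrite distrC.
have gi : (@lebesgue_measure R).-integrable `[-1, 2] (EFin \o g).
  apply: continuous_compact_integrable; first exact: segment_compact.
  exact: continuous_subspaceT.
pose F (x : R) := \int[@lebesgue_measure R]_(t in `[-1, x]) g t.
exists F => t t01 e e0.
have [|||dF FE] := @continuous_FTC1_closed R g (-1) t 2 _ gi.
- lra.
- lra.
- exact: gc.
have [r r0 rF] := derivable_approx dF e0.
exists r => // s /rF; rewrite -derive1E FE /g /= clampid //.
Qed.

End RealPrimitive.

(** * Integrals along segments *)

Section SegmentIntegral.
Context {R : realType}.
Implicit Types (z w : R[i]) (g h : R[i] -> R[i]).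

Definition seg z w (t : R) : R[i] := z + t%:C * (w - z).

(** The derivative is relative to [0, 1], hence one-sided at the ends. *)
Definition primitive01 (c F : R -> R[i]) := forall t : R, 0 <= t <= 1 ->
  forall e : R, 0 < e -> exists2 d : R, 0 < d & forall s : R, 0 <= s <= 1 -> `|s - t| < d ->
    cabs (F s - F t - (s - t)%:C * c t) <= e * `|s - t|.

(** The increment of any primitive of the integrand along the segment; by [primitive01_uniq] its
    choice is immaterial. Without a primitive the default is the zero function, and the integral is
    0. *)
Definition segment_integral g z w : R[i] :=
  let F := xget (fun=> 0) [set F | primitive01 (g \o seg z w) F] in
  (w - z) * (F 1 - F 0).

Definition seg_cont g z w := forall t : R, 0 <= t <= 1 -> ccont g (seg z w t).

Lemma primitive01_bound (c F : R -> R[i]) (M : R) : primitive01 c F ->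
  (forall t : R, 0 <= t <= 1 -> cabs (c t) <= M) -> cabs (F 1 - F 0) <= M.
Proof.
move=> Fp cM; apply: mean_value_bound => t t01 e e0.
have [d d0 dF] := Fp t t01 e e0; exists d => // s s01 st.
have h := dF s s01 st.
have -> : F s - F t = F s - F t - (s - t)%:C * c t + (s - t)%:C * c t by ring.
apply: le_trans (cabsD _ _) _.
rewrite cabsM cabs_real; have p := ler_wpM2l (normr_ge0 (s - t)) (cM t t01).
by lra.
Qed.

Lemma primitive01_ext (c c' F : R -> R[i]) :
  (forall t : R, 0 <= t <= 1 -> c t = c' t) -> primitive01 c F -> primitive01 c' F.
Proof. by move=> cc Fp t t01; rewrite -cc //; exact: Fp. Qed.

Lemma primitive01_comb (c c' F F' : R -> R[i]) (k : R[i]) : primitive01 c F ->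
  primitive01 c' F' -> primitive01 (fun t => c t + k * c' t) (fun t => F t + k * F' t).
Proof.
move=> Fp Fp' t t01 e e0.
have k0 : 0 < cabs k + 1 by have := cabs_ge0 k; lra.
have e2 : 0 < e / 2 by lra.
have ek : 0 < e / 2 / (cabs k + 1) by rewrite divr_gt0.
have [d d0 dF] := Fp t t01 _ e2; have [d' d'0 dF'] := Fp' t t01 _ ek.
exists (Num.min d d'); first by rewrite lt_min d0.
move=> s s01; rewrite lt_min => /andP[/(dF s s01) h /(dF' s s01) h'].
have -> : F s + k * F' s - (F t + k * F' t) - (s - t)%:C * (c t + k * c' t) =
  (F s - F t - (s - t)%:C * c t) + k * (F' s - F' t - (s - t)%:C * c' t) by ring.
apply: le_trans (cabsD _ _) _; rewrite cabsM.
have : cabs k * cabs (F' s - F' t - (s - t)%:C * c' t) <= e / 2 * `|s - t|.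
  apply: (@le_trans _ _ ((cabs k + 1) * (e / 2 / (cabs k + 1) * `|s - t|))).
    by apply: ler_pM; rewrite ?cabs_ge0 //; lra.
  by rewrite mulrA [_ * (_ / _)]mulrC divfK ?gt_eqF.
by lra.
Qed.

Lemma primitive01_uniq (c F F' : R -> R[i]) : primitive01 c F -> primitive01 c F' ->
  F 1 - F 0 = F' 1 - F' 0.
Proof.
move=> Fp Fp'; apply/eqP; rewrite -subr_eq0 -cabs_eq0 eq_le cabs_ge0 andbT.
have -> : F 1 - F 0 - (F' 1 - F' 0) = (F 1 + -1 * F' 1) - (F 0 + -1 * F' 0) by ring.
apply: (primitive01_bound (primitive01_comb (-1) Fp Fp')) => t _.
by rewrite mulN1r subrr cabs0.
Qed.

Lemma seg_diff z w (s t : R) : seg z w s - seg z w t = (s - t)%:C * (w - z).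
Proof. by rewrite /seg rmorphB /=; ring. Qed.

Lemma primitive01_exists g z w : seg_cont g z w -> exists F, primitive01 (g \o seg z w) F.
Proof.
move=> gc.
have gseg (t : R) : 0 <= t <= 1 -> forall e : R, 0 < e -> exists2 d : R, 0 < d &
    forall s : R, 0 <= s <= 1 -> `|s - t| < d -> cabs (g (seg z w s) - g (seg z w t)) < e.
  move=> t01 e e0; have [d d0 dg] := gc t t01 e e0.
  have l0 : 0 < cabs (w - z) + 1 by have := cabs_ge0 (w - z); lra.
  exists (d / (cabs (w - z) + 1)); first by rewrite divr_gt0.
  move=> s _; rewrite ltr_pdivlMr // => st; apply: dg.
  rewrite seg_diff cabsM cabs_real; apply: le_lt_trans st.
  by apply: ler_wpM2l => //; lra.
have [|A AP] := @primitive_real R (fun t => complex.Re (g (seg z w t))).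
  move=> t t01 e e0; have [d d0 dg] := gseg t t01 e e0; exists d => // s s01 st.
  by apply: le_lt_trans (dg s s01 st); rewrite -raddfB; exact: cabs_Re.
have [|B BP] := @primitive_real R (fun t => complex.Im (g (seg z w t))).
  move=> t t01 e e0; have [d d0 dg] := gseg t t01 e e0; exists d => // s s01 st.
  by apply: le_lt_trans (dg s s01 st); rewrite -raddfB; exact: cabs_Im.
exists (fun t => (A t +i* B t)%C) => t t01 e e0.
have e2 : 0 < e / 2 by lra.
have [a a0 aP] := AP t t01 _ e2; have [b b0 bP] := BP t t01 _ e2.
exists (Num.min a b); first by rewrite lt_min a0.
move=> s s01; rewrite lt_min => /andP[/aP ha /bP hb].
apply: le_trans (cabs_le _) _.
have -> : (s - t)%:C * (g \o seg z w) t =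
  (((s - t) * complex.Re (g (seg z w t))) +i* ((s - t) * complex.Im (g (seg z w t))))%C.
  by rewrite /=; case: (g _) => x y; rewrite [LHS]/GRing.mul /= !mul0r subr0 addr0.
rewrite /=; lra.
Qed.

End SegmentIntegral.

Section SegmentIntegralTheory.
Context {R : realType}.
Implicit Types (z w : R[i]) (g h : R[i] -> R[i]).

Lemma segment_integralE g z w F : primitive01 (g \o seg z w) F ->
  segment_integral g z w = (w - z) * (F 1 - F 0).
Proof.
move=> Fp; rewrite /segment_integral; congr (_ * _).
case: xgetP => [G _ Gp|/(_ F)]; last by [].
exact: primitive01_uniq Gp Fp.
Qed.

Lemma seg0 z w : seg z w 0 = z. Proof. by rewrite /seg mul0r addr0. Qed.
Lemma seg1 z w : seg z w 1 = w. Proof. by rewrite /seg mul1r addrC subrK. Qed.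

Lemma seg_seg z w (a b t : R) :
  seg (seg z w a) (seg z w b) t = seg z w (a + t * (b - a)).
Proof. by rewrite /seg !rmorphD !rmorphM rmorphB /=; ring. Qed.

(** One primitive on the whole segment serves for all its subsegments, in both directions, after an
    affine change of parameter whose speed [b - a] is divided out. Additivity and reversal follow at
    once. *)
Lemma segment_integral_sub g z w F (a b : R) : primitive01 (g \o seg z w) F ->
  0 <= a <= 1 -> 0 <= b <= 1 ->
  segment_integral g (seg z w a) (seg z w b) = (w - z) * (F b - F a).
Proof.
move=> Fp a01 b01; have [->|ab] := eqVneq a b.
  by rewrite /segment_integral /= !subrr mulr0 mul0r.
have ba0 : b - a != 0 by rewrite subr_eq0 eq_sym.
rewrite (@segment_integralE _ _ _ (fun t => F (a + t * (b - a)) / (b - a)%:C)).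
  rewrite mul1r mul0r addr0 [a + _]addrC subrK seg_diff.
  have : (b - a)%:C != 0 :> R[i] by rewrite fmorph_eq0.
  by move: (b - a)%:C => k k0; field.
move=> t t01 e e0; have u01 : 0 <= a + t * (b - a) <= 1 by nra.
have [d d0 dF] := Fp _ u01 e e0.
have p0 : 0 < `|b - a| by rewrite normr_gt0.
exists (d / `|b - a|); first by rewrite divr_gt0.
move=> s s01; rewrite ltr_pdivlMr // => st.
have v01 : 0 <= a + s * (b - a) <= 1 by nra.
have E : a + s * (b - a) - (a + t * (b - a)) = (s - t) * (b - a) by ring.
have := dF _ v01; rewrite !E normrM => /(_ st).
have k0 : (b - a)%:C != 0 :> R[i] by rewrite fmorph_eq0.
have -> : F (a + s * (b - a)) / (b - a)%:C - F (a + t * (b - a)) / (b - a)%:C -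
  (s - t)%:C * (g \o seg (seg z w a) (seg z w b)) t =
  (F (a + s * (b - a)) - F (a + t * (b - a)) - ((s - t) * (b - a))%:C * (g \o seg z w) (a + t * (b - a))) / (b - a)%:C.
  by rewrite /= seg_seg rmorphM /=; move: (b - a)%:C k0 => k k0; field.
rewrite cabsM cabsV cabs_real => h.
by rewrite ler_pdivrMr // -mulrA.
Qed.

Lemma segment_integral_split g z w (l : R) : seg_cont g z w -> 0 <= l <= 1 ->
  segment_integral g z w =
  segment_integral g z (seg z w l) + segment_integral g (seg z w l) w.
Proof.
move=> gc l01; have [F Fp] := primitive01_exists gc.
have := segment_integral_sub (a := 0) (b := l) Fp _ l01.
have := segment_integral_sub (a := l) (b := 1) Fp l01 _.
rewrite seg0 seg1 (segment_integralE Fp) => -> //; last by rewrite ler01 lexx.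
by move=> -> //; last (by rewrite lexx ler01); ring.
Qed.

Lemma segment_integral_rev g z w : seg_cont g z w ->
  segment_integral g w z = - segment_integral g z w.
Proof.
move=> gc; have [F Fp] := primitive01_exists gc.
have := segment_integral_sub (a := 1) (b := 0) Fp.
rewrite seg0 seg1 (segment_integralE Fp) => -> //; [ring|..].
  by rewrite ler01 lexx.
by rewrite lexx ler01.
Qed.

Lemma segment_integral_refl g z : segment_integral g z z = 0.
Proof. by rewrite /segment_integral /= subrr mul0r. Qed.

Lemma segment_integral_comb g h z w (k : R[i]) : seg_cont g z w -> seg_cont h z w ->
  segment_integral (fun x => g x + k * h x) z w =
  segment_integral g z w + k * segment_integral h z w.
Proof.
move=> /primitive01_exists[F Fp] /primitive01_exists[G Gp].
rewrite (segment_integralE Fp) (segment_integralE Gp).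
by rewrite (segment_integralE (primitive01_comb k Fp Gp)); ring.
Qed.

Lemma segment_integral_eq g h z w : seg_cont g z w ->
  (forall t : R, 0 <= t <= 1 -> g (seg z w t) = h (seg z w t)) ->
  segment_integral g z w = segment_integral h z w.
Proof.
move=> /primitive01_exists[F Fp] gh; rewrite (segment_integralE Fp).
by rewrite (segment_integralE (primitive01_ext gh Fp)).
Qed.

Lemma segment_integral_bound g z w (M : R) : seg_cont g z w ->
  (forall t : R, 0 <= t <= 1 -> cabs (g (seg z w t)) <= M) ->
  cabs (segment_integral g z w) <= M * cabs (w - z).
Proof.
move=> /primitive01_exists[F Fp] gM; rewrite (segment_integralE Fp) cabsM mulrC.
by apply: ler_wpM2r; rewrite ?cabs_ge0 //; exact: primitive01_bound Fp gM.
Qed.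

Lemma segment_integral_derivative g G z w :
  (forall t : R, 0 <= t <= 1 -> cdiff G (seg z w t) (g (seg z w t))) ->
  segment_integral g z w = G w - G z.
Proof.
move=> Gg; have [->|zw] := eqVneq z w; first by rewrite segment_integral_refl subrr.
have wz0 : w - z != 0 by rewrite subr_eq0 eq_sym.
rewrite (@segment_integralE _ _ _ (fun t => G (seg z w t) / (w - z))).
  by rewrite seg0 seg1; field.
move=> t t01 e e0; have /cdiffP := Gg t t01.
have p0 : 0 < cabs (w - z) by rewrite cabs_gt0.
move=> /(_ e e0)[d d0 dG]; exists (d / cabs (w - z)); first by rewrite divr_gt0.
move=> s s01; rewrite ltr_pdivlMr // => st.
have := dG (seg z w s); rewrite seg_diff cabsM cabs_real => /(_ st).
have -> : G (seg z w s) / (w - z) - G (seg z w t) / (w - z) - (s - t)%:C * (g \o seg z w) t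
 = (G (seg z w s) - G (seg z w t) - g (seg z w t) * ((s - t)%:C * (w - z))) / (w - z).
  by rewrite /=; field.
by move=> h; rewrite cabsM cabsV ler_pdivrMr // -mulrA.
Qed.

End SegmentIntegralTheory.

(** * Goursat's theorem and Cauchy's formula *)

Section Goursat.
Context {R : realType}.
Implicit Types (a b c z w : R[i]) (g : R[i] -> R[i]) (D : set R[i]).

Definition triangle_integral g a b c :=
  segment_integral g a b + segment_integral g b c + segment_integral g c a.

Definition convexC D := forall z w, D z -> D w -> forall t : R, 0 <= t <= 1 ->
  D (seg z w t).

Lemma convexC_disc z0 (r : R) : convexC [set z | cabs (z - z0) < r].
Proof.
move=> z w /= zr wr t /andP[t0 t1].
have -> : seg z w t - z0 = (1 - t)%:C * (z - z0) + t%:C * (w - z0).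
  by rewrite /seg rmorphB /=; ring.
apply: le_lt_trans (cabsD _ _) _; rewrite !cabsM !cabs_real !ger0_norm //; last lra.
have [->|nt0] := eqVneq t 0; first lra.
have tp : 0 < t by rewrite lt_def nt0.
nra.
Qed.

Lemma seg_cont_convex D g a b : convexC D -> (forall z, D z -> ccont g z) ->
  D a -> D b -> seg_cont g a b.
Proof. by move=> cD gc Da Db t t01; apply: gc; exact: cD. Qed.

Definition midpoint a b := seg a b 2^-1.

(** Each of the three inner sides is run through twice, in opposite directions. *)
Lemma triangle_split D g a b c : convexC D -> (forall z, D z -> ccont g z) ->
  D a -> D b -> D c ->
  let m := midpoint a b in let l := midpoint b c in let n := midpoint c a in
  triangle_integral g a b c = triangle_integral g a m n + triangle_integral g l n m +
    triangle_integral g m b l + triangle_integral g n l c.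
Proof.
move=> cD gc Da Db Dc m l n.
have h01 : 0 <= (2^-1 : R) <= 1 by lra.
have Dm : D m by exact: cD.
have Dl : D l by exact: cD.
have Dn : D n by exact: cD.
have S x y : D x -> D y -> seg_cont g x y by exact: seg_cont_convex.
rewrite /triangle_integral (segment_integral_split (S _ _ Da Db) h01).
rewrite (segment_integral_split (S _ _ Db Dc) h01).
rewrite (segment_integral_split (S _ _ Dc Da) h01).
rewrite -/(midpoint a b) -/(midpoint b c) -/(midpoint c a) -/m -/l -/n.
rewrite (segment_integral_rev (S _ _ Dl Dn)) (segment_integral_rev (S _ _ Dm Dl)).
by rewrite (segment_integral_rev (S _ _ Dn Dm)); ring.
Qed.

(** The affine approximation [f] of [g] at [z] has the primitive [F] and contributes nothing around
    the triangle. The remainder is at most [e * r] on three sides of length at most [2 * r], whence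
    the factor 6. *)
Lemma triangle_small D g z d : convexC D -> (forall z, D z -> ccont g z) ->
  cdiff g z d -> forall e : R, 0 < e -> exists2 r0 : R, 0 < r0 &
  forall a b c (r : R), r < r0 -> D a -> D b -> D c ->
    cabs (a - z) <= r -> cabs (b - z) <= r -> cabs (c - z) <= r ->
    cabs (triangle_integral g a b c) <= 6 * e * r ^+ 2.
Proof.
move=> cD gc /cdiffP gz e e0; have [r0 r00 rg] := gz e e0; exists r0 => //.
move=> a b c r rr0 Da Db Dc ar br cr.
pose f w := g z + d * (w - z); pose h w := g w - f w.
pose F w := (g z - d * z) * w + d / 2 * (w * w).
have Ff w : cdiff F w (f w).
  have := cdiffD (cdiffM (cdiff_cst (g z - d * z) w) (cdiff_id w))
    (cdiffM (cdiff_cst (d / 2) w) (cdiffM (cdiff_id w) (cdiff_id w))).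
  by move=> /cdiff_eq; apply; rewrite /f /=; field.
have fc w : ccont f w.
  apply: ccontD; first exact: ccont_cst.
  by apply: ccontM; [exact: ccont_cst|apply: ccontB; [exact: ccont_id|exact: ccont_cst]].
have hc w : D w -> ccont h w by move=> Dw; apply: ccontB => //; exact: gc.
have sintE x y : D x -> D y -> cabs (x - z) <= r -> cabs (y - z) <= r ->
    exists v, segment_integral g x y = F y - F x + v /\ cabs v <= 2 * e * r ^+ 2.
  move=> Dx Dy xr yr; exists (segment_integral h x y); split.
    have -> : segment_integral g x y = segment_integral (fun x => f x + 1 * h x) x y.
      apply: segment_integral_eq; first exact: seg_cont_convex Dx Dy.
      by move=> t _; rewrite /h; ring.
    rewrite segment_integral_comb ?mul1r //.
    - by congr (_ + _); apply: segment_integral_derivative.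
    - exact: seg_cont_convex Dx Dy.
  have xy : cabs (y - x) <= 2 * r.
    have -> : y - x = (y - z) - (x - z) by ring.
    by apply: le_trans (cabsB _ _) _; lra.
  have r_ge0 : 0 <= r by apply: le_trans xr; exact: cabs_ge0.
  apply: (@le_trans _ _ (e * r * cabs (y - x))); last first.
    have -> : 2 * e * r ^+ 2 = e * r * (2 * r) by ring.
    by apply: ler_wpM2l => //; apply: mulr_ge0 => //; exact: ltW.
  apply: segment_integral_bound; first exact: seg_cont_convex Dx Dy.
  move=> t t01.
  have sr : cabs (seg x y t - z) <= r.
    have -> : seg x y t - z = (1 - t)%:C * (x - z) + t%:C * (y - z).
      by rewrite /seg rmorphB /=; ring.
    apply: le_trans (cabsD _ _) _; rewrite !cabsM !cabs_real !ger0_norm; try lra.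
    by nra.
  have := rg (seg x y t) (le_lt_trans sr rr0).
  have -> : h (seg x y t) = g (seg x y t) - g z - d * (seg x y t - z) by rewrite /h /f; ring.
  by move/le_trans; apply; apply: ler_wpM2l => //; exact: ltW.
rewrite /triangle_integral.
have [u [-> ur]] := sintE a b Da Db ar br.
have [v [-> vr]] := sintE b c Db Dc br cr.
have [w [-> wr]] := sintE c a Dc Da cr ar.
have -> : F b - F a + u + (F c - F b + v) + (F a - F c + w) = u + v + w by ring.
apply: le_trans (cabsD _ _) _.
have := cabsD u v; lra.
Qed.

(** The triangle is the image under an affine [p], with Lipschitz constant [L], of the half
    [x + y <= 1] of the unit square. Each square of the grid carries a lower and an upper triangle,
    and quartering the square quarters both, so that [square_bisection] replaces the bisection of
    triangles. *)
Lemma goursat_grid D g (p : R -> R -> R[i]) (L : R) : convexC D ->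
  (forall z, D z -> exists d, cdiff g z d) -> 0 <= L ->
  (forall x y : R, 0 <= x -> 0 <= y -> x + y <= 1 -> D (p x y)) ->
  (forall x y x' y' s : R, `|x - x'| <= s -> `|y - y'| <= s ->
    cabs (p x y - p x' y') <= s * L) ->
  (forall x y x' y' : R, midpoint (p x y) (p x' y') = p ((x + x') / 2) ((y + y') / 2)) ->
  triangle_integral g (p 0 0) (p 1 0) (p 0 1) = 0.
Proof.
move=> cD gd L0 Dp pp mid.
have gc z : D z -> ccont g z by move=> /gd[d /cdiff_cont].
pose lower (x y s : R) := triangle_integral g (p x y) (p (x + s) y) (p x (y + s)).
pose upper (x y s : R) := triangle_integral g (p (x + s) (y + s)) (p x (y + s)) (p (x + s) y).
apply/eqP; rewrite -cabs_eq0 eq_le cabs_ge0 andbT.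
apply/ler_addgt0Pr => e e0; rewrite add0r.
(* The guards exclude the triangles that stick out of the half square, where [p] need not take its
   values in [D]. The bound is proportional to the area, hence additive under quartering. *)
pose Q (x y s : R) := (x + y + s <= 1 -> cabs (lower x y s) <= e * s ^+ 2) /\
  (x + y + 2 * s <= 1 -> cabs (upper x y s) <= e * s ^+ 2).
suff [h _] : Q 0 0 1.
  by move: h; rewrite !add0r lexx expr1n !mulr1 /lower !add0r; apply.
have eA (x s : R) : (x + (x + s)) / 2 = x + s / 2 by field.
have eB (x : R) : (x + x) / 2 = x by field.
have eC (x s : R) : (x + s + x) / 2 = x + s / 2 by field.
have eD (x s : R) : x + s / 2 + s / 2 = x + s by field.
apply: (square_bisection (Q := Q)).
  move=> x y s s0 x0 _ y0 _ [l1 u1] [l2 u2] [l3 u3] [l4 u4].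
  have E4 : e * s ^+ 2 = 4 * (e * (s / 2) ^+ 2) by field.
  split=> h; rewrite E4.
    have -> : lower x y s = lower x y (s / 2) + upper x y (s / 2) +
        lower (x + s / 2) y (s / 2) + lower x (y + s / 2) (s / 2).
      have D1 : D (p x y) by apply: Dp; clear -h s0 x0 y0; lra.
      have D2 : D (p (x + s) y) by apply: Dp; clear -h s0 x0 y0; lra.
      have D3 : D (p x (y + s)) by apply: Dp; clear -h s0 x0 y0; lra.
      rewrite {1}/lower (triangle_split cD gc D1 D2 D3) !mid !eA !eB !eC.
      by rewrite /lower /upper !eD.
    have {}l1 := l1 ltac:(clear -h s0; lra); have {}u1 := u1 ltac:(clear -h s0; lra).
    have {}l2 := l2 ltac:(clear -h s0; lra); have {}l3 := l3 ltac:(clear -h s0; lra).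
    apply: le_trans (cabsD _ _) _.
    have := cabsD (lower x y (s / 2) + upper x y (s / 2)) (lower (x + s / 2) y (s / 2)).
    have := cabsD (lower x y (s / 2)) (upper x y (s / 2)).
    clear -l1 u1 l2 l3; lra.
  have -> : upper x y s = upper (x + s / 2) (y + s / 2) (s / 2) + lower (x + s / 2) (y + s / 2) (s / 2) +
      upper x (y + s / 2) (s / 2) + upper (x + s / 2) y (s / 2).
    have D1 : D (p (x + s) (y + s)) by apply: Dp; clear -h s0 x0 y0; lra.
    have D2 : D (p x (y + s)) by apply: Dp; clear -h s0 x0 y0; lra.
    have D3 : D (p (x + s) y) by apply: Dp; clear -h s0 x0 y0; lra.
    rewrite {1}/upper (triangle_split cD gc D1 D2 D3) !mid !eA !eB !eC.
    by rewrite /lower /upper !eD.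
  have {}l4 := l4 ltac:(clear -h s0; lra); have {}u4 := u4 ltac:(clear -h s0; lra).
  have {}u2 := u2 ltac:(clear -h s0; lra); have {}u3 := u3 ltac:(clear -h s0; lra).
  apply: le_trans (cabsD _ _) _.
  have := cabsD (upper (x + s / 2) (y + s / 2) (s / 2) + lower (x + s / 2) (y + s / 2) (s / 2)) (upper x (y + s / 2) (s / 2)).
  have := cabsD (upper (x + s / 2) (y + s / 2) (s / 2)) (lower (x + s / 2) (y + s / 2) (s / 2)).
  clear -l4 u4 u2 u3; lra.
move=> x0 y0 /andP[x00 x01] /andP[y00 y01].
(* At a point beyond the hypotenuse both guards fail for small squares. *)
have [xy1|xy1] := leP (x0 + y0) 1; last first.
  exists (x0 + y0 - 1); first lra.
  by move=> x y s /andP[s0 sd] _ /andP[_ h1] _ _ /andP[_ h2] _; split=> h; exfalso; lra.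
have [d gz] := gd _ (Dp _ _ x00 y00 xy1).
have L1 : 0 < L ^+ 2 + 1 by have := sqr_ge0 L; lra.
pose n := e / (6 * (L ^+ 2 + 1)).
have n0 : 0 < n by rewrite divr_gt0 // mulr_gt0.
have [r0 r00 rT] := triangle_small cD gc gz n0.
have L1' : 0 < L + 1 by lra.
exists (r0 / (L + 1)); first by rewrite divr_gt0.
move=> x y s /andP[s0]; rewrite ltr_pdivlMr // => sd h1 /andP[h2 h3] h4 h5 /andP[h6 h7] h8.
have sL : s * L < r0 by rewrite mulrDr in sd; lra.
have near (x' y' : R) : x <= x' <= x + s -> y <= y' <= y + s -> cabs (p x' y' - p x0 y0) <= s * L.
  by move=> hx hy; apply: pp; rewrite ler_norml; lra.
have fin : 6 * n * (s * L) ^+ 2 <= e * s ^+ 2.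
  have -> : 6 * n * (s * L) ^+ 2 = e * s ^+ 2 * (L ^+ 2 / (L ^+ 2 + 1)).
    by rewrite /n; field; rewrite gt_eqF.
  rewrite ler_piMr //; first by rewrite mulr_ge0 ?sqr_ge0 // ltW.
  by rewrite ler_pdivrMr //; lra.
have A1 : x <= x <= x + s by lra.
have A2 : x <= x + s <= x + s by lra.
have A3 : y <= y <= y + s by lra.
have A4 : y <= y + s <= y + s by lra.
by split=> h; apply: le_trans fin; apply: (rT _ _ _ _ sL); try exact: near; apply: Dp;
  clear -h s0 h1 h5; lra.
Qed.

Lemma goursat D g a b c : convexC D -> (forall z, D z -> exists d, cdiff g z d) ->
  D a -> D b -> D c -> triangle_integral g a b c = 0.
Proof.
move=> cD gd Da Db Dc.
pose p (x y : R) := a + x%:C * (b - a) + y%:C * (c - a).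
have E (x : R[i]) : a + (x - a) = x by ring.
have := @goursat_grid D g p (cabs (b - a) + cabs (c - a)) cD gd.
rewrite /p !rmorph0 !rmorph1 !mul0r !mul1r !addr0 !E; apply.
- by rewrite addr_ge0 ?cabs_ge0.
- move=> x y x0 y0 xy1; have [xy0|xy0] := eqVneq (x + y) 0.
    have -> : x = 0 by lra.
    have -> : y = 0 by lra.
    by rewrite !mul0r !addr0.
  have xyp : 0 < x + y by rewrite lt_def xy0 /=; lra.
  (* Convexity speaks of segments only: the point is placed on a segment from [a] to a point of the
     opposite side. *)
  have -> : a + x%:C * (b - a) + y%:C * (c - a) = seg a (seg b c (y / (x + y))) (x + y).
    rewrite /seg fmorph_div !rmorphD /=.
    have : x%:C + y%:C != 0 :> R[i] by rewrite -rmorphD fmorph_eq0.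
    by move: x%:C y%:C => X Y XY; field.
  apply: (cD) => //; last by lra.
  apply: cD => //; rewrite divr_ge0 //=; last lra.
  by rewrite ler_pdivrMr //; lra.
- move=> x y x' y' s xs ys.
  have -> : a + x%:C * (b - a) + y%:C * (c - a) - (a + x'%:C * (b - a) + y'%:C * (c - a))
    = (x - x')%:C * (b - a) + (y - y')%:C * (c - a) by rewrite !rmorphB /=; ring.
  apply: le_trans (cabsD _ _) _; rewrite !cabsM !cabs_real mulrDr.
  by apply: lerD; apply: ler_wpM2r; rewrite ?cabs_ge0.
- by move=> x y x' y'; rewrite /midpoint /seg; field.
Qed.

End Goursat.

Section Contour.
Context {R : realType}.
Implicit Types (a b z w : R[i]) (f g h : R[i] -> R[i]).

(* The contour is the boundary of the square with vertices [r], [ir], [-r], [-ir]. *)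
Definition vertex (r : R) k : R[i] := r%:C * 'i ^+ k.
Definition on_contour (r : R) z := exists k (t : R),
  0 <= t <= 1 /\ z = seg (vertex r k) (vertex r k.+1) t.
Definition contour_integral g (r : R) :=
  \sum_(k < 4) segment_integral g (vertex r k) (vertex r k.+1).

Lemma vertex_diff (r : R) k : vertex r k.+1 - vertex r k = vertex r k * ('i - 1).
Proof. by rewrite /vertex exprSr; ring. Qed.

Lemma cabs_vertex (r : R) k : 0 <= r -> cabs (vertex r k) = r.
Proof. by move=> r0; rewrite cabsM cabsX cabs_i expr1n mulr1 cabs_real ger0_norm. Qed.

Lemma seg_vertex (r : R) k (t : R) :
  seg (vertex r k) (vertex r k.+1) t = vertex r k * (1 + t%:C * ('i - 1)).
Proof. by rewrite /seg vertex_diff; ring. Qed.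

Lemma cabs_edge (t : R) : cabs (1 + t%:C * ('i - 1)) ^+ 2 = (1 - t) ^+ 2 + t ^+ 2.
Proof.
have -> : 1 + t%:C * ('i - 1) = ((1 - t) +i* t)%C.
  by apply/eqP; rewrite eq_complex /=; apply/andP; split; apply/eqP; ring.
by rewrite cabsE /= sqr_sqrtr // addr_ge0 ?sqr_ge0.
Qed.

(** The sides are at distance r / sqrt 2 from 0; the rational bound is the reason why points inside
    of a contour of size [r] are taken at distance less than [r / 2] from 0. *)
Lemma on_contour_bound (r : R) z : 0 <= r -> on_contour r z -> r / 2 <= cabs z <= r.
Proof.
move=> r0 [k [t [t01 ->]]]; rewrite seg_vertex cabsM cabs_vertex //.
have := cabs_edge t; have := cabs_ge0 (1 + t%:C * ('i - 1)).
move: (cabs _) => x x0 xE.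
have h1 : x <= 1 by rewrite -(@ler_pXn2r _ 2) ?nnegrE // xE expr1n; nra.
have h2 : 2^-1 <= x by rewrite -(@ler_pXn2r _ 2) ?nnegrE // ?xE; nra.
apply/andP; split; first by apply: ler_wpM2l.
by rewrite ler_piMr.
Qed.

Lemma seg_cont_contour g (r : R) k : (forall z, on_contour r z -> ccont g z) ->
  seg_cont g (vertex r k) (vertex r k.+1).
Proof. by move=> gc t t01; apply: gc; exists k, t. Qed.

Lemma contour_integral_comb g h (r : R) (k : R[i]) :
  (forall z, on_contour r z -> ccont g z) -> (forall z, on_contour r z -> ccont h z) ->
  contour_integral (fun x => g x + k * h x) r =
  contour_integral g r + k * contour_integral h r.
Proof.
move=> gc hc; rewrite /contour_integral mulr_sumr -big_split /=.
by apply: eq_bigr => j _; rewrite segment_integral_comb //; exact: seg_cont_contour.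
Qed.

Lemma contour_integral_eq g h (r : R) : (forall z, on_contour r z -> ccont g z) ->
  (forall z, on_contour r z -> g z = h z) ->
  contour_integral g r = contour_integral h r.
Proof.
move=> gc gh; apply: eq_bigr => k _; apply: segment_integral_eq.
  exact: seg_cont_contour.
by move=> t t01; apply: gh; exists k, t.
Qed.

(** There are four sides, of length r sqrt 2, which is estimated by [2 * r]. *)
Lemma contour_integral_bound g (r M : R) : 0 <= r -> 0 <= M ->
  (forall z, on_contour r z -> ccont g z) ->
  (forall z, on_contour r z -> cabs (g z) <= M) ->
  cabs (contour_integral g r) <= 8 * r * M.
Proof.
move=> r0 M0 gc gM; apply: le_trans (cabs_sum _ _ _) _.
apply: (@le_trans _ _ (\sum_(k < 4) (2 * r * M))); last first.
  by rewrite sumr_const card_ord -mulr_natr; lra.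
apply: ler_sum => k _; apply: (@le_trans _ _ (M * (r * 2))); last lra.
apply: le_trans (segment_integral_bound (seg_cont_contour _ gc) _) _.
  by move=> t t01; apply: gM; exists k, t.
rewrite vertex_diff cabsM cabs_vertex //; apply: ler_wpM2l => //.
by apply: ler_wpM2l => //; apply: le_trans (cabsB _ _) _; rewrite cabs_i cabs1; lra.
Qed.

Lemma vertexD4 (r : R) k : vertex r (k + 4) = vertex r k.
Proof.
have i4 : 'i ^+ 4 = 1 :> R[i].
  by rewrite -[4%N]/(2 * 2)%N exprM sqr_i sqrrN expr1n.
by rewrite /vertex exprD i4 mulr1.
Qed.

Lemma contour_integral_derivative g G (r : R) :
  (forall z, on_contour r z -> cdiff G z (g z)) -> contour_integral g r = 0.
Proof.
move=> Gg; have E (k : 'I_4) : true -> segment_integral g (vertex r k) (vertex r k.+1) =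
    G (vertex r k.+1) - G (vertex r k).
  by move=> _; apply: segment_integral_derivative => t t01; apply: Gg; exists k, t.
rewrite /contour_integral (eq_bigr _ E) !big_ord_recr big_ord0 /=.
by rewrite -(vertexD4 r 0) add0n; ring.
Qed.

Lemma contour_bounded g (r : R) : (forall z, on_contour r z -> ccont g z) ->
  exists2 M : R, 0 < M & forall z, on_contour r z -> cabs (g z) <= M.
Proof.
move=> gc.
have edge k : exists M : R, forall t : R, 0 <= t <= 1 ->
    cabs (g (seg (vertex r k) (vertex r k.+1) t)) <= M.
  pose c t := g (seg (vertex r k) (vertex r k.+1) t).
  (* The second coordinate of the squares is idle: this is bisection of [0, 1]. *)
  pose Q (a b s : R) := exists M : R, forall t : R, a <= t <= a + s -> cabs (c t) <= M.
  suff [M h] : Q 0 0 1 by exists M => t t01; apply: h; rewrite add0r.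
  apply: (square_bisection (Q := Q)).
    move=> a b s s0 _ _ _ _ [M h] [N h'] _ _; exists (Num.max M N) => t /andP[t0 t1].
    rewrite le_max; have [ts|ts] := leP t (a + s / 2).
      by rewrite h ?t0.
    by rewrite h' ?orbT // (ltW ts) /=; lra.
  move=> a0 b0 a01 _; have := seg_cont_contour k gc a01.
  move=> /(_ 1 ltr01)[d d0 dg].
  pose l := cabs (vertex r k.+1 - vertex r k) + 1.
  have l0 : 0 < l by rewrite /l; have := cabs_ge0 (vertex r k.+1 - vertex r k); lra.
  exists (d / l); first by rewrite divr_gt0.
  move=> a b s /andP[s0]; rewrite ltr_pdivlMr // => sd _ h1 _ _ _ _.
  exists (cabs (c a0) + 1) => t t1.
  have ta : `|t - a0| <= s by rewrite ler_norml; lra.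
  have : cabs (c t - c a0) < 1.
    apply: dg; rewrite seg_diff cabsM cabs_real; apply: le_lt_trans sd.
    by apply: ler_pM => //; [exact: cabs_ge0|rewrite /l; lra].
  have := cabs_sub (c t) (c a0); lra.
have [M0 h0] := edge 0%N; have [M1 h1] := edge 1%N.
have [M2 h2] := edge 2%N; have [M3 h3] := edge 3%N.
pose M := Num.max (Num.max M0 M1) (Num.max (Num.max M2 M3) 1).
exists M; first by rewrite /M !lt_max ltr01 !orbT.
move=> _ [k [t [t01 ->]]].
(* In [on_contour] the index of a side is any natural number; the vertices have period 4. *)
have kE : exists2 j, (j < 4)%N & seg (vertex r k) (vertex r k.+1) t = seg (vertex r j) (vertex r j.+1) t.
  exists (k %% 4)%N; first by rewrite ltn_mod.
  rewrite !seg_vertex {1}(divn_eq k 4); congr (_ * _).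
  elim: (k %/ 4)%N => [|n IH]; first by rewrite mul0n add0n.
  by rewrite mulSn -addnA addnC vertexD4.
have [j j4 ->] := kE; rewrite /M !le_max.
by case: j j4 => [|[|[|[|//]]]] _; rewrite ?h0 ?h1 ?h2 ?h3 ?orbT.
Qed.

End Contour.

(** * Cauchy's integral formula on a square *)

Section Cauchy.
Context {R : realType}.
Implicit Types (a b z w : R[i]) (f g h q : R[i] -> R[i]) (D : set R[i]).

Lemma convexC_halfplane w (mu : R[i]) : convexC [set z | 0 < complex.Re ((z - w) * mu)].
Proof.
move=> x y /= xp yp t /andP[t0 t1].
have -> : (seg x y t - w) * mu = (1 - t)%:C * ((x - w) * mu) + t%:C * ((y - w) * mu).
  by rewrite /seg rmorphB /=; ring.
have ReM (s : R) z : complex.Re (s%:C * z) = s * complex.Re z.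
  by case: z => u v /=; rewrite mul0r subr0.
rewrite raddfD /= !ReM; have [->|tn0] := eqVneq t 0; first by lra.
have tp : 0 < t by rewrite lt_def tn0.
by nra.
Qed.

Lemma convexCI D D' : convexC D -> convexC D' -> convexC (D `&` D').
Proof. by move=> cD cD' z w [? ?] [? ?] t t01; split; [exact: cD|exact: cD']. Qed.

(** At the vertex [w] only continuity is available. The half plane contains the side [ab] but not
    [w]; Goursat's theorem in it allows the triangle to be shrunk towards [w], where [q] is bounded
    and the perimeter tends to 0. *)
Lemma triangle_exceptional D q w a b (mu : R[i]) : convexC D ->
  (forall z, D z -> ccont q z) ->
  (forall z, D z -> z != w -> exists d, cdiff q z d) -> D w -> D a -> D b ->
  0 < complex.Re ((a - w) * mu) -> 0 < complex.Re ((b - w) * mu) ->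
  triangle_integral q w a b = 0.
Proof.
move=> cD qc qd Dw Da Db aw bw.
pose D' := D `&` [set z | 0 < complex.Re ((z - w) * mu)].
have cD' : convexC D' by apply: convexCI => //; exact: convexC_halfplane.
have D'd z : D' z -> exists d, cdiff q z d.
  move=> [Dz /= zw]; apply: qd => //; apply: contraTneq zw => ->.
  by rewrite subrr mul0r /= ltxx.
have shrink (s : R) : 0 < s <= 1 -> triangle_integral q w a b =
    triangle_integral q w (seg w a s) (seg w b s).
  move=> /andP[s0 s1]; have s01 : 0 <= s <= 1 by rewrite ltW.
  have Das : D (seg w a s) by exact: cD.
  have Dbs : D (seg w b s) by exact: cD.
  have ReM z : complex.Re (s%:C * z) = s * complex.Re z.
    by case: z => u v /=; rewrite mul0r subr0.
  have D'a : D' a by [].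
  have D'b : D' b by [].
  have D'as : D' (seg w a s).
    by split=> //=; rewrite /seg addrC addKr -mulrA ReM mulr_gt0.
  have D'bs : D' (seg w b s).
    by split=> //=; rewrite /seg addrC addKr -mulrA ReM mulr_gt0.
  have T1 := goursat cD' D'd D'as D'a D'b.
  have T2 := goursat cD' D'd D'as D'b D'bs.
  have S x y : D x -> D y -> seg_cont q x y by exact: seg_cont_convex.
  have W := segment_integral_split (S _ _ Dw Da) s01.
  have V := segment_integral_split (S _ _ Dw Db) s01.
  move: T1 T2; rewrite /triangle_integral W.
  rewrite (segment_integral_rev (S _ _ Dw Db)) V.
  rewrite (segment_integral_rev (S _ _ Das Db)) (segment_integral_rev (S _ _ Das Dbs)).
  rewrite (segment_integral_rev (S _ _ Dbs Db)) (segment_integral_rev (S _ _ Dw Dbs)).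
  move=> T1 T2; apply/eqP; rewrite -subr_eq0; apply/eqP.
  by rewrite -[RHS]addr0 -{1}T1 -T2; ring.
apply/eqP; rewrite -cabs_eq0 eq_le cabs_ge0 andbT.
apply/ler_addgt0Pr => e e0; rewrite add0r.
pose L := cabs (a - w) + cabs (b - w) + 1.
have a0 := cabs_ge0 (a - w); have b0 := cabs_ge0 (b - w).
have L0 : 0 < L by rewrite /L; lra.
have [d d0 dq] := qc w Dw 1 ltr01.
pose M := cabs (q w) + 1.
have M0 : 0 < M by rewrite /M; have := cabs_ge0 (q w); lra.
(* The second term keeps the small triangle in the disc where [q] is bounded by [M]; the third makes
   its three sides, of length at most [s * L], contribute at most [e]. *)
pose s := Num.min 1 (Num.min (d / 2 / L) (e / (3 * M * L))).
have s0 : 0 < s.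
  by rewrite !lt_min ltr01 !divr_gt0 //= !mulr_gt0.
have s1 : s <= 1 by rewrite ge_min lexx.
have sd : s * L <= d / 2.
  by rewrite -ler_pdivlMr // /s !ge_min lexx !orbT.
have se : s * (3 * M * L) <= e.
  by rewrite -ler_pdivlMr ?mulr_gt0 // /s !ge_min lexx !orbT.
rewrite (shrink s); last by rewrite s0.
have s01 : 0 <= s <= 1 by rewrite ltW.
have Das : D (seg w a s) by exact: cD.
have Dbs : D (seg w b s) by exact: cD.
pose B := [set z | cabs (z - w) < d].
have cB : convexC B by exact: convexC_disc.
have Bw : B w by rewrite /B /= subrr cabs0.
have Bs z : cabs (z - w) <= L -> B (seg w z s).
  move=> zL; rewrite /B /= /seg addrC addKr cabsM cabs_real gtr0_norm //.
  by have := ler_wpM2l (ltW s0) zL; lra.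
have Ba : B (seg w a s) by apply: Bs; rewrite /L; lra.
have Bb : B (seg w b s) by apply: Bs; rewrite /L; lra.
have bnd x y : D x -> D y -> B x -> B y -> cabs (segment_integral q x y) <= M * cabs (y - x).
  move=> Dx Dy Bx By; apply: segment_integral_bound.
    exact: seg_cont_convex Dx Dy.
  move=> t t01; have /dq := cB _ _ Bx By t t01.
  by rewrite /M; have := cabs_sub (q (seg x y t)) (q w); lra.
have n1 : cabs (seg w a s - w) <= s * L.
  rewrite /seg addrC addKr cabsM cabs_real gtr0_norm //; apply: ler_wpM2l; first exact: ltW.
  by rewrite /L; lra.
have n2 : cabs (w - seg w b s) <= s * L.
  rewrite cabsC /seg addrC addKr cabsM cabs_real gtr0_norm //; apply: ler_wpM2l; first exact: ltW.
  by rewrite /L; lra.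
have n3 : cabs (seg w b s - seg w a s) <= s * L.
  have -> : seg w b s - seg w a s = s%:C * ((b - w) - (a - w)) by rewrite /seg; ring.
  rewrite cabsM cabs_real gtr0_norm //; apply: ler_wpM2l; first exact: ltW.
  by apply: le_trans (cabsB _ _) _; rewrite /L; lra.
have := bnd _ _ Dw Das Bw Ba; have := bnd _ _ Das Dbs Ba Bb; have := bnd _ _ Dbs Dw Bb Bw.
have := ler_wpM2l (ltW M0) n1; have := ler_wpM2l (ltW M0) n2; have := ler_wpM2l (ltW M0) n3.
move=> p1 p2 p3 q1 q2 q3; rewrite /triangle_integral.
apply: le_trans (cabsD _ _) _.
have := cabsD (segment_integral q w (seg w a s)) (segment_integral q (seg w a s) (seg w b s)).
have E : s * (3 * M * L) = 3 * (M * (s * L)) by ring.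
by rewrite E in se; lra.
Qed.

Definition holomorphic_disc f (r : R) := forall z, cabs z < r -> exists d, cdiff f z d.

(** The slope [q] of [f] at [w] is continuous at [w] and differentiable elsewhere, so its integral
    vanishes on the four triangles with apex [w] over the sides of the square. *)
Lemma cauchy_integral f (r1 r : R) w : holomorphic_disc f r1 -> 0 < r < r1 ->
  cabs w < r / 2 ->
  contour_integral (fun z => f z / (z - w)) r =
  f w * contour_integral (fun z => (z - w)^-1) r.
Proof.
move=> fh /andP[r0 rr1] wr.
have wr1 : cabs w < r1 by lra.
have [dw fw] := fh w wr1.
pose D := [set z : R[i] | cabs (z - 0) < r1].
have cD : convexC D by exact: convexC_disc.
have Dr z : cabs z < r1 -> D z by rewrite /D /= subr0.
have rD z : D z -> cabs z < r1 by rewrite /D /= subr0.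
pose q z := if z == w then dw else (f z - f w) / (z - w).
have qd z : D z -> z != w -> exists d, cdiff q z d.
  move=> /rD zr zw; have [d fz] := fh z zr.
  have zw0 : 0 < cabs (z - w) by rewrite cabs_gt0 subr_eq0.
  have h0 : cdiff (fun x => x - w) z (1 - 0) by apply: cdiffB; [exact: cdiff_id|exact: cdiff_cst].
  have h1 : cdiff (fun x => f x - f w) z (d - 0) by apply: cdiffB => //; exact: cdiff_cst.
  have h2 := cdiffV (f := fun x => x - w) _ h0.
  eexists; apply: cdiff_near zw0 _ (cdiffM h1 (h2 _)); last by rewrite subr_eq0.
  move=> x; rewrite /q; case: eqVneq => // ->.
  by rewrite cabsC ltxx.
have qc z : D z -> ccont q z.
  move=> Dz; have [->|zw] := eqVneq z w; last by have [d /cdiff_cont] := qd z Dz zw.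
  have [p [pE pc pw]] := fw.
  suff -> : q = p by [].
  apply/funext => x; rewrite /q; case: eqVneq => [->//|xw].
  by rewrite pE mulfK // subr_eq0.
have vr k : D (vertex r k) by apply: Dr; rewrite cabs_vertex // ltW.
have S x y : D x -> D y -> seg_cont q x y by exact: seg_cont_convex.
have Dw := Dr w wr1.
have T k : triangle_integral q w (vertex r k) (vertex r k.+1) = 0.
  have Rew : `|complex.Re (w * (1 - 'i) / 'i ^+ k)| < r.
    apply: le_lt_trans (cabs_Re _) _; rewrite !cabsM cabsV cabsX cabs_i expr1n invr1 mulr1.
    have : cabs (1 - 'i : R[i]) <= 2 by apply: le_trans (cabsB _ _) _; rewrite cabs_i cabs1; lra.
    by have := cabs_ge0 w; nra.
  have ik : 'i ^+ k != 0 :> R[i] by rewrite expf_neq0 // eq_complex /= oner_eq0 andbF.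
  have ReB (x y : R[i]) : complex.Re (x - y) = complex.Re x - complex.Re y.
    by case: x y => [? ?] [? ?].
  have Rv z : complex.Re (r%:C * z) = r * complex.Re z.
    by case: z => u v /=; rewrite mul0r subr0.
  (* The [k]-th side lies on the line where [z * ((1 - 'i) / 'i ^+ k)] has real part [r], while [w]
     gives less than [r], as the modulus of [1 - 'i] is at most 2 and [cabs w < r / 2]. *)
  apply: (@triangle_exceptional D q w _ _ ((1 - 'i) / 'i ^+ k)) => //.
  - have -> : (vertex r k - w) * ((1 - 'i) / 'i ^+ k) = r%:C * (1 - 'i) - w * (1 - 'i) / 'i ^+ k.
      by rewrite /vertex; field.
    by rewrite ReB Rv /=; move: Rew; rewrite ltr_norml; lra.
  - have -> : (vertex r k.+1 - w) * ((1 - 'i) / 'i ^+ k) = r%:C * (1 + 'i) - w * (1 - 'i) / 'i ^+ k.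
      rewrite /vertex exprSr; have ii : 'i * 'i = -1 :> R[i] by rewrite -expr2 sqr_i.
      have -> : r%:C * (1 + 'i) = r%:C * ('i - 'i * 'i) by rewrite ii; ring.
      by field.
    by rewrite ReB Rv /=; move: Rew; rewrite ltr_norml; lra.
have q0 : contour_integral q r = 0.
  rewrite /contour_integral.
  (* Each side is traded for two segments from [w], and the sum telescopes around the square. *)
  have E (k : 'I_4) : true -> segment_integral q (vertex r k) (vertex r k.+1) =
      segment_integral q w (vertex r k.+1) - segment_integral q w (vertex r k).
    move=> _; have := T k; rewrite /triangle_integral.
    rewrite (segment_integral_rev (S _ _ Dw (vr k.+1))) => /eqP.
    by rewrite subr_eq0 => /eqP <-; ring.
  by rewrite (eq_bigr _ E) !big_ord_recr big_ord0 /= -(vertexD4 r 0) add0n;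
    move: (segment_integral q w) => J; ring.
have r_ge0 : 0 <= r by lra.
have cw z : on_contour r z -> z != w.
  by move=> /(on_contour_bound r_ge0); apply: contraTneq => ->; lra.
have cD' z : on_contour r z -> D z.
  by move=> /(on_contour_bound r_ge0) h; apply: Dr; lra.
have ic z : on_contour r z -> ccont (fun x => (x - w)^-1) z.
  move=> /cw zw; apply: ccontV; last by rewrite subr_eq0.
  by apply: ccontB; [exact: ccont_id|exact: ccont_cst].
rewrite -[RHS]add0r -q0 -contour_integral_comb //; last by move=> z /cD'; exact: qc.
apply: contour_integral_eq => z cz; last first.
  by rewrite /q (negPf (cw z cz)); field; rewrite subr_eq0 cw.
by apply: ccontM; [have [d /cdiff_cont] := fh z (rD _ (cD' z cz))|exact: ic].
Qed.

(** This is 2 pi i, as four times the integral of dz / z over one side of the square. *)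
Definition kappa : R[i] := 4 * segment_integral (@GRing.inv _) 1 'i.

Lemma seg_cont_inv : seg_cont (@GRing.inv _) 1 ('i : R[i]).
Proof.
have v0 : vertex 1 0 = 1 :> R[i] by rewrite /vertex rmorph1 mul1r expr0.
have v1 : vertex 1 1 = 'i :> R[i] by rewrite /vertex rmorph1 mul1r expr1.
have := @seg_cont_contour R (@GRing.inv _) 1 0; rewrite v0 v1; apply.
move=> z /(on_contour_bound ler01)/andP[h _]; apply: ccontV; first exact: ccont_id.
by rewrite -cabs_gt0; lra.
Qed.

(** The form dz / z is invariant under rotation and scaling, so all sides of all the squares
    contribute equally. *)
Lemma contour_inv (r : R) : 0 < r -> contour_integral (@GRing.inv _) r = kappa.
Proof.
move=> r0; have ec := seg_cont_inv.
have [F Fp] := primitive01_exists ec.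
rewrite /kappa (segment_integralE Fp) /contour_integral.
have i0 : 'i != 0 :> R[i] by rewrite eq_complex /= oner_eq0 andbF.
have E (k : 'I_4) : true -> segment_integral (@GRing.inv _) (vertex r k) (vertex r k.+1) =
    ('i - 1) * (F 1 - F 0).
  move=> _; have v0 : vertex r k != 0 by rewrite -cabs_gt0 cabs_vertex // ltW.
  rewrite (@segment_integralE _ _ _ _ (fun t => (vertex r k)^-1 * F t)).
    by rewrite vertex_diff; field.
  have := primitive01_comb ((vertex r k)^-1 - 1) Fp Fp.
  have -> : (fun t => F t + ((vertex r k)^-1 - 1) * F t) = (fun t => (vertex r k)^-1 * F t).
    by apply/funext => t; ring.
  apply: primitive01_ext => t t01 /=; rewrite seg_vertex [RHS]invfM.
  by rewrite /seg; ring.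
by rewrite (eq_bigr _ E) sumr_const card_ord mulr_natl.
Qed.

Lemma kappa_neq0 : kappa != 0.
Proof.
have [F Fp] := primitive01_exists seg_cont_inv.
rewrite /kappa (segment_integralE Fp).
have c4 : 4 != 0 :> R[i] by rewrite pnatr_eq0.
rewrite mulf_neq0 //.
(* The integrand (i - 1) / ((1 - t) + i t) = (2 t - 1 + i) / ((1 - t)^2 + t^2)
   stays at distance less than 4 from 4i. *)
pose c t := ('i - 1) * (seg 1 'i t)^-1 + (-1) * (4 * 'i) :> R[i].
have Cp : primitive01 c (fun t => ('i - 1) * F t + (-1) * (t%:C * (4 * 'i))).
  have Ip : primitive01 (fun=> 4 * 'i : R[i]) (fun t => t%:C * (4 * 'i)).
    move=> t _ e e0; exists 1 => // s _ _.
    have -> : s%:C * (4 * 'i) - t%:C * (4 * 'i) - (s - t)%:C * (4 * 'i) = 0 :> R[i].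
      by rewrite rmorphB; ring.
    by rewrite cabs0 mulr_ge0 // ltW.
  have := primitive01_comb ('i - 1 - 1) Fp Fp => Fp'.
  have := primitive01_comb (-1) Fp' Ip.
  set A := (X in primitive01 X _); set B := (X in primitive01 _ X).
  have -> : A = c by apply/funext => t; rewrite /A /c /=; ring.
  by have -> : B = (fun t => ('i - 1) * F t + (-1) * (t%:C * (4 * 'i)))
    by apply/funext => t; rewrite /B /=; ring.
(* The squared distance to 4i is 16 - 6 / d with 0 < d <= 1, so at most 10; any constant from sqrt
   10 up to, but excluding, 4 would do. *)
have := primitive01_bound Cp (M := 7 / 2).
have -> : (('i - 1) * F 1 + -1 * (1%:C * (4 * 'i)) - (('i - 1) * F 0 + -1 * (0%:C * (4 * 'i)))) =
  ('i - 1) * (F 1 - F 0) - 4 * 'i by rewrite rmorph1 rmorph0; ring.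
move=> h; apply: contra_not_neq (_ : ~ (4 <= 7 / 2 :> R)); last by lra.
move=> J0; have := h _; rewrite J0 sub0r cabsN cabsM cabs_i mulr1.
have -> : cabs (4 : R[i]) = 4.
  by rewrite -[4 : R[i]](rmorph_nat (real_complex R)) cabs_real ger0_norm.
apply=> t t01; rewrite /c.
have -> : seg 1 'i t = ((1 - t) +i* t)%C :> R[i].
  by apply/eqP; rewrite eq_complex /=; apply/andP; split; apply/eqP; ring.
pose d := (1 - t) ^+ 2 + t ^+ 2.
have d0 : 0 < d <= 1 by rewrite /d; nra.
have d1 : d != 0 by lra.
have -> : ('i - 1) * ((1 - t) +i* t)%C^-1 + -1 * (4 * 'i) = (((2 * t - 1) / d) +i* (d^-1 - 4))%C :> R[i].
  have -> : ((1 - t) +i* t)%C^-1 = (((1 - t) / d) -i* (t / d))%C :> R[i] by [].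
  apply/eqP; rewrite eq_complex /=; apply/andP; split; apply/eqP; by field.
rewrite cabsE /= -(@ler_pXn2r _ 2) ?nnegrE ?sqrtr_ge0 // sqr_sqrtr; last first.
  by rewrite addr_ge0 ?sqr_ge0.
have -> : ((2 * t - 1) / d) ^+ 2 + (d^-1 - 4) ^+ 2 = 16 - 6 / d.
  have E : (2 * t - 1) ^+ 2 = 2 * d - 1 by rewrite /d; ring.
  by rewrite expr_div_n E; field.
have : 1 <= d^-1 by rewrite invf_ge1; lra.
lra.
Qed.

End Cauchy.

(** * Taylor expansions and local behaviour *)

Section Taylor.
Context {R : realType}.
Implicit Types (z w : R[i]) (f g h : R[i] -> R[i]).

(** Coefficients and remainders carry a factor [kappa]; the remainder of order 0 is the Cauchy
    integral itself. *)
Definition taylor_coef g (r : R) k := contour_integral (fun z => g z / z ^+ k.+1) r.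
Definition taylor_rem g (r : R) m w :=
  contour_integral (fun z => g z / (z ^+ m * (z - w))) r.

Section Fixed.
Variables (g : R[i] -> R[i]) (r M : R).
Hypotheses (r0 : 0 < r) (M0 : 0 <= M).
Hypothesis gc : forall z, on_contour r z -> ccont g z.
Hypothesis gM : forall z, on_contour r z -> cabs (g z) <= M.

Let on_r z : on_contour r z -> r / 2 <= cabs z <= r.
Proof. exact: on_contour_bound (ltW r0). Qed.

Let on0 z : on_contour r z -> z != 0.
Proof. by move=> /on_r h; rewrite -cabs_gt0; move: h r0; lra. Qed.

Let onw z w : on_contour r z -> cabs w < r / 2 -> r / 2 - cabs w <= cabs (z - w).
Proof. by move=> /on_r h wr; have := cabs_sub z w; lra. Qed.

Let onw0 z w : on_contour r z -> cabs w < r / 2 -> z - w != 0.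
Proof. by move=> cz wr; have := onw cz wr; rewrite -cabs_gt0; move: wr; lra. Qed.

Let ccont_rem z w m : on_contour r z -> cabs w < r / 2 ->
  ccont (fun x => g x / (x ^+ m * (x - w))) z.
Proof.
move=> cz wr; apply: ccontM; first exact: gc.
apply: ccontV; last by rewrite mulf_neq0 ?onw0 // expf_neq0 // on0.
apply: ccontM; first by apply: ccontX; exact: ccont_id.
by apply: ccontB; [exact: ccont_id|exact: ccont_cst].
Qed.

Let ccont_coef z k : on_contour r z -> ccont (fun x => g x / x ^+ k.+1) z.
Proof.
move=> cz; apply: ccontM; first exact: gc.
by apply: ccontV; [apply: ccontX; exact: ccont_id|rewrite expf_neq0 // on0].
Qed.

(** Integrate the identity 1 / (z^m (z - w)) = 1 / z^(m+1) + w / (z^(m+1) (z - w)). *)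
Lemma taylor_remS m w : cabs w < r / 2 ->
  taylor_rem g r m w = taylor_coef g r m + w * taylor_rem g r m.+1 w.
Proof.
move=> wr; rewrite -contour_integral_comb.
- apply: contour_integral_eq => z cz; first exact: ccont_rem.
  rewrite !exprS; have := on0 cz; have := onw0 cz wr; have : z ^+ m != 0 by rewrite expf_neq0 // on0.
  by move: (z ^+ m) => X X0 zw0 z0; field; rewrite X0 zw0 z0.
- by move=> z cz; exact: ccont_coef.
- by move=> z cz; exact: ccont_rem.
Qed.

Lemma taylor_expansion m w : cabs w < r / 2 ->
  taylor_rem g r 0 w = \sum_(k < m) taylor_coef g r k * w ^+ k + w ^+ m * taylor_rem g r m w.
Proof.
move=> wr; elim: m => [|m IH]; first by rewrite big_ord0 add0r mul1r.
by rewrite IH taylor_remS // big_ord_recr /= exprSr; ring.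
Qed.

Lemma taylor_rem_bound m w : cabs w < r / 2 ->
  cabs (taylor_rem g r m w) <= 8 * r * (M * ((2 / r) ^+ m / (r / 2 - cabs w))).
Proof.
move=> wr; have d0 : 0 < r / 2 - cabs w by lra.
have p0 : 0 <= (2 / r) ^+ m by rewrite exprn_ge0 // divr_ge0 // ltW.
apply: contour_integral_bound; first exact: ltW.
- by rewrite mulr_ge0 // divr_ge0 // ltW.
- by move=> z cz; exact: ccont_rem.
move=> z cz; rewrite cabsM cabsV cabsM cabsX.
apply: ler_pM; rewrite ?cabs_ge0 ?invr_ge0 ?mulr_ge0 ?exprn_ge0 ?cabs_ge0 //; first exact: gM.
rewrite invfM -exprVn; have z0 : 0 < cabs z by rewrite cabs_gt0 on0.
apply: ler_pM; rewrite ?invr_ge0 ?exprn_ge0 ?cabs_ge0 ?invr_ge0 ?cabs_ge0 //.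
  apply: lerXn2r; rewrite ?nnegrE ?invr_ge0 ?cabs_ge0 //.
    by rewrite divr_ge0 // ltW.
  by rewrite -[2 / r]invf_div lef_pV2 ?posrE ?divr_gt0 //; have /andP[] := on_r cz.
rewrite lef_pV2 ?posrE //; first exact: onw.
by rewrite cabs_gt0 onw0.
Qed.

Lemma taylor_rem_lip m w w' : cabs w < r / 2 -> cabs w' < r / 2 ->
  cabs (taylor_rem g r m w - taylor_rem g r m w') <=
  8 * r * (M * ((2 / r) ^+ m / (r / 2 - cabs w) / (r / 2 - cabs w')) * cabs (w - w')).
Proof.
move=> wr wr'; have d0 : 0 < r / 2 - cabs w by lra.
have d0' : 0 < r / 2 - cabs w' by lra.
have p0 : 0 <= (2 / r) ^+ m by rewrite exprn_ge0 // divr_ge0 // ltW.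
have -> : taylor_rem g r m w - taylor_rem g r m w' = taylor_rem g r m w + (-1) * taylor_rem g r m w' by ring.
have cw z : on_contour r z -> ccont (fun x => g x / (x ^+ m * (x - w))) z by move=> cz; exact: ccont_rem.
have cw' z : on_contour r z -> ccont (fun x => g x / (x ^+ m * (x - w'))) z by move=> cz; exact: ccont_rem.
rewrite -contour_integral_comb //; apply: contour_integral_bound; first exact: ltW.
- by rewrite !mulr_ge0 ?cabs_ge0 ?invr_ge0 // ltW.
- move=> z cz; apply: ccontD; first exact: cw.
  by apply: ccontM; [exact: ccont_cst|exact: cw'].
move=> z cz; have z0 := on0 cz; have zw := onw0 cz wr; have zw' := onw0 cz wr'.
have -> : g z / (z ^+ m * (z - w)) + -1 * (g z / (z ^+ m * (z - w'))) =
    g z * (z ^- m / (z - w) / (z - w')) * (w - w').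
  have : z ^+ m != 0 by rewrite expf_neq0.
  by move: (z ^+ m) => X X0; field; rewrite X0 zw zw'.
rewrite !cabsM !cabsV cabsX; apply: ler_wpM2r; first exact: cabs_ge0.
apply: ler_pM; rewrite ?cabs_ge0 ?invr_ge0 ?mulr_ge0 ?invr_ge0 ?exprn_ge0 ?cabs_ge0 //; first exact: gM.
have zc : 0 < cabs z by rewrite cabs_gt0.
apply: ler_pM; rewrite ?invr_ge0 ?mulr_ge0 ?invr_ge0 ?exprn_ge0 ?cabs_ge0 //.
  apply: ler_pM; rewrite ?invr_ge0 ?exprn_ge0 ?cabs_ge0 //.
    rewrite -exprVn; apply: lerXn2r; rewrite ?nnegrE ?invr_ge0 ?cabs_ge0 //.
      by rewrite divr_ge0 // ltW.
    by rewrite -[2 / r]invf_div lef_pV2 ?posrE ?divr_gt0 //; have /andP[] := on_r cz.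
  by rewrite lef_pV2 ?posrE ?cabs_gt0 //; exact: onw.
by rewrite lef_pV2 ?posrE ?cabs_gt0 //; exact: onw.
Qed.

(* The remainder is dominated by a geometric sequence of ratio [2 |w| / r]. *)
Lemma taylor_rem_eq0 (x : R[i]) w : cabs w < r / 2 ->
  (forall m, x = w ^+ m.+1 * taylor_rem g r m.+1 w) -> x = 0.
Proof.
move=> wr xE; apply/eqP; rewrite -cabs_eq0 eq_le cabs_ge0 andbT.
apply/ler_addgt0Pr => e e0; rewrite add0r.
have d0 : 0 < r / 2 - cabs w by lra.
pose q := 2 / r * cabs w; pose C := 8 * r * M / (r / 2 - cabs w) + 1.
have C1 : 0 <= 8 * r * M / (r / 2 - cabs w) by rewrite divr_ge0 ?mulr_ge0 // ltW.
have C0 : 0 < C by rewrite /C; lra.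
have q01 : 0 <= q < 1.
  have -> : q = cabs w / (r / 2) by rewrite /q; field; rewrite gt_eqF.
  have r2 : 0 < r / 2 by rewrite divr_gt0.
  by rewrite divr_ge0 ?cabs_ge0 ?(ltW r2) //= ltr_pdivrMr // mul1r.
have [n qn] := expr_small q01 (divr_gt0 e0 C0).
have /andP[q0 q1] := q01.
have qS : q ^+ n.+1 <= q ^+ n by rewrite exprS ler_piMl ?exprn_ge0 // ltW.
rewrite (xE n) cabsM cabsX.
have := ler_wpM2l (exprn_ge0 n.+1 (cabs_ge0 w)) (taylor_rem_bound n.+1 wr).
move/le_trans; apply.
have -> : cabs w ^+ n.+1 * (8 * r * (M * ((2 / r) ^+ n.+1 / (r / 2 - cabs w)))) =
  q ^+ n.+1 * (8 * r * M / (r / 2 - cabs w)).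
  by rewrite /q [(2 / r * cabs w) ^+ _]exprMn; move: (cabs w ^+ _) ((2 / r) ^+ _) (_ - _)^-1 => X Y D; ring.
move: qn; rewrite ltr_pdivlMr // => qn; apply: le_trans (ltW qn).
by apply: ler_pM => //; [rewrite exprn_ge0|rewrite /C; lra].
Qed.

End Fixed.

(** Taylor expansion in [w] of the Cauchy integral of the constant 1: the coefficient of order 0 is
    [kappa], those of higher order integrate a negative power with a primitive, and the remainders
    tend to 0. *)
Lemma contour_kappa (r : R) w : 0 < r -> cabs w < r / 2 ->
  contour_integral (fun z => (z - w)^-1) r = kappa.
Proof.
move=> r0 wr; have on0 z : on_contour r z -> z != 0.
  by move=> /(on_contour_bound (ltW r0)) h; rewrite -cabs_gt0; move: h r0; lra.
have c1 z : on_contour r z -> ccont (fun=> 1 : R[i]) z by move=> _; exact: ccont_cst.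
have b1 z : on_contour r z -> cabs (1 : R[i]) <= 1 by rewrite cabs1.
have E : contour_integral (fun z => (z - w)^-1) r = taylor_rem (fun=> 1) r 0 w.
  apply: contour_integral_eq => [z cz|z _]; last by rewrite expr0 !mul1r.
  apply: ccontV; first by apply: ccontB; [exact: ccont_id|exact: ccont_cst].
  rewrite -cabs_gt0; have := cabs_sub z w.
  by have := on_contour_bound (ltW r0) cz; lra.
have k0 : taylor_coef (fun=> 1) r 0 = kappa.
  rewrite -(contour_inv r0); apply: contour_integral_eq => [z /on0 z0|z _].
    apply: ccontM; first exact: ccont_cst.
    apply: ccontV; last by rewrite expf_neq0.
    exact: cdiff_cont (cdiffX 1 (cdiff_id z)).
  by rewrite mul1r expr1.
have kS k : taylor_coef (fun=> 1) r k.+1 = 0.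
  apply: (@contour_integral_derivative _ _ (fun z => - k.+1%:R^-1 * (z ^+ k.+1)^-1)).
  move=> z /on0 z0; have k1 : k.+1%:R != 0 :> R[i] by rewrite pnatr_eq0.
  have z1 : z ^+ k.+1 != 0 by rewrite expf_neq0.
  have := cdiffM (cdiff_cst (- k.+1%:R^-1) z) (cdiffV (f := fun x => x ^+ k.+1) z1 (cdiffX k.+1 (cdiff_id z))).
  move=> /cdiff_eq; apply; rewrite /= !exprS.
  have : z ^+ k != 0 by rewrite expf_neq0.
  by move: (z ^+ k) (k.+1%:R : R[i]) k1 => X K K0 X0; field; rewrite K0 X0 z0.
rewrite E; apply/eqP; rewrite -subr_eq0; apply/eqP.
apply: (taylor_rem_eq0 r0 ler01 c1 b1 wr) => m.
rewrite (taylor_expansion r0 c1 m.+1 wr) big_ord_recl k0 expr0 mulr1 big1 /=.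
  by ring.
by move=> k _; rewrite kS mul0r.
Qed.

Lemma taylor_formula f (r1 r : R) m w : holomorphic_disc f r1 -> 0 < r < r1 ->
  cabs w < r / 2 ->
  kappa * f w = \sum_(k < m) taylor_coef f r k * w ^+ k + w ^+ m * taylor_rem f r m w.
Proof.
move=> fh /andP[r0 rr1] wr.
have fc z : on_contour r z -> ccont f z.
  move=> /(on_contour_bound (ltW r0)) h; have [|d /cdiff_cont//] := fh z; lra.
rewrite -(taylor_expansion r0 fc) // mulrC -(contour_kappa r0 wr).
rewrite -(@cauchy_integral _ _ r1) ?r0 //.
apply: contour_integral_eq => z cz; last by rewrite expr0 mul1r.
apply: ccontM; first exact: fc.
apply: ccontV; first by apply: ccontB; [exact: ccont_id|exact: ccont_cst].
rewrite -cabs_gt0; have := cabs_sub z w.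
by have := on_contour_bound (ltW r0) cz; lra.
Qed.

End Taylor.

Section LocalTheory.
Context {R : realType}.
Implicit Types (z w : R[i]) (f g h : R[i] -> R[i]).

(** The coefficients [b] do not depend on the order [m], and the remainder [h] is bounded and
    Lipschitz with one constant. The contour has size [s = r / 2]; the radius [r / 8 = s / 4] keeps
    [w] at a uniform distance from it. *)
Lemma taylor_local f (r : R) : 0 < r -> holomorphic_disc f r ->
  exists2 b : nat -> R[i], (forall k, b k.+1 = 0) -> forall w, cabs w < r / 8 -> f w = b 0%N &
  forall m, exists h (K : R), 0 <= K /\
    forall w, cabs w < r / 8 ->
      [/\ f w = \sum_(k < m) b k * w ^+ k + w ^+ m * h w, cabs (h w) <= K &
        forall w', cabs w' < r / 8 -> cabs (h w - h w') <= K * cabs (w - w')].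
Proof.
move=> r0 fh; pose s := r / 2.
have s0 : 0 < s by rewrite /s; lra.
have sr : 0 < s < r by rewrite s0 /s; lra.
have fc z : on_contour s z -> ccont f z.
  by move=> /(on_contour_bound (ltW s0)) h; have [|d /cdiff_cont//] := fh z; move: h sr; lra.
have [M M0 fM] := contour_bounded fc.
exists (fun k => kappa^-1 * taylor_coef f s k) => [b0 w wr|m].
  have ws : cabs w < s / 2 by rewrite /s; lra.
  apply: (mulfI (kappa_neq0 (R := R))); rewrite mulVKf ?kappa_neq0 //.
  apply/eqP; rewrite -subr_eq0; apply/eqP.
  apply: (taylor_rem_eq0 s0 (ltW M0) fc fM ws) => m.
  rewrite (taylor_formula m.+1 fh sr ws) big_ord_recl expr0 mulr1 big1 /=; first by ring.
  move=> k _; have /eqP := b0 k; rewrite mulf_eq0 invr_eq0 (negPf kappa_neq0) /=.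
  by move=> /eqP ->; rewrite mul0r.
exists (fun w => kappa^-1 * taylor_rem f s m w).
have p0 : 0 <= (2 / s) ^+ m by rewrite exprn_ge0 // divr_ge0 // ltW.
have k0 : 0 < cabs (kappa^-1 : R[i]) by rewrite cabs_gt0 invr_eq0 kappa_neq0.
pose K1 := 8 * s * (M * ((2 / s) ^+ m / (s / 4))).
pose K2 := 8 * s * (M * ((2 / s) ^+ m / (s / 4) / (s / 4))).
have s4 : 0 < s / 4 by lra.
have K10 : 0 <= K1.
  by rewrite /K1 !mulr_ge0 ?invr_ge0 // ltW.
have K20 : 0 <= K2.
  by rewrite /K2 !mulr_ge0 ?invr_ge0 // ltW.
have inv w : cabs w < r / 8 -> 0 < s / 2 - cabs w /\ (s / 2 - cabs w)^-1 <= (s / 4)^-1.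
  move=> wr; have h : s / 4 <= s / 2 - cabs w by rewrite /s in wr *; lra.
  have d0 := lt_le_trans s4 h.
  by split=> //; rewrite lef_pV2 ?posrE.
exists (cabs kappa^-1 * (K1 + K2)); split; first by rewrite mulr_ge0 ?addr_ge0 // ltW.
move=> w wr; have [d0 dle] := inv w wr.
have ws : cabs w < s / 2 by lra.
split.
- apply: (mulfI (kappa_neq0 (R := R))); rewrite (taylor_formula m fh sr ws) mulrDr.
  congr (_ + _); last by rewrite [RHS]mulrCA mulVKf ?kappa_neq0.
  by rewrite mulr_sumr; apply: eq_bigr => k _; rewrite mulrA mulVKf ?kappa_neq0.
- rewrite cabsM; apply: ler_wpM2l; first exact: ltW.
  apply: le_trans (taylor_rem_bound s0 (ltW M0) fc fM m ws) _.
  apply: (@le_trans _ _ K1); last lra.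
  rewrite /K1; apply: ler_wpM2l; first by rewrite mulr_ge0 // ltW.
  by apply: ler_wpM2l; [exact: ltW|exact: ler_wpM2l].
move=> w' wr'; have [d0' dle'] := inv w' wr'.
have ws' : cabs w' < s / 2 by lra.
rewrite -mulrBr cabsM -mulrA; apply: ler_wpM2l; first exact: ltW.
apply: le_trans (taylor_rem_lip s0 (ltW M0) fc fM m ws ws') _.
apply: (@le_trans _ _ (K2 * cabs (w - w'))); last first.
  by apply: ler_wpM2r; [exact: cabs_ge0|lra].
have -> : K2 * cabs (w - w') = 8 * s * (M * ((2 / s) ^+ m / (s / 4) / (s / 4)) * cabs (w - w')).
  by rewrite /K2 [RHS]mulrA.
apply: ler_wpM2l; first by rewrite mulr_ge0 // ltW.
apply: ler_wpM2r; first exact: cabs_ge0.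
apply: ler_wpM2l; first exact: ltW.
apply: ler_pM => //; rewrite ?invr_ge0 ?mulr_ge0 ?invr_ge0 ?(ltW d0) ?(ltW d0') //.
exact: ler_wpM2l.
Qed.

Lemma lip_ccont h z (r K : R) : 0 < r -> 0 <= K ->
  (forall w, cabs (w - z) < r -> cabs (h w - h z) <= K * cabs (w - z)) -> ccont h z.
Proof.
move=> r0 K0 hl e e0; have K1 : 0 < K + 1 by lra.
exists (Num.min r (e / (K + 1))); first by rewrite lt_min r0 divr_gt0.
move=> w; rewrite lt_min ltr_pdivlMr // => /andP[/hl h1 h2].
by apply: le_lt_trans h1 _; have := cabs_ge0 (w - z); lra.
Qed.

Lemma cdiff_lip h z d (r K : R) : 0 < r ->
  (forall w, cabs (w - z) < r -> cabs (h w - h z) <= K * cabs (w - z)) ->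
  cdiff h z d -> cabs d <= K.
Proof.
move=> r0 hl /cdiffP hd; apply/ler_addgt0Pr => e e0.
have [s s0 hs] := hd e e0; pose t := Num.min r s / 2.
have m0 : 0 < Num.min r s by rewrite lt_min r0.
have t0 : 0 < t by rewrite /t; lra.
have : t < Num.min r s by rewrite /t; lra.
rewrite lt_min => /andP[tr ts].
have tE : cabs (z + t%:C - z) = t by rewrite addrC addKr cabs_real gtr0_norm.
have := hl (z + t%:C); have := hs (z + t%:C); rewrite tE => /(_ ts) h1 /(_ tr) h2.
have : cabs (d * (z + t%:C - z)) <= K * t + e * t.
  have -> : d * (z + t%:C - z) = (h (z + t%:C) - h z) - (h (z + t%:C) - h z - d * (z + t%:C - z)) by ring.
  by apply: le_trans (cabsB _ _) _; exact: lerD.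
by rewrite cabsM tE -mulrDl ler_pM2r.
Qed.

(** With [a] the first nonzero coefficient of positive order, f w = f 0 + w^(m+1) (a + w h w). For
    small [w] the term in [a] dominates here, and its derivative dominates in the derivative of
    [f]. *)
Lemma isolated_or_constant f (r : R) : 0 < r -> holomorphic_disc f r ->
  (exists2 s : R, 0 < s & forall w, cabs w < s -> f w = f 0) \/
  (exists2 s : R, 0 < s & forall w, w != 0 -> cabs w < s ->
    f w != f 0 /\ exists2 d, d != 0 & cdiff f w d).
Proof.
move=> r0 fh; have [b bz bP] := taylor_local r0 fh.
have r8 : 0 < r / 8 by lra.
have b0 : f 0 = b 0%N.
  have [h [K [K0 hP]]] := bP 1%N.
  have [|-> _ _] := hP 0; first by rewrite cabs0.
  by rewrite big_ord1 expr0 expr1 mul0r addr0 mulr1.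
have [bz0|/existsNP nz] := pselect (forall k, b k.+1 = 0); [left|right].
  by exists (r / 8) => // w wr; rewrite b0; exact: bz.
have {}nz : exists k, b k.+1 != 0 by have [k /eqP bk] := nz; exists k.
case: (ex_minnP nz) => m bm mmin; pose a := b m.+1.
have a0 : 0 < cabs a by rewrite cabs_gt0.
have [h [K [K0 hP]]] := bP m.+2.
have fE w : cabs w < r / 8 -> f w = f 0 + w ^+ m.+1 * (a + w * h w).
  move=> wr; have [-> _ _] := hP w wr.
  rewrite big_ord_recr big_ord_recl /= -b0 expr0 mulr1 big1 ?addr0.
    by rewrite /a !exprS; ring.
  move=> [k km] _ /=; have [->|nk] := eqVneq (b k.+1) 0; first by rewrite mul0r.
  by have := mmin k nk; rewrite leqNgt km.
(* With [m.+4] and [K + 1] a single inequality serves both estimates: the derivative asks for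
   [cabs w * (m.+3%:R * K)] below [cabs a]. *)
pose s := Num.min (r / 8) (Num.min 1 (cabs a / (m.+4%:R * (K + 1)))).
have K1 : 0 < K + 1 by lra.
have mK0 : 0 < m.+4%:R * (K + 1) by rewrite mulr_gt0.
have s0 : 0 < s by rewrite !lt_min r8 ltr01 divr_gt0.
exists s => // w w0; rewrite !lt_min => /and3P[wr w1 wa].
rewrite ltr_pdivlMr // in wa.
have wp : 0 < cabs w by rewrite cabs_gt0.
have hK x : cabs x < r / 8 -> cabs (h x) <= K by move=> /hP[].
have wK : cabs w * K * m.+4%:R < cabs a.
  by apply: le_lt_trans wa; rewrite -mulrA ler_wpM2l ?cabs_ge0 // mulrC ler_wpM2l //; lra.
have m4 : m.+4%:R = m%:R + 4 :> R by rewrite -natrD addnC.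
have m_ge0 : 0 <= m%:R :> R by rewrite ler0n.
have whK : cabs (w * h w) <= cabs w * K by rewrite cabsM ler_wpM2l ?cabs_ge0 // hK.
have wK0 : 0 <= cabs w * K by rewrite mulr_ge0 ?cabs_ge0.
split.
  rewrite -subr_eq0 fE // addrC addKr mulf_neq0 ?expf_neq0 // -cabs_gt0.
  have -> : a + w * h w = a - (- (w * h w)) by ring.
  have := cabs_sub a (- (w * h w)); rewrite cabsN.
  by rewrite m4 in wK; nra.
have [df fd] : exists d, cdiff f w d by apply: fh; lra.
pose t := Num.min (r / 8 - cabs w) (cabs w).
have t0 : 0 < t by rewrite lt_min wp subr_gt0 wr.
have near x : cabs (x - w) < t -> cabs x < r / 8 /\ x != 0.
  rewrite lt_min => /andP[h1 h2]; split.
    by have := cabs_sub x w; lra.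
  by apply: contraTneq h2 => ->; rewrite sub0r cabsN ltxx.
have hE x : cabs (x - w) < t -> ((f x - f 0) / x ^+ m.+1 - a) / x = h x.
  move=> /near[xr x0]; rewrite fE //.
  have : x ^+ m.+1 != 0 by rewrite expf_neq0.
  by move: (x ^+ m.+1) => X X0; field; rewrite X0 x0.
have wm0 : w ^+ m.+1 != 0 by rewrite expf_neq0.
(* Away from 0 the remainder is a quotient of differentiable functions; its Lipschitz constant
   bounds its derivative. *)
have [dh hd] : exists d, cdiff h w d.
  eexists; apply: cdiff_near t0 hE _.
  apply: cdiffM; last exact: cdiffV w0 (cdiff_id w).
  apply: cdiffB; last exact: cdiff_cst.
  apply: cdiffM; first exact: cdiffB fd (cdiff_cst _ _).
  exact: (cdiffV (f := fun x => x ^+ m.+1) wm0 (cdiffX m.+1 (cdiff_id w))).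
have dhK : cabs dh <= K.
  apply: cdiff_lip t0 _ hd => x /near[xr _].
  by have [_ _] := hP x xr; apply.
have fE' x : cabs (x - w) < t -> f 0 + x ^+ m.+1 * (a + x * h x) = f x.
  by move=> /near[xr _]; rewrite -fE.
have F1 := cdiffD (cdiff_cst a w) (cdiffM (cdiff_id w) hd).
have F2 := cdiffD (cdiff_cst (f 0) w) (cdiffM (cdiffX m.+1 (cdiff_id w)) F1).
have F3 := cdiff_near t0 fE' F2.
eexists; last exact: F3.
rewrite /= add0r mulr1 add0r mul1r.
have -> : m.+1%:R * w ^+ m * (a + w * h w) + w ^+ m.+1 * (h w + w * dh) =
  w ^+ m * (m.+1%:R * a + (w * (m.+2%:R * h w + w * dh))).
  by rewrite exprS -[m.+2%:R]natr1; ring.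
rewrite mulf_neq0 ?expf_neq0 // -cabs_gt0.
have -> : m.+1%:R * a + w * (m.+2%:R * h w + w * dh) = m.+1%:R * a - (- (w * (m.+2%:R * h w + w * dh))) by ring.
have cn k : cabs (k%:R : R[i]) = k%:R.
  by rewrite -(rmorph_nat (real_complex R)) cabs_real ger0_norm.
have c1 : cabs (m.+2%:R * h w + w * dh) <= m.+2%:R * K + K.
  apply: le_trans (cabsD _ _) _; rewrite !cabsM cn; apply: lerD.
    by apply: ler_wpM2l => //; exact: hK.
  by apply: le_trans (ler_pM (cabs_ge0 _) (cabs_ge0 _) (ltW w1) dhK) _; rewrite mul1r.
have c2 := ler_wpM2l (cabs_ge0 w) c1.
have := cabs_sub (m.+1%:R * a) (- (w * (m.+2%:R * h w + w * dh))).
rewrite cabsN [cabs (_ * a)]cabsM cn [cabs (w * _)]cabsM.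
have : cabs w * (m.+2%:R * K + K) < cabs a.
  have -> : m.+2%:R = m%:R + 2 :> R by rewrite -natrD addnC.
  by rewrite m4 in wK; nra.
have : cabs a <= m.+1%:R * cabs a by rewrite ler_peMl ?cabs_ge0 ?ler1n.
by lra.
Qed.

End LocalTheory.

Section LocalBehaviour.
Context {R : realType}.
Implicit Types (z w : R[i]) (f g h : R[i] -> R[i]).

Lemma addsubrK z w : z + (w - z) = w.
Proof. by rewrite addrC subrK. Qed.

Lemma cdiff_shift f z0 w d : cdiff f (z0 + w) d <-> cdiff (fun x => f (z0 + x)) w d.
Proof.
split=> /cdiffP fd; apply/cdiffP => e e0; have [r r0 rf] := fd e e0; exists r => // x xw.
  have E : x - w = z0 + x - (z0 + w) by ring.
  by rewrite E; apply: rf; rewrite -E.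
have E : x - (z0 + w) = x - z0 - w by ring.
by have := rf (x - z0); rewrite -E addsubrK; apply.
Qed.

Definition holomorphic_at f z0 (r : R) :=
  forall z, cabs (z - z0) < r -> exists d, cdiff f z d.

Lemma holomorphic_at_disc f z0 (r : R) : holomorphic_at f z0 r ->
  holomorphic_disc (fun x => f (z0 + x)) r.
Proof.
move=> fh z zr; have [|d fd] := fh (z0 + z); first by rewrite addrC addKr.
by exists d; apply/cdiff_shift.
Qed.

Lemma constant_or_isolated f z0 (r : R) : 0 < r -> holomorphic_at f z0 r ->
  (exists2 s : R, 0 < s & forall z, cabs (z - z0) < s -> f z = f z0) \/
  (exists2 s : R, 0 < s & forall z, z != z0 -> cabs (z - z0) < s ->
    f z != f z0 /\ exists2 d, d != 0 & cdiff f z d).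
Proof.
move=> r0 /holomorphic_at_disc fh.
have [[s s0 fc]|[s s0 fi]] := isolated_or_constant r0 fh; [left|right]; exists s => // z.
  by move=> /fc; rewrite addsubrK addr0.
rewrite -subr_eq0 => zz0 zs; have := fi _ zz0 zs; rewrite addsubrK addr0.
move=> [? [d d0 fd]]; split=> //; exists d => //.
by have := (cdiff_shift f z0 (z - z0) d).2 fd; rewrite addsubrK.
Qed.

(** In the second order expansion, equal values at [x] and [y] give (x - y) d = - ((x - y) (x + y) h
    x + y^2 (h x - h y)). The right hand side is smaller than the left near 0 unless [x = y], as [h]
    is bounded and Lipschitz. *)
Lemma locally_injective f z0 (r : R) d : 0 < r -> holomorphic_at f z0 r ->
  cdiff f z0 d -> d != 0 -> exists2 s : R, 0 < s &
    forall z w, cabs (z - z0) < s -> cabs (w - z0) < s -> f z = f w -> z = w.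
Proof.
move=> r0 /holomorphic_at_disc fh fd d0; set g := fun x => f (z0 + x) in fh.
have gd : cdiff g 0 d by apply/cdiff_shift; rewrite addr0.
have [b _ bP] := taylor_local r0 fh.
have r8 : 0 < r / 8 by lra.
have [h [K [K0 hP]]] := bP 2%N.
have gE w : cabs w < r / 8 -> g w = b 0%N + (w * b 1%N + w ^+ 2 * h w).
  by move=> /hP[-> _ _]; rewrite !big_ord_recr big_ord0 /=; ring.
have bd : b 1%N = d.
  have hc : ccont h 0.
    apply: (lip_ccont r8 K0) => w; rewrite subr0 => wr.
    by have [_ _ /(_ 0)] := hP w wr; rewrite subr0 cabs0; apply.
  (* The slope of [g] at 0, read off from the expansion near 0, shows that [b 1] is a derivative of
     [g]. *)
  apply: cdiff_uniq gd; exists (fun w => if cabs w < r / 8 then b 1%N + w * h w else (g w - g 0) / w).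
  have g0 : g 0 = b 0%N by rewrite gE ?cabs0 //; ring.
  split.
  - move=> w; rewrite subr0; case: ifPn => wr; first by rewrite gE // g0; ring.
    rewrite divfK //; apply: contraNneq wr => ->; by rewrite cabs0.
  - have : ccont (fun w => b 1%N + w * h w) 0.
      by apply: ccontD; [exact: ccont_cst|apply: ccontM => //; exact: ccont_id].
    move=> C e e0; have [t t0 tP] := C e e0.
    exists (Num.min t (r / 8)); first by rewrite lt_min t0.
    by move=> w; rewrite lt_min => /andP[wt]; rewrite subr0 cabs0 r8 => ->; exact: tP.
  - by rewrite cabs0 r8 mul0r addr0.
have dp : 0 < cabs d by rewrite cabs_gt0.
have K1 : 0 < 3 * (K + 1) by lra.
pose s := Num.min (r / 8) (Num.min 1 (cabs d / (3 * (K + 1)))).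
have s0 : 0 < s by rewrite !lt_min r8 ltr01 divr_gt0.
exists s => // z w; rewrite !lt_min => /and3P[zr z1 zd] /and3P[wr w1 wd] fzw.
rewrite ltr_pdivlMr // in zd; rewrite ltr_pdivlMr // in wd.
have shift x : f x = g (x - z0) by rewrite /g addsubrK.
move: fzw zr z1 zd wr w1 wd; rewrite !shift.
have -> : (z = w) = (z - z0 = w - z0).
  by apply/propext; split=> [->//|/addIr].
move: (z - z0) (w - z0) => x y gxy xr x1 xd yr y1 yd.
apply/eqP; rewrite -subr_eq0 -cabs_eq0; apply/negPn/negP => xy0.
have {xy0}xy : 0 < cabs (x - y) by rewrite lt_def xy0 cabs_ge0.
have [_ hx hxy] := hP x xr; have [_ hy _] := hP y yr; have {}hxy := hxy y yr.
have : (x - y) * d = - ((x - y) * ((x + y) * h x) + y ^+ 2 * (h x - h y)).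
  move: gxy; rewrite !gE // bd => /eqP; rewrite -subr_eq0 => /eqP E.
  apply/eqP; rewrite -subr_eq0 -E; apply/eqP; ring.
move=> /(congr1 (@Normc.normc R)); rewrite cabsN cabsM => E.
have := cabsD ((x - y) * ((x + y) * h x)) (y ^+ 2 * (h x - h y)).
rewrite -E [cabs ((x - y) * _)]cabsM [cabs ((x + y) * _)]cabsM [cabs (y ^+ 2 * _)]cabsM cabsX => L.
have h1 : cabs (x + y) * cabs (h x) <= (cabs x + cabs y) * K.
  by apply: ler_pM; rewrite ?cabs_ge0 //; exact: cabsD.
have h2 : cabs y ^+ 2 * cabs (h x - h y) <= cabs y * (K * cabs (x - y)).
  apply: ler_pM => //; rewrite ?exprn_ge0 ?cabs_ge0 //.
  by rewrite expr2 ler_piMr ?cabs_ge0 // ltW.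
have h3 := ler_wpM2l (ltW xy) h1.
have : cabs (x - y) * cabs d <= cabs (x - y) * ((cabs x + cabs y + cabs y) * K).
  by apply: le_trans L _; nra.
rewrite ler_pM2l // => h4.
have := cabs_ge0 x; have := cabs_ge0 y; nra.
Qed.

(** If [c] is not a value, 1 / (f - c) is holomorphic on the disc, and Cauchy's formula bounds it at
    the centre by its size on the contour. This fails when [c] is close to [f z0]. *)
Lemma open_mapping f z0 (r : R) d : 0 < r -> holomorphic_at f z0 r ->
  cdiff f z0 d -> d != 0 -> forall s : R, 0 < s -> exists2 t : R, 0 < t &
    forall c, cabs (c - f z0) < t -> exists2 z, cabs (z - z0) < s & f z = c.
Proof.
move=> r0 fh fd d0 s s0.
have dp : 0 < cabs d by rewrite cabs_gt0.
have d2 : 0 < cabs d / 2 by lra.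
have [u u0 uf] := (cdiffP f z0 d).1 fd _ d2.
pose r1 := Num.min r (Num.min s u).
have r10 : 0 < r1 by rewrite !lt_min r0 s0 u0.
(* On the contour [z] has modulus at least [p / 2] and [f] moves by at least half of [d * z]; this
   gives the lower bound [n] below. *)
pose p := r1 / 2; have p0 : 0 < p by rewrite /p; lra.
have p1 : 0 < p < r1 by rewrite /p; lra.
pose n := cabs d * p / 4; have n0 : 0 < n by rewrite /n divr_gt0 ?mulr_gt0.
have fn z : on_contour p z -> n <= cabs (f (z0 + z) - f z0).
  move=> /(on_contour_bound (ltW p0)) /andP[z1 z2].
  have zu : cabs (z0 + z - z0) < u.
    have ru : r1 <= u by rewrite !ge_min lexx !orbT.
    by rewrite addrC addKr; move: ru z2 p1; lra.
  have := uf _ zu; rewrite [z0 + z - z0]addrC addKr => h.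
  have := cabs_sub (d * z) (- (f (z0 + z) - f z0 - d * z)).
  have -> : d * z - - (f (z0 + z) - f z0 - d * z) = f (z0 + z) - f z0 by ring.
  rewrite cabsN cabsM /n => h'.
  by have := ler_wpM2l (ltW dp) z1; lra.
have kp : 0 < cabs (kappa : R[i]) by rewrite cabs_gt0 kappa_neq0.
(* The first term keeps [f - c] above [n / 2] on the contour. Then Cauchy's formula gives
   [cabs kappa <= 32 / n * cabs (c - f z0)], which the second term contradicts. *)
exists (Num.min (n / 2) (cabs (kappa : R[i]) * n / 64)).
  by rewrite lt_min !divr_gt0 ?mulr_gt0.
move=> c; rewrite lt_min => /andP[c1 c2]; apply: contrapT => nc.
have fc z : cabs z < r1 -> f (z0 + z) - c != 0.
  move=> zr; rewrite subr_eq0; apply/eqP => fz; apply: nc; exists (z0 + z) => //.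
  by rewrite addrC addKr; apply: lt_le_trans zr _; rewrite !ge_min lexx !orbT.
pose g z := (f (z0 + z) - c)^-1.
have gh : holomorphic_disc g r1.
  move=> z zr; have [|df fz] := fh (z0 + z).
    by rewrite addrC addKr; apply: lt_le_trans zr _; rewrite ge_min lexx.
  eexists; apply: (cdiffV (f := fun z => f (z0 + z) - c) (fc z zr)).
  apply: cdiffB; [exact: (cdiff_shift f z0 z df).1 fz|exact: cdiff_cst].
have on0 z : on_contour p z -> z != 0.
  by move=> /(on_contour_bound (ltW p0)) h; rewrite -cabs_gt0; move: h p0; lra.
have gc z : on_contour p z -> ccont g z.
  move=> /(on_contour_bound (ltW p0)) h; have [|dg /cdiff_cont//] := gh z.
  by move: h p1; lra.
have c0 : cabs (0 : R[i]) < p / 2 by rewrite cabs0; lra.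
have := cauchy_integral gh p1 c0; rewrite (contour_kappa p0 c0).
move=> /(congr1 (@Normc.normc R)); rewrite cabsM => E.
have : cabs (contour_integral (fun z => g z / (z - 0)) p) <= 8 * p * (2 / n * (2 / p)).
  apply: contour_integral_bound; first exact: ltW.
  - by rewrite !mulr_ge0 ?invr_ge0 // ltW.
  - move=> z cz; apply: ccontM; first exact: gc.
    apply: ccontV; last by rewrite subr0 on0.
    by apply: ccontB; [exact: ccont_id|exact: ccont_cst].
  move=> z cz; rewrite cabsM subr0; apply: ler_pM; rewrite ?cabs_ge0 //.
    have n2 : 0 < n / 2 by move: n0; lra.
    rewrite /g cabsV -[2 / n]invf_div lef_pV2 ?posrE //.
      have := fn z cz; have := cabs_sub (f (z0 + z) - f z0) (c - f z0).
      have -> : f (z0 + z) - f z0 - (c - f z0) = f (z0 + z) - c by ring.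
      lra.
    rewrite cabs_gt0; apply: fc; have := on_contour_bound (ltW p0) cz.
    by move: p1; lra.
  have p2 : 0 < p / 2 by move: p0; lra.
  rewrite cabsV -[2 / p]invf_div lef_pV2 ?posrE ?cabs_gt0 ?on0 //.
  by have /andP[] := on_contour_bound (ltW p0) cz.
have -> : 8 * p * (2 / n * (2 / p)) = 32 / n by field; rewrite !gt_eqF.
rewrite E /g addr0 cabsV cabsC.
have f0 : 0 < cabs (c - f z0).
  by rewrite cabsC cabs_gt0; have := fc 0; rewrite addr0 cabs0; apply.
rewrite mulrC ler_pdivrMr // mulrAC ler_pdivlMr //.
lra.
Qed.

End LocalBehaviour.

(** * Entire functions of polynomial growth *)

Section Liouville.
Context {R : realType}.
Implicit Types (z w : R[i]) (f g h : R[i] -> R[i]).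

(** Dividing [f z - f 0] by [z] lowers the exponent by one; for exponent 0, the first order Taylor
    remainder tends to 0 as the contour grows. *)
Lemma liouville_polynomial f (M : R) m : (forall z, exists d, cdiff f z d) ->
  (forall z, cabs (f z) <= M * (1 + cabs z) ^+ m) ->
  exists p : {poly R[i]}, forall z, f z = p.[z].
Proof.
elim: m f M => [|m IH] f M fd fM.
  exists (f 0)%:P => z; rewrite hornerC.
  have M0 : 0 <= M by have := fM 0; rewrite expr0 mulr1; apply: le_trans; exact: cabs_ge0.
  apply/eqP; rewrite -subr_eq0 -cabs_eq0 eq_le cabs_ge0 andbT.
  have kp : 0 < cabs (kappa : R[i]) by rewrite cabs_gt0 kappa_neq0.
  rewrite -(ler_pM2l kp) mulr0 -cabsM.
  apply/ler_addgt0Pr => e e0; rewrite add0r.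
  have z0 := cabs_ge0 z.
  have C0 : 0 <= 16 * M * cabs z / e by rewrite divr_ge0 ?mulr_ge0 // ltW.
  (* Chosen so that [r / 2 - cabs z] exceeds [16 * M * cabs z / e]; the remainder is then below
     [e]. *)
  pose r := 2 * (cabs z + 1 + 16 * M * cabs z / e).
  have r0 : 0 < r by rewrite /r; lra.
  have fh : holomorphic_disc f (r + 1) by move=> w _; exact: fd.
  have rr : 0 < r < r + 1 by lra.
  have zr : cabs z < r / 2 by rewrite /r; lra.
  have c0 : cabs (0 : R[i]) < r / 2 by rewrite cabs0; lra.
  have fc w : on_contour r w -> ccont f w by move=> _; have [d /cdiff_cont] := fd w.
  have fM' w : on_contour r w -> cabs (f w) <= M by move=> _; have := fM w; rewrite expr0 mulr1.
  rewrite mulrBr (taylor_formula 1 fh rr zr) (taylor_formula 1 fh rr c0).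
  rewrite !big_ord1 !expr0 !expr1 mul0r addr0 addrC addKr cabsM.
  have h := taylor_rem_bound r0 M0 fc fM' 1 zr.
  apply: le_trans (ler_wpM2l z0 h) _.
  have d0 : 0 < r / 2 - cabs z by lra.
  have -> : cabs z * (8 * r * (M * ((2 / r) ^+ 1 / (r / 2 - cabs z)))) = 16 * M * cabs z / (r / 2 - cabs z).
    have rz : 0 < r + - cabs z * 2 by lra.
    by field; rewrite !gt_eqF.
  rewrite ler_pdivrMr //.
  have -> : r / 2 - cabs z = 1 + 16 * M * cabs z / e by rewrite /r; field; rewrite gt_eqF.
  rewrite mulrDr mulr1 [e * _]mulrC divfK ?gt_eqF //; lra.
have r1 : 0 < (8 : R) by [].
have fh8 : holomorphic_disc f 8 by move=> w _; exact: fd.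
have [b _ bP] := taylor_local r1 fh8.
have [h [K [K0 hP]]] := bP 2%N.
have fE w : cabs w < 1 -> f w = b 0%N + w * (b 1%N + w * h w).
  by move=> wr; have [|-> _ _] := hP w; [lra|rewrite !big_ord_recr big_ord0 /=; ring].
have f0 : f 0 = b 0%N by rewrite fE ?cabs0 //; ring.
(* Near 0 this is [b 1 + w * h w] with [h] continuous, hence differentiable at 0 as well, with
   derivative [h 0]. *)
pose g z := if z == 0 then b 1%N else (f z - f 0) / z.
have gE w : cabs w < 1 -> b 1%N + w * h w = g w.
  rewrite /g => w1; case: eqVneq => [->|w0]; first by ring.
  by rewrite fE // f0; field.
have M0 : 0 <= M by have := fM 0; rewrite cabs0 addr0 expr1n mulr1; apply: le_trans; exact: cabs_ge0.
have gd z : exists d, cdiff g z d.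
  have [->|z0] := eqVneq z 0.
    have hc : ccont h 0.
      apply: (lip_ccont ltr01 K0) => w; rewrite subr0 => wr.
      have w8 : cabs w < 8 / 8 by lra.
      by have [_ _ /(_ 0)] := hP w w8; rewrite subr0 cabs0; apply; lra.
    exists (h 0); apply: (cdiff_near (f := fun w => b 1%N + w * h w) ltr01).
      by move=> w; rewrite subr0; exact: gE.
    by exists h; split=> // w; rewrite mul0r subr0; ring.
  have [d fz] := fd z; have zp : 0 < cabs z by rewrite cabs_gt0.
  eexists; apply: (cdiff_near (f := fun w => (f w - f 0) / w) zp).
    move=> w wz; rewrite /g; case: eqVneq => // w0.
    by move: wz; rewrite w0 sub0r cabsN ltxx.
  apply: cdiffM; last exact: cdiffV z0 (cdiff_id z).
  exact: cdiffB fz (cdiff_cst _ _).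
have gM z : cabs (g z) <= (cabs (b 1%N) + K + 4 * M) * (1 + cabs z) ^+ m.
  have zp := cabs_ge0 z; have b1 := cabs_ge0 (b 1%N).
  have p1 k : 1 <= (1 + cabs z) ^+ k by rewrite exprn_ege1 // lerDl.
  have [z1|z1] := ltP (cabs z) 1.
    rewrite -gE //; apply: le_trans (cabsD _ _) _; rewrite cabsM.
    have hK : cabs (h z) <= K by have [|_ ? _] := hP z; [lra|].
    have : cabs z * cabs (h z) <= K.
      by apply: le_trans hK; rewrite ler_piMl ?cabs_ge0 // ltW.
    have := p1 m; move: (_ ^+ m) => X X1 Y.
    have : (cabs (b 1%N) + K + 4 * M) <= (cabs (b 1%N) + K + 4 * M) * X.
      by rewrite ler_peMr //; lra.
    lra.
  have z0 : z != 0 by rewrite -cabs_gt0; lra.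
  rewrite /g (negPf z0) cabsM cabsV ler_pdivrMr ?cabs_gt0 //.
  apply: le_trans (cabsB _ _) _.
  have := fM z; have := fM 0; rewrite cabs0 addr0 expr1n mulr1 exprS => F0 Fz.
  have := p1 m; move: (_ ^+ m) Fz => X Fz X1.
  have X2 : M * ((1 + cabs z) * X) <= 2 * (M * X * cabs z).
    have -> : M * ((1 + cabs z) * X) = M * X * (1 + cabs z) by ring.
    have := mulr_ge0 M0 (le_trans ler01 X1); nra.
  have X3 : M <= M * X * cabs z.
    by rewrite -mulrA ler_peMr // -[1]mulr1; apply: ler_pM.
  have X4 : 0 <= (cabs (b 1%N) + K) * X * cabs z.
    by rewrite !mulr_ge0 ?addr_ge0 // (le_trans ler01).
  have -> : (cabs (b 1%N) + K + 4 * M) * X * cabs z = (cabs (b 1%N) + K) * X * cabs z + 4 * (M * X * cabs z) by ring.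
  lra.
have [p pE] := IH g _ gd gM.
exists ('X * p + (f 0)%:P) => z; rewrite !hornerE -pE /g.
case: eqVneq => [->|z0]; first by rewrite mul0r add0r.
by field.
Qed.

End Liouville.

(** * Meromorphic functions on a Riemann surface *)

Local Notation coord := Defs.coord.

Section Surface.
Context {R : realType} (S : topologicalType) (A : atlas (R := R) S).
Hypothesis surfA : riemann_surface A.
Implicit Types (F : S -> CP1 (R := R)) (p : S) (i : chart A).

Lemma chart_at p : exists i : chart A, dom i p.
Proof. by have [_ _ _ [_ /(_ p)]] := surfA. Qed.

Lemma chart_nbhs i p (V : set S) : dom i p -> nbhs p V ->
  exists2 r : R, 0 < r & forall z, cabs (z - coord i p) < r -> V (param i z).
Proof.
move=> ip; have [_ _ _ [/(_ i)[_ _ pK _ pc] _] _] := surfA.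
by move=> pV; apply/nbhs_cabs; apply: (pc p ip); rewrite pK.
Qed.

Lemma chart_image i p : dom i p -> exists2 r : R, 0 < r &
  forall z, cabs (z - coord i p) < r -> dom i (param i z) /\ coord i (param i z) = z.
Proof.
move=> ip; have [_ _ _ [/(_ i)[_ oi pK _ _] _] _] := surfA.
have [r r0 rO] := open_cabs oi (imageP _ ip : (coord i @` dom i) (coord i p)).
by exists r => // z /rO [x ix <-]; rewrite pK.
Qed.

Lemma nbhs_chart i p (r : R) : dom i p -> 0 < r ->
  nbhs p [set x | [/\ dom i x, cabs (coord i x - coord i p) < r & param i (coord i x) = x]].
Proof.
move=> ip r0; have [_ _ _ [/(_ i)[oi _ pK cc _] _] _] := surfA.
have h : nbhs p (dom i) by apply: open_nbhs_nbhs.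
have h' : nbhs p [set x | cabs (coord i x - coord i p) < r].
  by apply: (cc p ip [set z | cabs (z - coord i p) < r]); apply/nbhs_cabs; exists r.
by apply: filterS (filterI h h') => x [ix xr]; split=> //; exact: pK.
Qed.

Lemma paramK i p : dom i p -> param i (coord i p) = p.
Proof. by move=> ip; have [_ _ _ [/(_ i)[_ _ pK _ _] _] _] := surfA; exact: pK. Qed.

Let dom1 (j : bool) := dom (j : chart (CP1_atlas (R := R))).
Let coord1 (j : bool) := coord (j : chart (CP1_atlas (R := R))).

Lemma open_CP1_dom (j : bool) : open (dom1 j).
Proof.
case: j; first by apply: one_point_compactification_open_some; exact: openT.
rewrite openE => -[z|] /= z0.
  have zp : 0 < cabs z by rewrite cabs_gt0; apply/eqP => z0'; apply: z0; rewrite z0'.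
  apply/nbhs_cabs; exists (cabs z) => // w wz [] w0; move: wz.
  by rewrite w0 sub0r cabsN ltxx.
exists [set 0].
  split; first exact: compact_set1.
  rewrite -[X in closed X]setCK; apply: open_closedC; rewrite openE => z /= /eqP zn0.
  apply/nbhs_cabs; exists (cabs z); first by rewrite cabs_gt0.
  by move=> w wz wE; move: wz; rewrite wE sub0r cabsN ltxx.
move=> x [[w w0 <-]|->] // [] /w0 [].
Qed.

Lemma coord1_inj (j : bool) x y : dom1 j x -> dom1 j y -> coord1 j x = coord1 j y -> x = y.
Proof.
rewrite /dom1 /coord1; case: j => /=; first by move=> [z _ <-] [w _ <-] /= ->.
case: x => [z|]; case: y => [w|] //= h h'; first by move/invr_inj ->.
  by move/eqP; rewrite invr_eq0 => /eqP z0; rewrite z0 in h; case: h.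
by move/esym/eqP; rewrite invr_eq0 => /eqP z0; rewrite z0 in h'; case: h'.
Qed.

Lemma local_expression F p i (j : bool) : holomorphic A CP1_atlas F -> dom i p -> dom1 j (F p) ->
  exists2 r : R, 0 < r & holomorphic_at (coord1 j \o F \o param i) (coord i p) r /\
    forall z, cabs (z - coord i p) < r -> dom1 j (F (param i z)).
Proof.
move=> [Fc Fd] ip jp.
have [r r0 ri] := chart_image ip.
have : nbhs p (F @^-1` dom1 j).
  by apply: Fc; apply: open_nbhs_nbhs; split => //; exact: open_CP1_dom.
move=> /(chart_nbhs ip)[s s0 sj].
exists (Num.min r s); first by rewrite lt_min r0.
split=> z; rewrite lt_min => /andP[/ri[iz zE] /sj jz] //.
by have := Fd i (j : chart (CP1_atlas (R := R))) _ iz jz; rewrite zE => /derivable_cdiff.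
Qed.

Definition locally_constant_chart F i p := exists2 r : R, 0 < r &
  forall z, cabs (z - coord i p) < r -> F (param i z) = F p.

(** Off the centre the values are finite even if [F p] is infinite, so that [g] is complex valued in
    all cases. *)
Definition punctured_chart F i p := exists2 r : R, 0 < r &
  exists g : R[i] -> R[i], forall z, z != coord i p -> cabs (z - coord i p) < r ->
    [/\ F (param i z) <> F p, F (param i z) = Some (g z) & exists2 d, d != 0 & cdiff g z d].

(** The local alternative for complex functions, read in the chart of the sphere around [F p]. When
    [F p] is infinite that chart is 1/z, and the expression [h] has to be inverted off the centre,
    which keeps the derivative nonzero. *)
Lemma holomorphic_dichotomy F i p : holomorphic A CP1_atlas F -> dom i p ->
  locally_constant_chart F i p \/ punctured_chart F i p.
Proof.
move=> hF ip.
have pp : param i (coord i p) = p by exact: paramK.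
pose j := F p != None.
have jp : dom1 j (F p).
  by rewrite /j /dom1; case: (F p) => [z|] /=; [exists z|].
have [r r0 [hr jr]] := local_expression hF ip jp.
have [[s s0 sc]|[s s0 sn]] := constant_or_isolated r0 hr.
  left; exists (Num.min r s); first by rewrite lt_min r0.
  move=> z; rewrite lt_min => /andP[/jr jz /sc] /=; rewrite pp => E.
  exact: coord1_inj jz jp E.
right; exists (Num.min r s); first by rewrite lt_min r0.
set h := coord1 j \o F \o param i in hr sn.
exists (fun z => if j then h z else (h z)^-1) => z zp.
rewrite lt_min => /andP[/jr jz /(sn z zp)[nz [d d0 hd]]].
have Fz : F (param i z) <> F p by move=> E; move: nz; rewrite /h /= E pp eqxx.
split=> //.
  move: jz Fz; rewrite /h /j /=; case: (F p) => [v|] /=; first by move=> [w _ <-].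
  by case: (F (param i z)) => [w|] //= _ _; rewrite invrK.
case Ej : j; first by exists d.
have hz : h z != 0.
  move: nz; rewrite {2}/h /= pp; move: Ej; rewrite /j => /negbFE/eqP Fp.
  by rewrite Fp /coord1 /=; case: (F p != None).
exists (- d / h z ^+ 2); last exact: cdiffV.
by rewrite mulf_neq0 ?oppr_eq0 // invr_eq0 expf_neq0.
Qed.

Lemma locally_constant_nbhs F i p : dom i p -> locally_constant_chart F i p ->
  nbhs p [set x | F x = F p].
Proof.
move=> ip [r r0 rc]; apply: filterS (nbhs_chart ip r0) => x [ix xr <-].
exact: rc.
Qed.

(* The points near which [F = c] form a set which is open, and closed by the
   dichotomy. *)
Lemma holomorphic_identity F (c : CP1) : holomorphic A CP1_atlas F -> (exists p, F p != c) ->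
  forall p, ~ nbhs p [set x | F x = c].
Proof.
move=> hF [p0 /eqP Fp0] p pc.
pose U : set S := [set x : S | nbhs x [set y | F y = c]].
have Uc x : U x -> F x = c by move=> /nbhs_singleton.
have [_ Sconn _ _ _] := surfA.
suff UT : U = setT by apply: Fp0; apply: Uc; rewrite UT.
apply: Sconn; first by exists p.
- exists U; last by rewrite setTI.
  by rewrite openE => x Ux; apply: nbhs_interior.
- exists U; last by rewrite setTI.
  move=> x clx; have [i ix] := chart_at x.
  have [K|[r r0 [g gP]]] := holomorphic_dichotomy hF ix.
    have nK := locally_constant_nbhs ix K.
    have [y [Uy /= Fy]] := clx _ nK.
    by rewrite /U /= -(Uc y Uy) Fy.
  have [r' r'0 ri] := chart_image ix.
  have m0 : 0 < Num.min r r' by rewrite lt_min r0.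
  have [y [Uy [iy yr yE]]] := clx _ (nbhs_chart ix m0).
  move: yr; rewrite lt_min => /andP[yr yr'].
  have [yx|yx] := eqVneq (coord i y) (coord i x).
    by rewrite -yE yx paramK in Uy.
  have [_ Fy [d d0 gd]] := gP _ yx yr.
  have [s s0 sc] := chart_nbhs iy Uy.
  (* A disc around [y] inside of the punctured disc, on which [F] has the constant value [c]; there
     [g] would have derivative 0. *)
  pose t := Num.min s (Num.min (r - cabs (coord i y - coord i x)) (cabs (coord i y - coord i x))).
  have t0 : 0 < t by rewrite !lt_min s0 subr_gt0 yr cabs_gt0 subr_eq0.
  have gc z : cabs (z - coord i y) < t -> g (coord i y) = g z.
    rewrite !lt_min => /and3P[zs zr zy].
    have zx : z != coord i x by apply: contraTneq zy => ->; rewrite cabsC ltxx.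
    have zr' : cabs (z - coord i x) < r.
      have -> : z - coord i x = (z - coord i y) + (coord i y - coord i x) by ring.
      by apply: le_lt_trans (cabsD _ _) _; lra.
    have [_ Fz _] := gP z zx zr'.
    have := sc z zs; rewrite /= Fz -(Uc y Uy) -{1}yE Fy => -[->] //.
  have := cdiff_uniq gd (cdiff_near t0 gc (cdiff_cst _ _)).
  by move=> dE; rewrite dE eqxx in d0.
Qed.

Lemma nonconstant_punctured F i p : holomorphic A CP1_atlas F ->
  (forall c, exists p, F p != c) -> dom i p -> punctured_chart F i p.
Proof.
move=> hF Fn ip; have [K|//] := holomorphic_dichotomy hF ip.
by have := holomorphic_identity hF (Fn (F p)) (locally_constant_nbhs ip K).
Qed.

Lemma meromorphic_punctured F i p : meromorphic A F -> dom i p ->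
  exists2 r : R, 0 < r & exists g : R[i] -> R[i],
    forall z, z != coord i p -> cabs (z - coord i p) < r ->
    F (param i z) = Some (g z) /\ exists d, cdiff g z d.
Proof.
move=> [hF Fn] ip; have [K|[r r0 [g gP]]] := holomorphic_dichotomy hF ip; last first.
  by exists r => //; exists g => z zp zr; have [_ ? [d _ gd]] := gP z zp zr; split => //; exists d.
have := holomorphic_identity hF Fn (p := p).
have := locally_constant_nbhs ip K; case E : (F p) => [w|] // _ _.
have [r r0 rc] := K; exists r => //; exists (fun=> w) => z _ zr; split; first by rewrite rc // E.
by exists 0; exact: cdiff_cst.
Qed.

End Surface.

(** * Points where [Pi] is a local coordinate *)

Section Regular.
Context {R : realType} (S : topologicalType) (A : atlas (R := R) S).
Hypothesis surfA : riemann_surface A.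
Variables (Pi f : S -> CP1 (R := R)).
Hypotheses (holPi : holomorphic A CP1_atlas Pi) (Pi_nc : forall c, exists p, Pi p != c).
Hypothesis merf : meromorphic A f.

(* The last clause says that, along the fibres of [Pi], the value of [f] has
   derivative [d] with respect to the value of [Pi]. *)
Definition regular_point p := exists u w d : R[i],
  [/\ Pi p = Some u, f p = Some w,
    exists2 V : set S, nbhs p V & set_inj V Pi,
    forall V : set S, nbhs p V -> exists2 t : R, 0 < t &
      forall u', cabs (u' - u) < t -> exists2 x, V x & Pi x = Some u' &
    forall e : R, 0 < e -> nbhs p [set x | forall u' w', Pi x = Some u' -> f x = Some w' ->
      cabs (w' - w - d * (u' - u)) <= e * cabs (u' - u)]].

(** Off [p0] the local expression [g] of [Pi] has nonzero derivative, hence is injective and open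
    there; the derivative of [f] with respect to [Pi] is the quotient of those of [k] and [g]. *)
Lemma punctured_regular p0 : nbhs p0 [set p | p <> p0 -> regular_point p].
Proof.
have [i ip0] := chart_at surfA p0; set z0 := coord i p0.
have [r1 r10 [g gP]] := nonconstant_punctured surfA holPi Pi_nc ip0.
have [r2 r20 [k kP]] := meromorphic_punctured surfA merf ip0.
have [r3 r30 rI] := chart_image surfA ip0.
pose s := Num.min r1 (Num.min r2 r3).
have s0 : 0 < s by rewrite !lt_min r10 r20.
apply: filterS (nbhs_chart surfA ip0 s0) => p [ip ps pE] pp0.
set z := coord i p in ps pE.
have zz0 : z != z0 by apply/eqP => E; apply: pp0; rewrite -pE E paramK.
pose t := Num.min (s - cabs (z - z0)) (cabs (z - z0)).
have t0 : 0 < t by rewrite lt_min subr_gt0 ps cabs_gt0 subr_eq0.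
have near x : cabs (x - z) < t -> [/\ x != z0, Pi (param i x) = Some (g x),
    f (param i x) = Some (k x), exists2 d, d != 0 & cdiff g x d & exists d, cdiff k x d].
  rewrite lt_min => /andP[h1 h2].
  have xz0 : x != z0 by apply: contraTneq h2 => ->; rewrite cabsC ltxx.
  have : cabs (x - z0) < s.
    have -> : x - z0 = (x - z) + (z - z0) by ring.
    by apply: le_lt_trans (cabsD _ _) _; lra.
  rewrite !lt_min => /and3P[xr1 xr2 _].
  by have [_ ? ?] := gP x xz0 xr1; have [? ?] := kP x xz0 xr2.
clearbody t; have zt : cabs (z - z) < t by rewrite subrr cabs0.
have [_ gz kz [dg dg0 gd] [dk kd]] := near z zt.
rewrite pE in gz kz.
have gh : holomorphic_at g z t by move=> x /near[_ _ _ [d _ ?] _]; exists d.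
exists (g z), (k z), (dk / dg); split=> //.
- have [s1 s10 inj] := locally_injective t0 gh gd dg0.
  have m0 : 0 < Num.min s1 t by rewrite lt_min s10.
  exists [set x | [/\ dom i x, cabs (coord i x - coord i p) < Num.min s1 t & param i (coord i x) = x]].
    by have := nbhs_chart surfA ip m0.
  move=> x y /set_mem [ix xs xE] /set_mem [iy ys yE].
  move: xs ys; rewrite !lt_min => /andP[xs xt] /andP[ys yt].
  have [_ gx _ _ _] := near _ xt; have [_ gy _ _ _] := near _ yt.
  by rewrite -xE -yE gx gy => -[/(inj _ _ xs ys) ->].
- move=> V pV; have [sV sV0 VP] := chart_nbhs surfA ip pV.
  have m0 : 0 < Num.min sV t by rewrite lt_min sV0.
  have [d d0 dP] := open_mapping t0 gh gd dg0 m0.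
  exists d => // u' /dP[x]; rewrite lt_min => /andP[xs xt] <-.
  by exists (param i x); [exact: VP|have [] := near x xt].
move=> e e0; have dgp : 0 < cabs dg by rewrite cabs_gt0.
have c0 := cabs_ge0 (dk / dg).
(* By the first term [cabs dg * cabs (y - z)] is at most twice [cabs (g y - g z)]; the second then
   bounds the two error terms together by [e * cabs (g y - g z)]. *)
pose n := Num.min (cabs dg / 2) (e * cabs dg / (2 * (1 + cabs (dk / dg)))).
have n0 : 0 < n by rewrite lt_min !divr_gt0 ?mulr_gt0 //; lra.
have [a a0 aP] := (cdiffP _ _ _).1 gd n n0.
have [b b0 bP] := (cdiffP _ _ _).1 kd n n0.
have m0 : 0 < Num.min t (Num.min a b) by rewrite !lt_min t0 a0.
apply: filterS (nbhs_chart surfA ip m0) => x [ix + xE] u' w'.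
rewrite !lt_min => /and3P[xt xa xb].
have [_ gx kx _ _] := near _ xt; rewrite -xE gx kx => -[<-] [<-].
move: (coord i x) xa xb => y /aP ya /bP yb.
rewrite -/z in ya yb *.
have n1 : n <= cabs dg / 2 by rewrite ge_min lexx.
have n2 : n * (2 * (1 + cabs (dk / dg))) <= e * cabs dg.
  by rewrite -ler_pdivlMr ?mulr_gt0 //; [rewrite ge_min lexx orbT|lra].
have yz0 := cabs_ge0 (y - z).
have h1 : cabs dg * cabs (y - z) <= 2 * cabs (g y - g z).
  have := cabs_sub (dg * (y - z)) (- (g y - g z - dg * (y - z))).
  have -> : dg * (y - z) - - (g y - g z - dg * (y - z)) = g y - g z by ring.
  by rewrite cabsN cabsM; have := ler_wpM2r yz0 n1; lra.
have -> : k y - k z - dk / dg * (g y - g z) =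
  (k y - k z - dk * (y - z)) - dk / dg * (g y - g z - dg * (y - z)) by field.
apply: le_trans (cabsB _ _) _; rewrite cabsM.
have h2 := ler_wpM2l c0 ya.
have h3 := ler_wpM2r yz0 n2.
have h4 := ler_wpM2l (ltW e0) h1.
by lra.
Qed.

(** If [B] is infinite, the sets that contain all but finitely many of its points form a proper
    filter; at a cluster point, [B] would not be isolated. *)
Lemma isolated_finite (B : set S) : compact [set: S] ->
  (forall p, nbhs p [set x | x <> p -> ~ B x]) -> finite_set B.
Proof.
move=> cS Bi; apply: contrapT => Binf.
pose F : set_system S := [set V | finite_set (B `\` V)].
have FF : ProperFilter F.
  apply: Build_ProperFilter; first by rewrite /F /= setD0.
  split; first by rewrite /F /= setDT; exact: finite_set0.
  - by move=> V W; rewrite /F /= setDIr finite_setU.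
  - by move=> V W VW; apply: sub_finite_set; exact: setDS.
have [p [_ pF]] := cS F FF (filterT : F setT).
have [] := pF (~` [set x | x <> p -> ~ B x]) [set x | x <> p -> ~ B x].
- apply: (sub_finite_set _ (finite_set1 p)) => x [Bx /contrapT/= h].
  by apply: contrapT => /h.
- exact: Bi.
- by move=> x [].
Qed.

Lemma irregular_finite : compact [set: S] -> finite_set [set p | ~ regular_point p].
Proof.
move=> cS; apply: isolated_finite => // p.
by apply: filterS (punctured_regular p) => x h /h xp /(_ xp).
Qed.

End Regular.

(** * The polynomial of a fibre *)

Section ProductCoefficients.
Context {R : realType}.

Lemma cdiff_coef_prod I (s : seq I) (w : I -> R[i] -> R[i]) z :
  (forall i, exists d, cdiff (w i) z d) ->
  forall k, exists d, cdiff (fun u => (\prod_(i <- s) ('X - (w i u)%:P))`_k) z d.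
Proof.
move=> wd; elim: s => [|i s IH] k.
  exists 0; have -> : (fun u => (\prod_(i <- [::]) ('X - (w i u)%:P))`_k) = (fun=> (k == 0%N)%:R).
    by apply/funext => u; rewrite big_nil coef1.
  exact: cdiff_cst.
have [d wi] := wd i; have [d1 h1] := IH k.
have [d2 h2] : exists d, cdiff (fun u => if (k == 0)%N then 0 else (\prod_(i <- s) ('X - (w i u)%:P))`_k.-1) z d.
  by case: (k == 0)%N; [exists 0; exact: cdiff_cst|exact: IH].
have -> : (fun u => (\prod_(i <- i :: s) ('X - (w i u)%:P))`_k) =
  (fun u => (if (k == 0)%N then 0 else (\prod_(i <- s) ('X - (w i u)%:P))`_k.-1) -
     w i u * (\prod_(i <- s) ('X - (w i u)%:P))`_k).
  by apply/funext => u; rewrite big_cons mulrBl coefB coefXM coefCM.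
by eexists; exact: cdiffB h2 (cdiffM wi h1).
Qed.

Lemma coef_prod_bound I (s : seq I) (w : I -> R[i]) k :
  cabs (\prod_(i <- s) ('X - (w i)%:P))`_k <= \prod_(i <- s) (1 + cabs (w i)).
Proof.
elim: s k => [|i s IH] k.
  by rewrite !big_nil coef1; case: (k == 0)%N; rewrite ?cabs1 ?cabs0.
rewrite !big_cons mulrBl coefB coefXM coefCM; apply: le_trans (cabsB _ _) _.
rewrite cabsM mulrDl mul1r; apply: lerD; last by apply: ler_wpM2l; rewrite ?cabs_ge0.
case: (k == 0)%N; last exact: IH.
by rewrite cabs0 prodr_ge0 // => j _; rewrite addr_ge0 ?cabs_ge0.
Qed.

End ProductCoefficients.

Section FibrePolynomial.
Context {R : realType} (S : topologicalType) (A : atlas (R := R) S).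
Hypothesis surfA : riemann_surface A.
Variables (Pi f : S -> CP1 (R := R)) (N : nat).
Hypothesis fibre_card : forall c, (forall p, Pi p = c -> ~ branch_point Pi p) ->
  (Pi @^-1` [set c] #= `I_N)%card.
Hypothesis bad_fin : finite_set [set p | ~ regular_point Pi f p].

Definition bad_value : set R[i] := [set u | exists2 p, ~ regular_point Pi f p & Pi p = Some u].

Lemma bad_value_finite : finite_set bad_value.
Proof.
have h : finite_set [set Pi p | p in [set p | ~ regular_point Pi f p]] by exact: finite_image.
have := finite_image (fun c : CP1 => odflt 0 (c : option R[i])) h.
apply: sub_finite_set => u [p pb pu]; exists (Pi p); last by rewrite pu.
by exists p.
Qed.

Lemma bad_value_near u1 : ~ bad_value u1 -> exists2 r : R, 0 < r &
  forall u, cabs (u - u1) < r -> ~ bad_value u.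
Proof.
move=> nb; have /finite_seqP[B BE] := bad_value_finite.
have : forall s : seq R[i], u1 \notin s -> exists2 r : R, 0 < r & forall u, cabs (u - u1) < r -> u \notin s.
  elim=> [|b s IH]; first by exists 1.
  rewrite inE negb_or => /andP[ub /IH[r r0 rs]].
  exists (Num.min r (cabs (b - u1))); first by rewrite lt_min r0 cabs_gt0 subr_eq0 eq_sym.
  move=> u; rewrite lt_min => /andP[/rs us ubb]; rewrite inE negb_or us andbT.
  by apply: contraTneq ubb => ->; rewrite ltxx.
have u1B : u1 \notin B.
  by apply/negP => h; apply: nb; rewrite BE.
move=> /(_ _ u1B)[r r0 rB]; exists r => // u /rB uB; rewrite BE /=.
by apply/negP.
Qed.

(** Poles of [f] get the value 0; there are none over a value that is not in [bad_value]. *)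
Definition finite_value p : R[i] := odflt 0 (f p : option R[i]).

Definition fibre_enum u (e : 'I_N -> S) :=
  [/\ injective e, forall i, Pi (e i) = Some u & forall p, Pi p = Some u -> exists i, e i = p].

Definition fibre_prod (e : 'I_N -> S) : {poly R[i]} :=
  \prod_(i < N) ('X - (finite_value (e i))%:P).

(** The polynomial with the values of [f] over [u] as roots. By [fibre_polyE] the enumeration of the
    fibre is immaterial; without one the polynomial is 0. *)
Definition fibre_poly u : {poly R[i]} :=
  xget 0 [set g | exists2 e, fibre_enum u e & g = fibre_prod e].

Lemma fibre_polyE u e : fibre_enum u e -> fibre_poly u = fibre_prod e.
Proof.
move=> he; rewrite /fibre_poly; case: xgetP => [g _ [e' he' ->]|/(_ (fibre_prod e))[]]; last by exists e.
have [ei eP eS] := he; have [ei' eP' eS'] := he'.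
have /choice[s sP] : forall i, exists j, e j = e' i by move=> i; apply: eS.
have si : injective s by move=> i j E; apply: ei'; rewrite -!sP E.
rewrite /fibre_prod [RHS](reindex_inj si); by apply: eq_bigr => i _; rewrite sP.
Qed.

Lemma good_regular u p : ~ bad_value u -> Pi p = Some u -> regular_point Pi f p.
Proof. by move=> ub pu; apply: contrapT => np; apply: ub; exists p. Qed.

(** Regular points are not branch points, so that the count of points in a fibre applies. *)
Lemma good_fibre_bij u : ~ bad_value u ->
  exists h : S -> nat, set_bij (Pi @^-1` [set Some u]) `I_N h.
Proof.
move=> ub; apply/card_set_bijP; apply: fibre_card => p pu.
have [_ [_ [_ [_ _ [V pV iV] _ _]]]] := good_regular ub pu.
by move=> /(_ V pV).
Qed.

Lemma good_fibre_enum u : ~ bad_value u -> exists e, fibre_enum u e.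
Proof.
move=> /good_fibre_bij[h [hS hi hs]].
have /choice[e eP] : forall i : 'I_N, exists p, Pi p = Some u /\ h p = i.
  by move=> i; have [p pu pi] := hs i (ltn_ord i); exists p.
exists e; split.
- by move=> i j E; apply/val_inj; rewrite /= -(proj2 (eP i)) -(proj2 (eP j)) E.
- by move=> i; have [] := eP i.
- move=> p pu; exists (Ordinal (hS p pu)).
  have [eu eh] := eP (Ordinal (hS p pu)); apply: hi => //; exact: mem_set.
Qed.

(** [N] distinct points exhaust a fibre of [N] points. *)
Lemma fibre_enum_inj u e : ~ bad_value u -> injective e -> (forall i, Pi (e i) = Some u) ->
  fibre_enum u e.
Proof.
move=> /good_fibre_enum[e' [ei' eP' eS']] ei eP; split=> // p /eS'[j <-].
have /choice[s sP] : forall i, exists j, e' j = e i by move=> i; apply: eS'.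
have si : injective s by move=> i k E; apply: ei; rewrite -!sP E.
have [t st ts] := injF_bij si.
by exists (t j); rewrite -sP ts.
Qed.

End FibrePolynomial.

Lemma nbhs_forall_ord (S : topologicalType) (p : S) N (P : 'I_N -> set S) :
  (forall i, nbhs p (P i)) -> nbhs p [set x | forall i, P i x].
Proof.
move=> nP; have : forall s : seq 'I_N, nbhs p [set x | forall i, i \in s -> P i x].
  elim=> [|i s IH]; first by apply: filterS filterT => x _ i.
  apply: filterS (filterI (nP i) IH) => x [xi xs] j; rewrite inE => /orP[/eqP->//|]; exact: xs.
by move=> /(_ (enum 'I_N)); apply: filterS => x h i; apply: h; rewrite mem_enum.
Qed.

Lemma separate_points (S : topologicalType) N (e : 'I_N -> S) : hausdorff_space S ->
  injective e -> exists V : 'I_N -> set S, (forall i, nbhs (e i) (V i)) /\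
    forall i j x, V i x -> V j x -> i = j.
Proof.
move=> hS ei.
have sep (ij : 'I_N * 'I_N) : exists AB : set S * set S, [/\ nbhs (e ij.1) AB.1, nbhs (e ij.2) AB.2 &
    ij.1 <> ij.2 -> AB.1 `&` AB.2 = set0].
  case: ij => i j /=; have [->|ij] := eqVneq i j.
    by exists (setT, setT); split=> //; exact: filterT.
  have eij : e i != e j by apply: contra_neq ij => /ei.
  have := hS; rewrite open_hausdorff => /(_ _ _ eij)[[A B] /= [/set_mem Ai /set_mem Bj] [oA oB /eqP AB]].
  by exists (A, B); split=> //=; apply: open_nbhs_nbhs.
have [W WP] := choice sep.
exists (fun i => [set x | forall j, (W (i, j)).1 x /\ (W (j, i)).2 x]); split.
  move=> i; apply: nbhs_forall_ord => j; apply: filterI.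
    by have [] := WP (i, j).
  by have [] := WP (j, i).
move=> i j x xi xj; apply: contrapT => ij.
have [_ _ /(_ ij) E] := WP (i, j).
suff : set0 x by [].
by rewrite -E; split; [have [] := xi j|have [] := xj i].
Qed.

Section FibreDerivative.
Context {R : realType} (S : topologicalType).
Hypothesis hausS : hausdorff_space S.
Variables (Pi f : S -> CP1 (R := R)) (N : nat).
Hypothesis fibre_card : forall c, (forall p, Pi p = c -> ~ branch_point Pi p) ->
  (Pi @^-1` [set c] #= `I_N)%card.
Hypothesis bad_fin : finite_set [set p | ~ regular_point Pi f p].

Let bad := bad_value Pi f.
Let chi := fibre_poly Pi f N.

(** The points of the fibre over [u1] have disjoint neighbourhoods [V i] on which [Pi] is injective,
    and for [u] near [u1] openness gives a point [E u i] over [u] in each. These are all the points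
    over [u], and [f] is differentiable along each of them by regularity. *)
Lemma fibre_poly_cdiff u1 k : ~ bad u1 -> exists d, cdiff (fun u => (chi u)`_k) u1 d.
Proof.
move=> nb1; have [e1 [ei1 eP1 eS1]] := good_fibre_enum fibre_card nb1.
have [r r0 rb] := bad_value_near bad_fin nb1.
have reg i : regular_point Pi f (e1 i) by apply: good_regular nb1 (eP1 i).
have [V0 [V0n V0d]] := separate_points hausS ei1.
have Vex i : exists V : set S, [/\ nbhs (e1 i) V, set_inj V Pi & V `<=` V0 i].
  have [_ [_ [_ [_ _ [V pV iV] _ _]]]] := reg i.
  exists (V `&` V0 i); split; [exact: filterI|by move=> x y /set_mem[vx _] /set_mem[vy _]; apply: iV; exact: mem_set|by move=> x []].
have [V VP] := choice Vex.
have opn i W : nbhs (e1 i) W -> exists2 t : R, 0 < t &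
    forall u, cabs (u - u1) < t -> exists2 x, W x & Pi x = Some u.
  move=> iW; have [u [w [d [eu _ _ /(_ W iW)[t t0 tP] _]]]] := reg i.
  by move: eu; rewrite eP1 => -[uu]; exists t => // u' h; apply: tP; rewrite -uu.
have tmin (P : 'I_N -> R -> Prop) : (forall i, exists2 t : R, 0 < t & P i t) ->
    (forall i t t', P i t -> t' <= t -> P i t') -> exists2 t : R, 0 < t & forall i, P i t.
  move=> Pt Pm; have : forall s : seq 'I_N, exists2 t : R, 0 < t & forall i, i \in s -> P i t.
    elim=> [|i s [t t0 tP]]; first by exists 1.
    have [t' t'0 t'P] := Pt i; exists (Num.min t t'); first by rewrite lt_min t0.
    move=> j; rewrite inE => /orP[/eqP->|/tP].
      by apply: Pm t'P _; rewrite ge_min lexx orbT.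
    by move/Pm; apply; rewrite ge_min lexx.
  by move=> /(_ (enum 'I_N))[t t0 tP]; exists t => // i; apply: tP; rewrite mem_enum.
have [t0 t00 tP] : exists2 t : R, 0 < t & forall i, forall u, cabs (u - u1) < t -> exists2 x, V i x & Pi x = Some u.
  apply: (tmin (fun i t => forall u, cabs (u - u1) < t -> exists2 x, V i x & Pi x = Some u)).
    by move=> i; have [Vn _ _] := VP i; exact: (opn i (V i) Vn).
  by move=> i t t' h tt' u ut; apply: h; apply: lt_le_trans tt'.
pose t := Num.min r t0; have tp : 0 < t by rewrite lt_min r0.
(* Far from [u1] the value is arbitrary; [e1] is a default. *)
have Eex u : exists e : 'I_N -> S, cabs (u - u1) < t -> forall i, V i (e i) /\ Pi (e i) = Some u.
  have [ut|nut] := pselect (cabs (u - u1) < t); last by exists e1.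
  have /choice[e eP] : forall i, exists x, V i x /\ Pi x = Some u.
    by move=> i; move: ut; rewrite lt_min => /andP[_ /(tP i u)[x Vx xu]]; exists x.
  by exists e.
have [E EP] := choice Eex.
have chiE u : cabs (u - u1) < t -> fibre_prod f (E u) = chi u.
  move=> ut; symmetry; apply: fibre_polyE.
  have ur : cabs (u - u1) < r by move: ut; rewrite lt_min => /andP[].
  apply: (fibre_enum_inj fibre_card (rb u ur)); last by move=> i; have [] := EP u ut i.
  move=> i j Eij; have [Vi _] := EP u ut i; have [Vj _] := EP u ut j.
  have [_ _ Vi0] := VP i; have [_ _ Vj0] := VP j.
  by apply: (V0d i j (E u i)); [exact: Vi0|rewrite Eij; exact: Vj0].
have [d cd] : exists d, cdiff (fun u => (\prod_(i < N) ('X - (finite_value f (E u i))%:P))`_k) u1 d.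
  apply: (@cdiff_coef_prod _ _ _ (fun i u => finite_value f (E u i))) => i.
  have [u [w [d [eu ew _ _ dP]]]] := reg i.
  have {eu} uu : u = u1 by move: eu; rewrite eP1 => -[].
  rewrite {u}uu in dP *.
  have u1t : cabs (u1 - u1) < t by rewrite subrr cabs0.
  have E1 : E u1 i = e1 i.
    have [Vi Pi1] := EP u1 u1t i; have [Vn Vinj _] := VP i.
    apply: Vinj; rewrite ?inE //; first exact: nbhs_singleton.
    by rewrite Pi1 eP1.
  exists d; apply/cdiffP => e e0.
  have [Vn Vinj _] := VP i.
  have [s s0 sP] := opn i _ (filterI Vn (dP e e0)).
  exists (Num.min s t); first by rewrite lt_min s0.
  move=> u'; rewrite lt_min => /andP[us ut].
  have [x [Vx xP] xu] := sP u' us.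
  have [Vi Piu] := EP u' ut i.
  (* The point found in the smaller neighbourhood, where the estimate for [e] holds, is [E u' i]
     because [Pi] is injective on [V i]. *)
  have -> : E u' i = x by apply: Vinj; rewrite ?inE // Piu xu.
  have ur : cabs (u' - u1) < r by move: ut; rewrite lt_min => /andP[].
  have [u2 [w2 [_ [_ fx _ _ _]]]] := good_regular (rb u' ur) xu.
  by rewrite E1 /finite_value ew fx /=; exact: xP.
by exists d; apply: cdiff_near tp _ cd => u ut; rewrite -chiE.
Qed.

End FibreDerivative.

Section PolynomialGrowth.
Context {R : realType}.
Implicit Types p : {poly R[i]}.

Definition poly_growth (g : R[i] -> R) := exists (M : R) (m : nat),
  0 <= M /\ forall z, g z <= M * (1 + cabs z) ^+ m.

Let base_ge1 (z : R[i]) : 1 <= 1 + cabs z. Proof. by rewrite lerDl cabs_ge0. Qed.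

Lemma poly_growth_cst (c : R) : 0 <= c -> poly_growth (fun=> c).
Proof. by move=> c0; exists c, 0%N; split=> // z; rewrite expr0 mulr1. Qed.

Lemma poly_growth_id : poly_growth (fun z => cabs z).
Proof. by exists 1, 1%N; split=> // z; rewrite expr1 mul1r lerDr. Qed.

Lemma poly_growthD g h : poly_growth g -> poly_growth h -> poly_growth (fun z => g z + h z).
Proof.
move=> [M [m [M0 gM]]] [L [l [L0 hL]]]; exists (M + L), (m + l)%N; split; first by rewrite addr_ge0.
move=> z; rewrite mulrDl; apply: lerD.
  apply: le_trans (gM z) _; apply: ler_wpM2l => //.
  by apply: ler_weXn2l => //; rewrite leq_addr.
apply: le_trans (hL z) _; apply: ler_wpM2l => //.
by apply: ler_weXn2l => //; rewrite leq_addl.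
Qed.

Lemma poly_growthM g h : (forall z, 0 <= g z) -> (forall z, 0 <= h z) ->
  poly_growth g -> poly_growth h -> poly_growth (fun z => g z * h z).
Proof.
move=> g0 h0 [M [m [M0 gM]]] [L [l [L0 hL]]]; exists (M * L), (m + l)%N.
split; first by rewrite mulr_ge0.
by move=> z; rewrite exprD mulrACA; apply: ler_pM.
Qed.

Lemma poly_growthX g n : (forall z, 0 <= g z) -> poly_growth g ->
  poly_growth (fun z => g z ^+ n).
Proof.
move=> g0 gg; elim: n => [|n IH]; first exact: poly_growth_cst.
have -> : (fun z => g z ^+ n.+1) = (fun z => g z * g z ^+ n) by apply/funext => z; rewrite exprS.
by apply: poly_growthM => // z; rewrite exprn_ge0.
Qed.

Lemma poly_growth_le g h : (forall z, g z <= h z) -> poly_growth h -> poly_growth g.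
Proof. by move=> gh [M [m [M0 hM]]]; exists M, m; split=> // z; exact: le_trans (gh z) (hM z). Qed.

Lemma poly_growth_horner p : poly_growth (fun z => cabs p.[z]).
Proof.
elim/poly_ind: p => [|p c IH].
  by apply: poly_growth_le (poly_growth_cst (lexx 0)) => z; rewrite horner0 cabs0.
have h : poly_growth (fun z => cabs p.[z] * cabs z + cabs c).
  apply: poly_growthD; last exact: poly_growth_cst (cabs_ge0 c).
  by apply: poly_growthM IH poly_growth_id => z; exact: cabs_ge0.
by apply: poly_growth_le h => z; rewrite !hornerE -cabsM; exact: cabsD.
Qed.

Lemma poly_growth_sum I (s : seq I) (g : I -> R[i] -> R) :
  (forall i, poly_growth (g i)) -> poly_growth (fun z => \sum_(i <- s) g i z).
Proof.
move=> gg; elim: s => [|i s IH].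
  by apply: poly_growth_le (poly_growth_cst (lexx 0)) => z; rewrite big_nil.
by apply: poly_growth_le (poly_growthD (gg i) IH) => z; rewrite big_cons.
Qed.

Lemma cdiff_horner p z : exists d, cdiff (fun u => p.[u]) z d.
Proof.
elim/poly_ind: p => [|p c [d pd]].
  exists 0; have -> : (fun u => (0 : {poly R[i]}).[u]) = (fun=> 0).
    by apply/funext => u; rewrite horner0.
  exact: cdiff_cst.
have -> : (fun u => (p * 'X + c%:P).[u]) = (fun u => p.[u] * u + c).
  by apply/funext => u; rewrite !hornerE.
by eexists; exact: cdiffD (cdiffM pd (cdiff_id z)) (cdiff_cst c z).
Qed.

(* An exceptional point is removable when the function vanishes there to second
   order. *)
Lemma cdiff_quadratic (g : R[i] -> R[i]) b (r K : R) : 0 < r -> 0 <= K -> g b = 0 ->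
  (forall u, cabs (u - b) < r -> cabs (g u) <= K * cabs (u - b) ^+ 2) -> cdiff g b 0.
Proof.
move=> r0 K0 gb gK; apply/cdiffP => e e0; have K1 : 0 < K + 1 by lra.
exists (Num.min r (e / (K + 1))); first by rewrite lt_min r0 divr_gt0.
move=> u; rewrite lt_min => /andP[/gK h]; rewrite ltr_pdivlMr // => h'.
rewrite gb subr0 mul0r subr0; apply: le_trans h _; have x0 := cabs_ge0 (u - b).
by rewrite expr2 mulrA; apply: ler_wpM2r => //; lra.
Qed.

End PolynomialGrowth.

(** * The coefficients of the fibre polynomial are rational functions *)

Section Rationality.
Context {R : realType} (S : topologicalType).
Hypothesis hausS : hausdorff_space S.
Variables (Pi f : S -> CP1 (R := R)) (N : nat).
Hypothesis fibre_card : forall c, (forall p, Pi p = c -> ~ branch_point Pi p) ->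
  (Pi @^-1` [set c] #= `I_N)%card.
Hypothesis bad_fin : finite_set [set p | ~ regular_point Pi f p].
Variable D : {poly R[i]}.
Hypothesis D0 : D != 0.
Variable B : R[i] -> R.
Hypothesis B0 : forall u, 0 <= B u.
Hypothesis Bg : poly_growth B.
Hypothesis DB : forall u p, ~ bad_value Pi f u -> Pi p = Some u ->
  cabs (D.[u] * finite_value f p) <= B u.

Let chi := fibre_poly Pi f N.

Lemma fibre_poly_bound u k : ~ bad_value Pi f u ->
  cabs (D.[u] ^+ N * (chi u)`_k) <= (cabs D.[u] + B u) ^+ N.
Proof.
move=> ub; have [e he] := good_fibre_enum fibre_card ub.
rewrite /chi (fibre_polyE f he) cabsM cabsX.
apply: le_trans (ler_wpM2l _ (coef_prod_bound _ _ _)) _; first by rewrite exprn_ge0 ?cabs_ge0.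
have -> : cabs D.[u] ^+ N = \prod_(i < N) cabs D.[u] by rewrite prodr_const card_ord.
have -> : (cabs D.[u] + B u) ^+ N = \prod_(i < N) (cabs D.[u] + B u).
  by rewrite prodr_const card_ord.
rewrite -big_split /=; apply: ler_prod => i _; apply/andP; split.
  by rewrite mulr_ge0 ?addr_ge0 ?cabs_ge0.
rewrite mulrDr mulr1 -cabsM lerD2l; apply: DB => //.
by have [_ eP _] := he.
Qed.

(** Multiplication by [D ^+ N] gives polynomial growth off the bad values, and the double zeros of
    [V ^+ 2] make the product differentiable at the bad values too, where [chi] is arbitrary.
    Liouville's theorem applies to this entire function. *)
Lemma fibre_poly_rational : exists E : {poly R[i]},
  [/\ E != 0, forall u, bad_value Pi f u -> E.[u] = 0 &
    forall k, exists Q : {poly R[i]}, forall u, E.[u] * (chi u)`_k = Q.[u]].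
Proof.
have /finite_seqP[s sE] := bad_value_finite bad_fin.
have sP u : bad_value Pi f u <-> u \in s by rewrite sE.
pose V : {poly R[i]} := \prod_(b <- s) ('X - b%:P).
have V0 : V != 0 by rewrite /V monic_neq0 // monic_prod // => i _; exact: monicXsubC.
have Vb b : b \in s -> exists2 V' : {poly R[i]}, V' != 0 & V = ('X - b%:P) * V'.
  move=> bs; have : root V b by rewrite /V root_prod_XsubC.
  move=> /factor_theorem[q qE]; exists q; last by rewrite qE mulrC.
  by apply: contraNneq V0 => q0; rewrite qE q0 mul0r.
have Vz b : b \in s -> V.[b] = 0.
  by move=> /Vb[V' _ ->]; rewrite hornerM hornerXsubC subrr mul0r.
exists (D ^+ N * V ^+ 2); split.
- by rewrite mulf_neq0 ?expf_neq0.
- by move=> u /sP/Vz uz; rewrite hornerM !horner_exp uz expr0n mulr0.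
move=> k; pose G u := (D ^+ N * V ^+ 2).[u] * (chi u)`_k.
have GE u : cabs (G u) <= cabs V.[u] ^+ 2 * (cabs D.[u] + B u) ^+ N.
  have [ub|ub] := pselect (bad_value Pi f u).
    have uz := Vz u ((sP u).1 ub).
    have -> : G u = 0 by rewrite /G hornerM !horner_exp uz expr0n mulr0 mul0r.
    by rewrite cabs0 mulr_ge0 ?exprn_ge0 ?addr_ge0 ?cabs_ge0.
  have -> : G u = V.[u] ^+ 2 * (D.[u] ^+ N * (chi u)`_k).
    by rewrite /G hornerM !horner_exp; ring.
  rewrite cabsM cabsX; apply: ler_wpM2l; first by rewrite exprn_ge0 ?cabs_ge0.
  exact: fibre_poly_bound.
have Hg : poly_growth (fun u => (cabs D.[u] + B u) ^+ N).
  apply: poly_growthX; first by move=> u; rewrite addr_ge0 ?cabs_ge0.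
  by apply: poly_growthD => //; exact: poly_growth_horner.
have Gd u : exists d, cdiff G u d.
  have [ub|ub] := pselect (bad_value Pi f u); last first.
    have [d1 h1] := cdiff_horner (D ^+ N * V ^+ 2) u.
    have [d2 h2] := fibre_poly_cdiff hausS fibre_card bad_fin k ub.
    by eexists; exact: cdiffM h1 h2.
  have [V' _ VE] := Vb u ((sP u).1 ub).
  have [M [m [M0 HM]]] : poly_growth (fun x => cabs V'.[x] ^+ 2 * (cabs D.[x] + B x) ^+ N).
    apply: poly_growthM => //.
    - by move=> x; rewrite exprn_ge0 ?cabs_ge0.
    - by move=> x; rewrite exprn_ge0 ?addr_ge0 ?cabs_ge0.
    - by apply: poly_growthX; [move=> x; exact: cabs_ge0|exact: poly_growth_horner].
  have b2 : 0 <= 2 + cabs u by rewrite addr_ge0 ?cabs_ge0.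
  exists 0; apply: (@cdiff_quadratic _ _ _ 1 (M * (2 + cabs u) ^+ m)) => //.
  - by rewrite mulr_ge0 ?exprn_ge0.
  - by rewrite /G hornerM !horner_exp (Vz u ((sP u).1 ub)) expr0n mulr0 mul0r.
  move=> x xu; apply: le_trans (GE x) _.
  have -> : cabs V.[x] ^+ 2 * (cabs D.[x] + B x) ^+ N =
      cabs V'.[x] ^+ 2 * (cabs D.[x] + B x) ^+ N * cabs (x - u) ^+ 2.
    rewrite VE hornerM hornerXsubC cabsM exprMn; move: (_ ^+ N) => X; ring.
  apply: ler_wpM2r.
    by rewrite exprn_ge0 ?cabs_ge0.
  apply: le_trans (HM x) _; apply: ler_wpM2l => //; apply: lerXn2r; rewrite ?nnegrE //.
    by rewrite addr_ge0 ?cabs_ge0.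
  by have := cabs_sub x u; lra.
have [M [m [M0 GM]]] : poly_growth (fun u => cabs (G u)).
  apply: poly_growth_le GE _; apply: poly_growthM => //.
  - by move=> x; rewrite exprn_ge0 ?cabs_ge0.
  - by move=> x; rewrite exprn_ge0 ?addr_ge0 ?cabs_ge0.
  - by apply: poly_growthX; [move=> x; exact: cabs_ge0|exact: poly_growth_horner].
have [Q QE] := liouville_polynomial Gd GM.
by exists Q => u; rewrite -QE.
Qed.

End Rationality.

(** * Generic specialization of polynomials over C(u) *)

Section SplittingRoots.
Variables (F : fieldType) (L : splittingFieldType F).
Local Notation toL := (map_poly (in_alg L)).

(** The minimal polynomial divides the irreducible [Om], so that any root of [Om] generates a
    subfield of full dimension. *)
Lemma adjoin_root_full (Om : {poly F}) (y : L) : irreducible_poly Om ->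
  \dim {:L}%VS = (size Om).-1 -> root (toL Om) y ->
  (<<1; y>>%VS = {:L}%VS) /\ minPoly 1 y %= toL Om.
Proof.
move=> [s1 irr] dimL ry.
have /polyOver1P[m mE] := minPolyOver 1 y.
have d : m %| Om.
  by rewrite -(dvdp_map (in_alg L)) -mE; apply: minPoly_dvdp ry; exact: alg_polyOver.
have sm : size m != 1%N by rewrite -(size_map_poly (in_alg L)) -mE size_minPoly.
have e := irr m sm d; split; last by rewrite mE eqp_map.
apply/eqP; rewrite eqEdim subvf /= dimL dim_Fadjoin dimv1 muln1.
have := size_minPoly 1 y; rewrite mE size_map_poly (eqp_size e) => ->.
by [].
Qed.

(** By normality the minimal polynomial of [x] splits. Each root is a polynomial in [x], as [x]
    generates [L]; but each root generates [L] as well, so that [x] is a polynomial in it. *)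
Lemma splitting_roots (Om : {poly F}) (x : L) : irreducible_poly Om -> Om \is monic ->
  \dim {:L}%VS = (size Om).-1 -> root (toL Om) x ->
  exists2 hs : seq {poly F}, toL Om = \prod_(h <- hs) ('X - ((toL h).[x])%:P) &
    forall h, h \in hs -> exists k : {poly F}, (toL k).[(toL h).[x]] = x.
Proof.
move=> irr mon dimL rx; have [fx ex] := adjoin_root_full irr dimL rx.
have H y : exists h : {poly F}, (toL h).[x] = y.
  have : y \in <<1; x>>%VS by rewrite fx memvf.
  by move=> /Fadjoin1_polyP[h ->]; exists h.
have [r /eqP rE] := splitting_field_normal 1 x.
have OmE : toL Om = \prod_(y <- r) ('X - y%:P).
  by rewrite -rE; apply/esym/eqP; rewrite -eqp_monic ?monic_minPoly ?map_monic.
have [g gP] := choice H.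
exists [seq g y | y <- r]; first by rewrite big_map OmE; apply: eq_bigr => y _; rewrite gP.
move=> h /mapP[y yr ->]; rewrite gP.
have ry : root (toL Om) y by rewrite OmE root_prod_XsubC.
have [fy _] := adjoin_root_full irr dimL ry.
have : x \in <<1; y>>%VS by rewrite fy memvf.
by move=> /Fadjoin1_polyP[k ->]; exists k.
Qed.

End SplittingRoots.

Section QuotientRoots.
Variables (F : fieldType) (Om : {poly F}) (irr : monic_irreducible_poly Om).
Local Notation L := {poly %/ Om with irr}.

Lemma in_qpoly_eq (p q : {poly F}) : in_qpoly Om p = in_qpoly Om q -> Om %| p - q.
Proof.
move=> E; have : in_qpoly Om (p - q) = 0 by rewrite (raddfB (in_qpoly Om)) /= E subrr.
move=> /(congr1 val) /=; rewrite mk_monicE // => /eqP.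
by rewrite /dvdp Pdiv.IdomainMonic.modpE //; case: irr.
Qed.

Lemma horner_qpoly (p q : {poly F}) :
  (map_poly (in_alg L) p).[in_qpoly Om q : L] = in_qpoly Om (p \Po q).
Proof.
elim/poly_ind: p => [|p c IH].
  by rewrite rmorph0 horner0 comp_poly0 raddf0.
rewrite rmorphD rmorphM /= map_polyX map_polyC /= hornerMXaddC IH.
rewrite comp_polyD comp_polyM comp_polyX comp_polyC rmorphD rmorphM /=.
congr (_ + _); rewrite -[c%:P]alg_polyC in_qpolyZ.
by rewrite in_qpoly1.
Qed.

(** The splitting over the quotient field is turned into divisibilities by [Om] in F[T], a form that
    can be specialized at a number [u]. The product has coefficients in F[T], and is compared with
    [Om] in a second indeterminate, coefficient by coefficient. *)
Lemma quotient_roots : galois_extension L ->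
  exists hs : seq {poly F},
    (forall i, Om %| (map_poly polyC Om - \prod_(h <- hs) ('X - h%:P))`_i) /\
    forall h, h \in hs -> exists k, Om %| k \Po h - 'X.
Proof.
move=> [axL _]; pose L' := splitting_field_pack axL; pose x : L' := in_qpoly Om 'X.
have [irr0 mon] := irr.
have dimL : \dim {:L'}%VS = (size Om).-1.
  transitivity (size (mk_monic Om)).-1; last by rewrite (mk_monicE irr).
  exact: dim_polyn.
have hq (p q : {poly F}) : (map_poly (in_alg L') p).[in_qpoly Om q : L'] = in_qpoly Om (p \Po q).
  exact: horner_qpoly.
have hx (p : {poly F}) : (map_poly (in_alg L') p).[x] = in_qpoly Om p by rewrite hq comp_polyXr.
have Om0 : in_qpoly Om Om = 0.
  by apply: val_inj; rewrite /= mk_monicE //; apply: Pdiv.RingMonic.rmodpp; case: irr.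
have rx : root (map_poly (in_alg L') Om) x by rewrite /root hx Om0.
have [hs hsE hsk] := splitting_roots irr0 mon dimL rx.
exists hs; split; last first.
  move=> h /hsk[k kE]; exists k; apply: in_qpoly_eq.
  by move: kE; rewrite hx hq.
move=> i; rewrite coefB coef_map /=; apply: in_qpoly_eq.
have : map_poly (in_qpoly Om) (\prod_(h <- hs) ('X - h%:P)) = map_poly (in_alg L') Om.
  rewrite hsE rmorph_prod; apply: eq_bigr => h _.
  by rewrite rmorphB /= map_polyX map_polyC /= hx.
move=> /(congr1 (fun p : {poly _} => p`_i)); rewrite !coef_map /= => ->.
rewrite -[(Om`_i)%:P]alg_polyC in_qpolyZ.
by rewrite in_qpoly1.
Qed.

End QuotientRoots.

(** * Specialization as a relation between rings *)

Section RingRelation.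
Variables (A B : comNzRingType) (rho : A -> B -> Prop).

(* A partially defined, possibly multivalued ring morphism. *)
Definition ring_relation := [/\ rho 1 1,
  forall a b a' b', rho a b -> rho a' b' -> rho (a - a') (b - b') &
  forall a b a' b', rho a b -> rho a' b' -> rho (a * a') (b * b')].

Hypothesis rr : ring_relation.

Lemma rr1 : rho 1 1. Proof. by have [] := rr. Qed.

Lemma rrB a b a' b' : rho a b -> rho a' b' -> rho (a - a') (b - b').
Proof. by have [_ h _] := rr; exact: h. Qed.

Lemma rrM a b a' b' : rho a b -> rho a' b' -> rho (a * a') (b * b').
Proof. by have [_ _ h] := rr; exact: h. Qed.

Lemma rr0 : rho 0 0.
Proof. by rewrite -(subrr (1 : A)) -(subrr (1 : B)); apply: rrB; exact: rr1. Qed.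

Lemma rrN a b : rho a b -> rho (- a) (- b).
Proof. by move=> h; rewrite -sub0r -[- b]sub0r; apply: rrB => //; exact: rr0. Qed.

Lemma rrD a b a' b' : rho a b -> rho a' b' -> rho (a + a') (b + b').
Proof. by move=> h /rrN h'; rewrite -[a']opprK -[b']opprK; exact: rrB. Qed.

Lemma rr_sum I (s : seq I) (f : I -> A) (g : I -> B) :
  (forall i, rho (f i) (g i)) -> rho (\sum_(i <- s) f i) (\sum_(i <- s) g i).
Proof. by move=> h; elim/big_ind2: _ => //; [exact: rr0|move=> *; exact: rrD]. Qed.

Lemma rr_prod_in (I : eqType) (s : seq I) (f : I -> A) (g : I -> B) :
  (forall i, i \in s -> rho (f i) (g i)) -> rho (\prod_(i <- s) f i) (\prod_(i <- s) g i).
Proof.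
elim: s => [|i s IH] h; first by rewrite !big_nil; exact: rr1.
rewrite !big_cons; apply: rrM; first by apply: h; rewrite mem_head.
by apply: IH => j js; apply: h; rewrite inE js orbT.
Qed.

Lemma rrX a b n : rho a b -> rho (a ^+ n) (b ^+ n).
Proof. by move=> h; elim: n => [|n IH]; [exact: rr1|rewrite !exprS; exact: rrM]. Qed.

Lemma rrMn a b n : rho a b -> rho (a *+ n) (b *+ n).
Proof. by move=> h; elim: n => [|n IH]; [exact: rr0|rewrite !mulrS; exact: rrD]. Qed.

Definition poly_relation (p : {poly A}) (q : {poly B}) := forall k, rho p`_k q`_k.

Lemma poly_relationC a b : rho a b -> poly_relation a%:P b%:P.
Proof. by move=> h k; rewrite !coefC; case: eqP => // _; exact: rr0. Qed.

Lemma poly_relationX : poly_relation 'X 'X.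
Proof. by move=> k; rewrite !coefX; case: eqP => _; [exact: rr1|exact: rr0]. Qed.

Lemma poly_relation_deriv p q : poly_relation p q -> poly_relation p^`() q^`().
Proof. by move=> h k; rewrite !coef_deriv; exact: rrMn. Qed.

End RingRelation.

Lemma poly_relation_ring (A B : comNzRingType) (rho : A -> B -> Prop) :
  ring_relation rho -> ring_relation (poly_relation rho).
Proof.
move=> rr; split.
- by move=> k; rewrite !coef1; case: eqP => _; [exact: rr1 rr|exact: rr0 rr].
- by move=> p q p' q' h h' k; rewrite !coefB; exact: rrB rr _ _ _ _ (h k) (h' k).
- by move=> p q p' q' h h' k; rewrite !coefM; apply: (rr_sum rr) => i; apply: (rrM rr).
Qed.

(** Specialization of the coefficients followed by evaluation at [w]; applied coefficientwise it
    handles polynomials in two indeterminates. *)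
Definition horner_relation (A B : comNzRingType) (rho : A -> B -> Prop) (w : B)
  (p : {poly A}) (b : B) := exists2 q, poly_relation rho p q & b = q.[w].

Lemma horner_relation_ring (A B : comNzRingType) (rho : A -> B -> Prop) w :
  ring_relation rho -> ring_relation (horner_relation rho w).
Proof.
move=> /poly_relation_ring rr; split.
- by exists 1; [exact: rr1 rr|rewrite hornerC].
- by move=> a _ a' _ [q h ->] [q' h' ->]; exists (q - q'); [exact: (rrB rr)|rewrite hornerD hornerN].
- by move=> a _ a' _ [q h ->] [q' h' ->]; exists (q * q'); [exact: (rrM rr)|rewrite hornerM].
Qed.

Lemma poly_relation_inj (A B : comNzRingType) (rho : A -> B -> Prop) p q q' :
  (forall a b b', rho a b -> rho a b' -> b = b') ->
  poly_relation rho p q -> poly_relation rho p q' -> q = q'.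
Proof. by move=> inj h h'; apply/polyP => k; exact: inj (h k) (h' k). Qed.

Lemma horner_relation_inj (A B : comNzRingType) (rho : A -> B -> Prop) w p b b' :
  (forall a b b', rho a b -> rho a b' -> b = b') ->
  horner_relation rho w p b -> horner_relation rho w p b' -> b = b'.
Proof. by move=> inj [q h ->] [q' h' ->]; rewrite (poly_relation_inj inj h h'). Qed.

Lemma poly_relation_comp (A B : comNzRingType) (rho : A -> B -> Prop) p p' q q' :
  ring_relation rho -> poly_relation rho p q -> poly_relation rho p' q' ->
  poly_relation rho (p \Po p') (q \Po q').
Proof.
(* Related polynomials may have different sizes, so both compositions are written as sums of a
   common length. *)
move=> rr h h'; have RR := poly_relation_ring rr; pose n := maxn (size p) (size q).
have E (C : comNzRingType) (s t : {poly C}) : (size s <= n)%N -> s \Po t = \sum_(i < n) (s`_i)%:P * t ^+ i.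
  move=> sn; rewrite /comp_poly (horner_coef_wide _ (n := n)).
    by apply: eq_bigr => i _; rewrite coef_map.
  by rewrite size_map_polyC.
rewrite !E ?leq_maxl ?leq_maxr //; apply: (rr_sum RR) => i; apply: (rrM RR).
  exact: (poly_relationC rr).
exact: (rrX RR).
Qed.

Section RationalValues.
Context {R : realType}.
Local Notation Cu := {fraction {poly R[i]}}.
Implicit Types (F : Cu) (u w : R[i]).

(* [poly_relation (value_at u) Om g] unfolds to [polyfun_value Om u g]. *)
Definition value_at u F w := ratfun_value F u w.

Lemma value_at_ring u : ring_relation (value_at u).
Proof.
split.
- by exists 1, 1; rewrite !hornerC oner_eq0 divr1 tofrac1 divr1.
- move=> _ _ _ _ [p [d [-> d0 ->]]] [p' [d' [-> d0' ->]]].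
  have D : d != 0 by apply: contraNneq d0 => ->; rewrite horner0.
  have D' : d' != 0 by apply: contraNneq d0' => ->; rewrite horner0.
  exists (p * d' - p' * d), (d * d'); split.
  + by rewrite tofracB !tofracM -mulNr addf_div ?tofrac_eq0 // mulNr.
  + by rewrite hornerM mulf_neq0.
  + by rewrite hornerD hornerN !hornerM; field; rewrite d0 d0'.
- move=> _ _ _ _ [p [d [-> d0 ->]]] [p' [d' [-> d0' ->]]].
  have D : d != 0 by apply: contraNneq d0 => ->; rewrite horner0.
  have D' : d' != 0 by apply: contraNneq d0' => ->; rewrite horner0.
  exists (p * p'), (d * d'); split.
  + by rewrite !tofracM mulf_div.
  + by rewrite hornerM mulf_neq0.
  + by rewrite !hornerM; field; rewrite d0 d0'.
Qed.

Lemma value_at_inj u F w w' : value_at u F w -> value_at u F w' -> w = w'.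
Proof.
move=> [p [d [-> d0 ->]]] [p' [d' [E d0' ->]]].
have D : d != 0 by apply: contraNneq d0 => ->; rewrite horner0.
have D' : d' != 0 by apply: contraNneq d0' => ->; rewrite horner0.
have : tofrac (p * d') = tofrac (p' * d).
  by apply/eqP; rewrite !tofracM -eqr_div ?tofrac_eq0 //; apply/eqP.
move=> /eqP; rewrite tofrac_eq => /eqP /(congr1 (fun q => q.[u])).
by rewrite !hornerM => H; apply/eqP; rewrite eqr_div //; apply/eqP.
Qed.

(** A fixed representative, perhaps not in lowest terms: its denominator can vanish at finitely many
    points where the fraction has a value. *)
Definition frac_num F : {poly R[i]} := (fraction.frac (repr F)).1.
Definition frac_den F : {poly R[i]} := (fraction.frac (repr F)).2.

Lemma frac_den_neq0 F : frac_den F != 0.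
Proof. exact: denom_ratioP. Qed.

Lemma frac_numden F : F = tofrac (frac_num F) / tofrac (frac_den F).
Proof.
have d0 : tofrac (frac_den F) != 0 by rewrite tofrac_eq0 frac_den_neq0.
apply: (mulIf d0); rewrite divfK // /frac_num /frac_den.
rewrite -{1}[F]reprK; move: (repr F) {d0} => r; unlock FracField.tofrac.
rewrite -[LHS]FracField.pi_mul; apply/eqmodP; rewrite /= FracField.equivfE /FracField.mulf.
by rewrite !numden_Ratio ?mulr1 ?oner_eq0 ?mulf_neq0 ?denom_ratioP // mulrC.
Qed.

(** Validity for all but finitely many [u]. A polynomial as witness makes conjunctions easy
    (multiply) and can be avoided near any point of [S], as its zeros are isolated. *)
Definition generic (Q : R[i] -> Prop) := exists2 d : {poly R[i]}, d != 0 &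
  forall u, d.[u] != 0 -> Q u.

Lemma generic_and Q Q' : generic Q -> generic Q' -> generic (fun u => Q u /\ Q' u).
Proof.
move=> [d d0 dQ] [e e0 eQ]; exists (d * e); first by rewrite mulf_neq0.
by move=> u; rewrite hornerM mulf_eq0 negb_or => /andP[/dQ ? /eQ ?].
Qed.

Lemma generic_sub Q Q' : (forall u, Q u -> Q' u) -> generic Q -> generic Q'.
Proof. by move=> QQ [d d0 dQ]; exists d => // u /dQ/QQ. Qed.

Lemma generic_true Q : (forall u, Q u) -> generic Q.
Proof. by move=> h; exists 1; rewrite ?oner_eq0. Qed.

Lemma generic_seq (I : eqType) (s : seq I) (Q : I -> R[i] -> Prop) :
  (forall i, generic (Q i)) -> generic (fun u => forall i, i \in s -> Q i u).
Proof.
move=> h; elim: s => [|i s IH]; first exact: generic_true.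
apply: generic_sub (generic_and (h i) IH) => u [Qi Qs] j.
by rewrite inE => /orP[/eqP->|/Qs].
Qed.

Lemma generic_exists Q : generic Q -> exists u, Q u.
Proof.
move=> [d d0 dQ]; apply: contrapT => nQ.
have root k : root d (k%:R : R[i]).
  by apply/negPn/negP => h; apply: nQ; exists (k%:R); exact: dQ.
have := @max_poly_roots _ d [seq (k%:R : R[i]) | k <- iota 0 (size d)] d0.
rewrite size_map size_iota ltnn => h; suff : false by []; apply: h.
  by apply/allP => _ /mapP[k _ ->].
rewrite map_inj_uniq ?iota_uniq // => i j /eqP; rewrite eqr_nat => /eqP //.
Qed.

Lemma value_generic F : generic (fun u => exists w, value_at u F w).
Proof.
exists (frac_den F); first exact: frac_den_neq0.
move=> u du; exists ((frac_num F).[u] / (frac_den F).[u]), (frac_num F), (frac_den F).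
by split=> //; exact: frac_numden.
Qed.

Lemma size_poly_value u (p : {poly Cu}) q : poly_relation (value_at u) p q ->
  (size q <= size p)%N.
Proof.
move=> h; apply/leq_sizeP => k pk; apply: value_at_inj (h k) _.
by rewrite nth_default //; exact: rr0 (value_at_ring u).
Qed.

Lemma monic_poly_value u (p : {poly Cu}) q : poly_relation (value_at u) p q ->
  p \is monic -> q \is monic /\ size q = size p.
Proof.
move=> h mp; have p0 : (0 < size p)%N by rewrite lt0n size_poly_eq0 monic_neq0.
have lc : q`_(size p).-1 = 1.
  have := h (size p).-1; rewrite -lead_coefE (monicP mp) => /value_at_inj; apply.
  exact: rr1 (value_at_ring u).
have sq : size q = size p.
  apply/eqP; rewrite eqn_leq (size_poly_value h) /= -(prednK p0) ltnNge.
  by apply/negP => /leq_sizeP /(_ _ (leqnn _)) E; move: lc; rewrite E => /eqP; rewrite eq_sym oner_eq0.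
by split=> //; rewrite monicE lead_coefE sq lc.
Qed.

End RationalValues.

Section GenericAlgebra.
Context {R : realType}.
Local Notation Cu := {fraction {poly R[i]}}.
Implicit Types (F : Cu) (u w : R[i]) (p q : {poly Cu}).

(** Meaningful where [common_den p] does not vanish; elsewhere some quotients may be divisions by
    0. *)
Definition specialized p u : {poly R[i]} :=
  \poly_(k < size p) ((frac_num p`_k).[u] / (frac_den p`_k).[u]).

Definition common_den p : {poly R[i]} := \prod_(k < size p) frac_den p`_k.

Lemma common_den_neq0 p : common_den p != 0.
Proof. by apply/prodf_neq0 => k _; exact: frac_den_neq0. Qed.

Lemma common_den_coef p u (k : nat) : (common_den p).[u] != 0 -> (k < size p)%N ->
  (frac_den p`_k).[u] != 0.
Proof.
move=> du kp; apply: contraNneq du => dk.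
by rewrite /common_den horner_prod (bigD1 (Ordinal kp)) //= dk mul0r.
Qed.

Lemma specializedP p u : (common_den p).[u] != 0 ->
  poly_relation (value_at u) p (specialized p u).
Proof.
move=> du k; rewrite coef_poly; case: ltnP => kp; last first.
  by rewrite nth_default //; exact: rr0 (value_at_ring u).
exists (frac_num p`_k), (frac_den p`_k); split=> //; first exact: frac_numden.
exact: common_den_coef.
Qed.

Lemma specialized_generic p :
  generic (fun u => poly_relation (value_at u) p (specialized p u)).
Proof. by exists (common_den p); [exact: common_den_neq0|move=> u; exact: specializedP]. Qed.

(** A Bezout relation with nonzero constant [c] specializes, and excludes common roots as soon as
    [c] has a nonzero value. *)
Lemma coprime_generic p q : coprimep p q -> generic (fun u => forall p' q' : {poly R[i]},
  poly_relation (value_at u) p p' -> poly_relation (value_at u) q q' ->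
  forall w, p'.[w] = 0 -> q'.[w] <> 0).
Proof.
move=> /Bezout_coprimepP[[a b] /=]; rewrite -size_poly_eq1 => /size_poly1P[c c0 E].
apply: generic_sub (generic_and (generic_and (specialized_generic a) (specialized_generic b))
  (* That the inverse of [c] has a value too forces the value of [c] to be nonzero. *)
  (generic_and (value_generic c) (value_generic c^-1))).
move=> u [[au bu] [[v cv] [v' cv']]] p' q' pp' qq' w pw qw.
have rr := value_at_ring u; have RR := poly_relation_ring rr.
have h := rrD RR (rrM RR au pp') (rrM RR bu qq'); rewrite E in h.
have h' := poly_relationC rr cv.
have := poly_relation_inj (@value_at_inj R u) h h'.
move=> /(congr1 (fun g => g.[w])); rewrite hornerD !hornerM pw qw !mulr0 addr0 hornerC => v0.
have := rrM rr cv cv'; rewrite -v0 mul0r divff // => /value_at_inj /(_ (rr1 rr)) /eqP.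
by rewrite eq_sym oner_eq0.
Qed.

Lemma natr_fraction_neq0 n : (n.+1)%:R != 0 :> Cu.
Proof.
rewrite -[n.+1%:R](rmorph_nat (@FracField.tofrac {poly R[i]})) tofrac_eq0.
by rewrite -polyC_natr polyC_eq0 pnatr_eq0.
Qed.

Section Irreducible.
Variables (Om : {poly Cu}) (irr : irreducible_poly Om) (mon : Om \is monic).

Lemma separable_generic : generic (fun u => forall g, poly_relation (value_at u) Om g ->
  forall w, g.[w] = 0 -> g^`().[w] <> 0).
Proof.
have [s1 _] := irr.
have sz : size Om = (size Om).-2.+2 by case: (size Om) s1 => [|[]].
have nd : ~~ (Om %| Om^`()).
  have d0 : Om^`() != 0.
    apply/eqP => /(congr1 (fun p : {poly _} => p`_(size Om).-2)).
    rewrite coef_deriv coef0; have -> : (size Om).-2.+1 = (size Om).-1 by rewrite sz.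
    rewrite -lead_coefE (monicP mon) sz /= => /eqP; exact/negP/natr_fraction_neq0.
  apply/negP => /(dvdp_leq d0); rewrite leqNgt => /negP; apply.
  by apply: lt_size_deriv; rewrite -size_poly_eq0 sz.
have cop : coprimep Om Om^`() by rewrite irreducible_poly_coprime.
apply: generic_sub (coprime_generic cop) => u h g Og w gw.
exact: (h _ _ Og (poly_relation_deriv (value_at_ring u) Og) w gw).
Qed.

(** If [Om] did not divide [q], irreducibility would make them coprime, and a generic [u] could not
    give a common root. Equality of the specializations follows from divisibility, degree and
    monicity. *)
Lemma divides_generic q (N : nat) : size Om = N.+1 ->
  generic (fun u => exists q' : {poly R[i]}, [/\ poly_relation (value_at u) q q', q' \is monic, size q' = N.+1 &
    (forall g, poly_relation (value_at u) Om g -> exists w, g.[w] = 0 /\ q'.[w] = 0)]) ->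
  generic (fun u => forall q' g : {poly R[i]}, poly_relation (value_at u) q q' -> q' \is monic ->
    size q' = N.+1 -> poly_relation (value_at u) Om g -> q' = g).
Proof.
move=> sOm gq.
have dv : Om %| q.
  apply/negPn/negP => nd; have cop : coprimep Om q by rewrite irreducible_poly_coprime.
  have [u [[[q' [qq' _ _ h]] h'] Og]] := generic_exists (generic_and (generic_and gq (coprime_generic cop)) (specialized_generic Om)).
  have [w [gw qw]] := h _ Og.
  exact: (h' _ _ Og qq' w gw qw).
move: dv => /dvdpP[y yE].
apply: generic_sub (specialized_generic y) => u yu q' g qq' mq' sq' Og.
have rr := value_at_ring u; have RR := poly_relation_ring rr.
have := rrM RR yu Og; rewrite -yE => /(poly_relation_inj (@value_at_inj R u) qq') E.
have [mg sg] := monic_poly_value Og mon.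
apply/eqP; rewrite -eqp_monic // eqp_sym -dvdp_size_eqp; last by rewrite E dvdp_mull.
by rewrite sg sq' sOm.
Qed.

End Irreducible.

Section Galois.
Variables (Om : {poly Cu}) (irr : monic_irreducible_poly Om).
Hypothesis gal : galois_extension {poly %/ Om with irr}.

(** At a root [w] of the specialization of [Om], the multiples of [Om] vanish: the values at [w] of
    the polynomials [hs] list the roots, and each of these values gives back [w]. The denominators
    are kept away from 0 for the sake of continuity. *)
Lemma galois_generic : exists hs : seq {poly Cu}, generic (fun u =>
  (forall h, h \in hs -> (common_den h).[u] != 0) /\
  forall g, poly_relation (value_at u) Om g ->
    (forall w, g.[w] = 0 -> g = \prod_(h <- hs) ('X - ((specialized h u).[w])%:P)) /\
    forall h w w', h \in hs -> g.[w] = 0 -> g.[w'] = 0 ->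
      (specialized h u).[w] = (specialized h u).[w'] -> w = w').
Proof.
have [hs [hsO hsk]] := quotient_roots gal; exists hs.
set P := map_poly polyC Om - \prod_(h <- hs) ('X - h%:P).
have g1 : generic (fun u => forall h, h \in hs -> (common_den h).[u] != 0).
  by apply: generic_seq => h; exists (common_den h); [exact: common_den_neq0|].
(* A divisibility is specialized through its cofactor, whose denominators have to be avoided as
   well. *)
have /choice[z zP] : forall i, exists z, P`_i = z * Om by move=> i; apply/dvdpP.
have /choice[k kP] : forall h, exists k, h \in hs -> Om %| k \Po h - 'X.
  move=> h; have [hh|nh] := boolP (h \in hs); last by exists 0.
  by have [k ?] := hsk h hh; exists k.
have /choice[y yP] : forall h, exists y, h \in hs -> k h \Po h - 'X = y * Om.
  move=> h; have [hh|nh] := boolP (h \in hs); last by exists 0.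
  by have /dvdpP[y ?] := kP h hh; exists y.
have g2 := generic_seq (iota 0 (size P)) (fun i => specialized_generic (z i)).
have g3 := generic_seq hs (fun h => specialized_generic (k h)).
have g4 := generic_seq hs (fun h => specialized_generic (y h)).
apply: generic_sub (generic_and (generic_and g1 g2) (generic_and g3 g4)).
move=> u [[du zu] [ku yu]]; split=> // g Og.
have rr := value_at_ring u; have RR := poly_relation_ring rr.
have hu h : h \in hs -> poly_relation (value_at u) h (specialized h u).
  by move=> hh; apply: specializedP; exact: du.
split=> [w gw|h w w' hh gw gw'].
  have rr2 := horner_relation_ring w rr; have RR2 := poly_relation_ring rr2.
  have h1 : poly_relation (horner_relation (value_at u) w) (map_poly polyC Om) g.
    move=> i; rewrite coef_map /=; exists (g`_i)%:P; last by rewrite hornerC.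
    exact: (poly_relationC rr (Og i)).
  have h2 : poly_relation (horner_relation (value_at u) w) (\prod_(h <- hs) ('X - h%:P))
      (\prod_(h <- hs) ('X - ((specialized h u).[w])%:P)).
    apply: (rr_prod_in RR2) => h hh; apply: (rrB RR2); first exact: (poly_relationX rr2).
    by apply: (poly_relationC rr2); exists (specialized h u); [exact: hu|].
  have h3 := rrB RR2 h1 h2; apply/eqP; rewrite -subr_eq0; apply/eqP/polyP => i.
  rewrite coef0; apply: (horner_relation_inj (@value_at_inj R u) (h3 i)).
  rewrite -/P; have [iP|iP] := ltnP i (size P); last by rewrite nth_default //; exact: rr0 rr2.
  rewrite zP; exists (specialized (z i) u * g); last by rewrite hornerM gw mulr0.
  by apply: (rrM RR) => //; apply: zu; rewrite mem_iota.
have E : specialized (k h) u \Po specialized h u - 'X = specialized (y h) u * g.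
  apply: (poly_relation_inj (@value_at_inj R u) (p := k h \Po h - 'X)).
    apply: (rrB RR); last exact: (poly_relationX rr).
    by apply: (poly_relation_comp rr); [exact: ku|exact: hu].
  by rewrite yP //; apply: (rrM RR) => //; exact: yu.
have inv x : g.[x] = 0 -> (specialized (k h) u).[(specialized h u).[x]] = x.
  move=> gx; move: E => /(congr1 (fun p : {poly R[i]} => p.[x])).
  rewrite hornerD hornerN hornerX horner_comp hornerM gx mulr0 => /eqP.
  by rewrite subr_eq0 => /eqP.
by move=> hE; rewrite -(inv w gw) -(inv w' gw') hE.
Qed.
End Galois.

End GenericAlgebra.

(** * The root of least modulus *)

Section Adjacency.
Context {R : realType} {VX EX : finType} {VY EY : choiceType}.
Variables (X : graph VX EX) (Y : graph VY EY) (act : free_Zaction Y).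
Variables (pV : VY -> VX) (pE : EY -> EX) (lift : VX -> VY) (q : nat).
Hypothesis covering : quotient_map act X pV pE.
Hypothesis liftK : cancel lift pV.
Hypothesis X_regular : regular_graph X q.+1.

Let arcs (i j : VX) : set (int * EY) := [set ke | source Y ke.2 = lift i /\
  target Y ke.2 = shiftV act ke.1 (lift j)].

Let pV_shift k v : pV (shiftV act k v) = pV v.
Proof. by apply/esym/(quotient_orbitV covering); exists k. Qed.

Let target_reverse (e : EY) : target Y (reverse Y e) = source Y e.
Proof. by rewrite -source_reverse reverseK. Qed.

Lemma arcs_edge i j ke : arcs i j ke -> source X (pE ke.2) = i /\ target X (pE ke.2) = j.
Proof.
move=> [s t]; rewrite (quotient_source covering) (quotient_target covering) s t.
by rewrite pV_shift !liftK.
Qed.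

(** Two edges over the same edge differ by a translation; it fixes the common source [lift i], so it
    is trivial by freeness. The exponent is then determined by the target, by freeness again. *)
Lemma arcs_inj i j : {in arcs i j &, injective (fun ke => pE ke.2)}.
Proof.
move=> [k e] [k' e'] /set_mem [/= s t] /set_mem [/= s' t'] /= E.
have [l lE] := (quotient_orbitE covering e e').1 E.
have l0 : l = 0.
  apply: (shiftV_free (f := act) (v := lift i)).
  by rewrite -{1}s -source_shift -lE s'.
have ee : e' = e by rewrite lE l0 shiftE0.
rewrite ee in t' *; congr (_, _); apply/eqP; rewrite -subr_eq0; apply/eqP.
apply: (shiftV_free (f := act) (v := lift j)).
have -> : shiftV act (k - k') (lift j) = shiftV act (- k') (shiftV act k (lift j)).
  by rewrite -shiftVD addrC.
by rewrite -t t' -shiftVD addNr shiftV0.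
Qed.

(** Finiteness is what makes the entries of the adjacency matrix genuine sums. *)
Lemma arcs_finite i j : finite_set (arcs i j).
Proof.
by rewrite -(eq_finite_set (inj_card_eq (@arcs_inj i j))); exact: finite_finset.
Qed.

Let between (i j : VX) := #|[set e : EX | (source X e == i) && (target X e == j)]%SET|.

Lemma arcs_size i j : (size (finmap.enum_fset (fset_set (arcs i j))) <= between i j)%N.
Proof.
rewrite -(size_map (fun ke => pE ke.2)) /between cardE; apply: uniq_leq_size.
  rewrite map_inj_in_uniq ?finmap.fset_uniq // => x y.
  rewrite !in_fset_set; try exact: arcs_finite.
  exact: (@arcs_inj i j).
move=> e /mapP[ke]; rewrite in_fset_set; last exact: arcs_finite.
by move=> /set_mem/arcs_edge[s t] ->; rewrite mem_enum inE s t !eqxx.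
Qed.

Lemma between_sum i : (\sum_(j < #|VX|) between i (enum_val j) = q.+1)%N.
Proof.
rewrite -(X_regular i) -sum1_card (partition_big (target X) xpredT) //=.
rewrite (reindex (@enum_val VX xpredT)) /=; last exact: onW_bij (enum_val_bij _).
by apply: eq_bigr => j _; rewrite /between -sum1_card; apply: eq_bigl => e; rewrite !inE.
Qed.

Lemma adjacency_entry_bound (t : R[i]) i j : cabs t = 1 ->
  cabs (adjacency_mx act lift t i j) <= (between (enum_val i) (enum_val j))%:R.
Proof.
move=> t1; rewrite mxE fsbig_finite; last exact: arcs_finite.
apply: le_trans (cabs_sum _ _ _) _.
apply: (@le_trans _ _ (size (finmap.enum_fset (fset_set (arcs (enum_val i) (enum_val j)))))%:R); last first.
  by rewrite ler_nat arcs_size.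
have tz (k : int) : cabs (t ^ k) = 1.
  by case: k => n; rewrite ?NegzE -?exprnP -?exprnN ?cabsV ?cabsX t1 expr1n ?invr1.
rewrite (eq_bigr (fun=> 1)) => [|ke _]; last exact: tz.
by rewrite big_const_seq count_predT iter_addr_0.
Qed.

Lemma adjacency_row_bound (t : R[i]) i : cabs t = 1 ->
  \sum_j cabs (adjacency_mx act lift t i j) <= q.+1%:R.
Proof.
move=> t1; rewrite -(between_sum (enum_val i)) natr_sum.
by apply: ler_sum => j _; exact: adjacency_entry_bound.
Qed.

(** An edge from [i] to the translate of [j] by t^k becomes, reversed and translated back, an edge
    from [j] to the translate of [i] by t^-k; on the unit circle conjugation inverts [t]. *)
Lemma adjacency_hermitian (t : R[i]) i j : cabs t = 1 ->
  (adjacency_mx act lift t i j)^* = adjacency_mx act lift t j i.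
Proof.
move=> t1; have t0 : t != 0 by rewrite -cabs_gt0 t1.
have tc : t^* = t^-1.
  by rewrite invc_norm normE t1 expr1n invr1 mul1r.
pose phi (ke : int * EY) := (- ke.1, shiftE act (- ke.1) (reverse Y ke.2)).
have phiP a b ke : arcs a b ke -> arcs b a (phi ke).
  move=> [s e]; split; rewrite /= ?source_shift ?target_shift.
    by rewrite source_reverse e -shiftVD addNr shiftV0.
  by rewrite target_reverse s.
have phiK ke : phi (phi ke) = ke.
  case: ke => k e; rewrite /phi /= opprK reverse_shift reverseK -shiftED subrr shiftE0.
  by [].
rewrite !mxE [RHS](reindex_fsbig phi (arcs (enum_val i) (enum_val j))); last first.
  split; first by move=> ke h; exact: (phiP _ _ _ h).
    by move=> x y _ _ /(congr1 phi); rewrite !phiK.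
  by move=> ke /phiP h; exists (phi ke).
rewrite !fsbig_finite; try exact: arcs_finite.
rewrite rmorph_sum; apply: eq_bigr => ke _ /=.
have -> : (t ^ ke.1)^* = t^* ^ ke.1 by exact: rmorphXz.
by rewrite tc exprz_inv.
Qed.

End Adjacency.

(** * Eigenvalues and the origin of the critical set *)

Section Spectrum.
Context {R : realType}.

Lemma mulcJ (z : R[i]) : z * conjc z = (cabs z ^+ 2)%:C.
Proof. by rewrite -sqr_normc normE rmorphXn. Qed.

Lemma hermitian_eigenvalue_real n (A : 'M[R[i]]_n) (v : 'rV[R[i]]_n) (l : R[i]) :
  (forall i j, conjc (A i j) = A j i) -> v != 0 -> v *m A = l *: v -> conjc l = l.
Proof.
move=> hA v0 vA; pose s := \sum_j v 0 j * conjc (v 0 j).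
have sE : s = (\sum_j cabs (v 0 j) ^+ 2)%:C.
  by rewrite rmorph_sum; apply: eq_bigr => j _; exact: mulcJ.
have s0 : s != 0.
  rewrite sE fmorph_eq0; apply: contraNneq v0 => /eqP; rewrite psumr_eq0; last first.
    by move=> j _; exact: sqr_ge0.
  move=> /allP h; apply/eqP/rowP => j; rewrite mxE; apply/eqP.
  by have := h j; rewrite mem_index_enum sqrf_eq0 cabs_eq0 => /(_ isT).
have E : l * s = \sum_j \sum_i v 0 i * A i j * conjc (v 0 j).
  rewrite /s mulr_sumr; apply: eq_bigr => j _; rewrite mulrA.
  have := congr1 (fun w : 'rV_n => w 0 j) vA; rewrite !mxE => <-.
  by rewrite mulr_suml.
have sc : conjc s = s by rewrite sE conjc_real.
apply: (mulIf s0); rewrite -{1}sc -rmorphM E rmorph_sum exchange_big /=.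
apply: eq_bigr => i _; rewrite rmorph_sum; apply: eq_bigr => j _ /=.
rewrite !rmorphM /= hA conjcK; ring.
Qed.

(** Compare at a coordinate of largest modulus; for a left eigenvector the sums run over columns. *)
Lemma eigenvalue_bound n (A : 'M[R[i]]_n) (v : 'rV[R[i]]_n) (l : R[i]) (M : R) :
  (forall j, \sum_i cabs (A i j) <= M) -> v != 0 -> v *m A = l *: v -> cabs l <= M.
Proof.
move=> AM v0 vA.
have [j0 vj0] : exists j, v 0 j != 0.
  apply: contrapT => h; move/eqP: v0; apply; apply/rowP => j; rewrite mxE.
  by apply/eqP/negPn/negP => vj; apply: h; exists j.
pose j := [arg max_(i > j0) cabs (v 0 i)]%O.
have jmax i : cabs (v 0 i) <= cabs (v 0 j).
  by rewrite /j; case: Order.TotalTheory.arg_maxP => // k _ h; exact: h.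
have vp : 0 < cabs (v 0 j) by apply: lt_le_trans (jmax j0); rewrite cabs_gt0.
rewrite -(ler_pM2r vp) -cabsM.
have -> : l * v 0 j = \sum_i v 0 i * A i j.
  by have := congr1 (fun w : 'rV_n => w 0 j) vA; rewrite !mxE => ->.
apply: le_trans (cabs_sum _ _ _) _.
apply: (@le_trans _ _ (\sum_i cabs (A i j) * cabs (v 0 j))).
  apply: ler_sum => i _; rewrite cabsM mulrC; apply: ler_wpM2l => //; exact: cabs_ge0.
by rewrite -mulr_suml; apply: ler_wpM2r => //; exact: cabs_ge0.
Qed.

(** The two roots [u] have product 1/q. If [u] is not real they are conjugate, which gives the
    circle; if [u] is real, [|l| <= q + 1] yields (q |u| - 1)(|u| - 1) <= 0, which gives the two
    segments. *)
Lemma critical_quadratic (q : nat) (u : R[i]) (l : R) : (0 < q)%N ->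
  `|l| <= q.+1%:R -> 1 + q%:R * u ^+ 2 = l%:C * u -> u \in critical_set (R := R) q.
Proof.
case: u => a b; move=> q0 lq E; have Q : 1 <= q%:R :> R by rewrite ler1n.
have Qc : (q%:R : R[i]) = (q%:R : R)%:C by rewrite rmorph_nat.
move: E; rewrite Qc expr2 => /eqP; rewrite eq_complex /= => /andP[/eqP E1 /eqP E2].
rewrite -natr1 in lq.
have {}E1 : 1 + q%:R * (a * a - b * b) = l * a by move: E1; lra.
have {}E2 : b * (2 * q%:R * a - l) = 0 by move: E2; lra.
apply: mem_set; move: E2 => /eqP; rewrite mulf_eq0 => /orP[/eqP b0|/eqP lE].
  have lb : -(q%:R + 1) <= l <= q%:R + 1 by rewrite -ler_norml.
  rewrite b0 in E1 *; have {}E1 : 1 + q%:R * (a * a) = l * a by rewrite -E1; ring.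
  have [a0|a0] := leP 0 a.
    right; exists a => //; rewrite /= in_itv /=.
    have h : (q%:R * a - 1) * (a - 1) <= 0 by nra.
    have qa : 1 <= q%:R * a.
      rewrite leNgt; apply/negP => h1; have : a < 1 by nra.
      by nra.
    have a1 : a <= 1.
      rewrite leNgt; apply/negP => h1.
      have : 0 <= (q%:R - 1) * a by apply: mulr_ge0; lra.
      have : 0 < (q%:R * a - 1) * (a - 1); last by lra.
      have h2 : 0 <= (q%:R - 1) * a by apply: mulr_ge0; lra.
      by apply: mulr_gt0; lra.
    by rewrite a1 andbT -[_^-1]mul1r ler_pdivrMr ?ltr0n // mulrC.
  left; right; exists a => //; rewrite /= in_itv /=.
  have h : (q%:R * a + 1) * (a + 1) <= 0.
    have : 0 <= (l + (q%:R + 1)) * - a by apply: mulr_ge0; lra.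
    lra.
  have qa : q%:R * a <= -1.
    rewrite leNgt; apply/negP => h1.
    have h2 : q%:R * a <= a.
      have : 0 <= (q%:R - 1) * - a by apply: mulr_ge0; lra.
      lra.
    have : 0 < (q%:R * a + 1) * (a + 1) by apply: mulr_gt0; lra.
    lra.
  have a1 : -1 <= a.
    rewrite leNgt; apply/negP => h1.
    have h2 : q%:R * a <= a.
      have : 0 <= (q%:R - 1) * - a by apply: mulr_ge0; lra.
      lra.
    have : 0 < (- (q%:R * a + 1)) * - (a + 1) by apply: mulr_gt0; lra.
    lra.
  by rewrite a1 /= lerNr -[_^-1]mul1r ler_pdivrMr ?ltr0n //; lra.
left; left; rewrite /= normE /=; congr (_%:C).
have E : q%:R * (a ^+ 2 + b ^+ 2) = 1.
  have lE' : l = 2 * q%:R * a by lra.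
  by rewrite lE' in E1; lra.
have qp : 0 < q%:R :> R by lra.
rewrite -sqrtrV; last by lra.
by congr Num.sqrt; apply: (mulfI (lt0r_neq0 qp)); rewrite E divff // gt_eqF.
Qed.

End Spectrum.

Section Joukowski.
Context {R : realType}.
Implicit Types r : R[i].

(* Writing [r + 1 = a^2] and [r - 1 = b^2] with principal square roots [a], [b],
   the numbers [r + s] and [r - s] are [(a + b)^2 / 2] and [(a - b)^2 / 2]; the
   principal roots satisfy [0 <= Re (a * conj b)], with equality only for real [r] in
   [-1, 1]. *)
Lemma joukowski_lt r : ~ (exists2 x : R, -1 <= x <= 1 & r = x%:C) ->
  cabs (r - sqrtc (r + 1) * sqrtc (r - 1)) < cabs (r + sqrtc (r + 1) * sqrtc (r - 1)).
Proof.
move=> nr; set a := sqrtc (r + 1); set b := sqrtc (r - 1).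
have a2 : a ^+ 2 = r + 1 by exact: sqr_sqrtc.
have b2 : b ^+ 2 = r - 1 by exact: sqr_sqrtc.
have c2 : (2 : R[i]) != 0 by rewrite pnatr_eq0.
have e1 : r - a * b = (a - b) ^+ 2 / 2.
  have -> : (a - b) ^+ 2 = a ^+ 2 + b ^+ 2 - 2 * (a * b) by ring.
  by rewrite a2 b2; field.
have e2 : r + a * b = (a + b) ^+ 2 / 2.
  have -> : (a + b) ^+ 2 = a ^+ 2 + b ^+ 2 + 2 * (a * b) by ring.
  by rewrite a2 b2; field.
have i2 : 0 < cabs (2^-1 : R[i]) by rewrite cabs_gt0 invr_eq0.
rewrite e1 e2 !(cabsM (_ ^+ 2)) ltr_pM2r // !cabsX.
have sq (z : R[i]) : cabs z ^+ 2 = complex.Re z ^+ 2 + complex.Im z ^+ 2.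
  by rewrite cabsE sqr_sqrtr // addr_ge0 ?sqr_ge0.
rewrite !sq.
suff : 0 < complex.Re a * complex.Re b + complex.Im a * complex.Im b.
  have ReD (z w : R[i]) : complex.Re (z + w) = complex.Re z + complex.Re w by case: z w => [? ?] [? ?].
  have ImD (z w : R[i]) : complex.Im (z + w) = complex.Im z + complex.Im w by case: z w => [? ?] [? ?].
  have ReN (z : R[i]) : complex.Re (- z) = - complex.Re z by case: z.
  have ImN (z : R[i]) : complex.Im (- z) = - complex.Im z by case: z.
  by rewrite !ReD !ImD ReN ImN => h; nra.
rewrite /a /b; case: r nr {a b a2 b2 e1 e2} => x y nr.
have -> : (x +i* y)%C + 1 = ((x + 1) +i* y)%C :> R[i].
  by apply/eqP; rewrite eq_complex /= addr0 !eqxx.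
have -> : (x +i* y)%C - 1 = ((x - 1) +i* y)%C :> R[i].
  by apply/eqP; rewrite eq_complex /= oppr0 addr0 !eqxx.
rewrite /sqrtc.
(* The principal root puts the sign [g] of the imaginary part on its own imaginary part; [r + 1] and
   [r - 1] share it, and it cancels in the product. *)
rewrite /=; set g := (if y == 0 then 1 else Num.sg y); set A := Num.sqrt ((x + 1) ^+ 2 + _); set B := Num.sqrt ((x - 1) ^+ 2 + _).
rewrite /=.
have gg : g * g = 1.
  rewrite /g; case: eqVneq => [_|y0]; first by rewrite mulr1.
  by rewrite -expr2 sqr_sg y0.
have -> : g * Num.sqrt ((A - (x + 1)) / 2) * (g * Num.sqrt ((B - (x - 1)) / 2)) =
  Num.sqrt ((A - (x + 1)) / 2) * Num.sqrt ((B - (x - 1)) / 2).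
  by rewrite mulrACA gg mul1r.
have A0 : `|x + 1| <= A by rewrite /A -sqrtr_sqr ler_wsqrtr // lerDl sqr_ge0.
have B0 : `|x - 1| <= B by rewrite /B -sqrtr_sqr ler_wsqrtr // lerDl sqr_ge0.
have s0 := @sqrtr_ge0 R.
have p1 : 0 <= Num.sqrt ((A + (x + 1)) / 2) * Num.sqrt ((B + (x - 1)) / 2) by rewrite mulr_ge0.
have p2 : 0 <= Num.sqrt ((A - (x + 1)) / 2) * Num.sqrt ((B - (x - 1)) / 2) by rewrite mulr_ge0.
have lA : - A <= x + 1 <= A by rewrite -ler_norml.
have lB : - B <= x - 1 <= B by rewrite -ler_norml.
have [y0|y0] := eqVneq y 0.
  have AE : A = `|x + 1| by rewrite /A y0 expr0n addr0 sqrtr_sqr.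
  have BE : B = `|x - 1| by rewrite /B y0 expr0n addr0 sqrtr_sqr.
  have [x1|x1] := ltP 1 x.
    have : 0 < Num.sqrt ((A + (x + 1)) / 2) * Num.sqrt ((B + (x - 1)) / 2); last lra.
    by rewrite AE BE !ger0_norm; [rewrite mulr_gt0 // sqrtr_gt0; lra|lra|lra].
  have [x2|x2] := ltP x (-1).
    have : 0 < Num.sqrt ((A - (x + 1)) / 2) * Num.sqrt ((B - (x - 1)) / 2); last lra.
    by rewrite AE BE !ltr0_norm; [rewrite mulr_gt0 // sqrtr_gt0; lra|lra|lra].
  by case: nr; exists x; [rewrite x1 x2|rewrite y0].
have y2 : 0 < y ^+ 2 by rewrite exprn_even_gt0.
have A1 : `|x + 1| < A by rewrite /A -sqrtr_sqr ltr_sqrt ?ltrDl // ltr_wpDl ?sqr_ge0.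
have B1 : `|x - 1| < B by rewrite /B -sqrtr_sqr ltr_sqrt ?ltrDl // ltr_wpDl ?sqr_ge0.
have lA' : - A < x + 1 < A by rewrite -ltr_norml.
have lB' : - B < x - 1 < B by rewrite -ltr_norml.
have : 0 < Num.sqrt ((A + (x + 1)) / 2) * Num.sqrt ((B + (x - 1)) / 2); last lra.
by rewrite mulr_gt0 // sqrtr_gt0; lra.
Qed.

(** The numbers [r + s] and [r - s] are inverse to each other. *)
Lemma joukowski_neq0 r : r - sqrtc (r + 1) * sqrtc (r - 1) != 0.
Proof.
set s := sqrtc _ * _; have : (r + s) * (r - s) = 1.
  have -> : (r + s) * (r - s) = r ^+ 2 - s ^+ 2 by ring.
  by rewrite /s exprMn !sqr_sqrtc; ring.
by move=> h; apply/eqP => h0; move: h; rewrite h0 mulr0 => /eqP; rewrite eq_sym oner_eq0.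
Qed.

(** The products are compared factor by factor, with a strict inequality at an index where the sign
    is +1. *)
Lemma W_min n (r : 'I_n -> R[i]) (I : {ffun 'I_n -> bool}) :
  (forall i, ~ (exists2 x : R, -1 <= x <= 1 & r i = x%:C)) -> I <> [ffun=> true] ->
  cabs (W_ r [ffun=> true]) < cabs (W_ r I).
Proof.
move=> nr nI; have [i0 Ii0] : exists i, I i = false.
  apply: contrapT => h; apply: nI; apply/ffunP => i; rewrite ffunE.
  by apply/negPn/negP => /negPf Ii; apply: h; exists i.
rewrite /W_ !cabs_prod (bigD1 i0) //= [X in _ < X](bigD1 i0) //= ffunE Ii0 expr1 expr0 mulN1r mul1r.
have le i : cabs (r i + (-1) ^+ ([ffun=> true] : {ffun 'I_n -> bool}) i * (sqrtc (r i + 1) * sqrtc (r i - 1))) <=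
    cabs (r i + (-1) ^+ I i * (sqrtc (r i + 1) * sqrtc (r i - 1))).
  by rewrite ffunE; case: (I i); rewrite ?expr1 ?expr0 ?mul1r ?mulN1r //; exact: ltW (joukowski_lt (nr i)).
have pos i : 0 < cabs (r i + (-1) ^+ ([ffun=> true] : {ffun 'I_n -> bool}) i * (sqrtc (r i + 1) * sqrtc (r i - 1))).
  by rewrite ffunE expr1 mulN1r cabs_gt0 joukowski_neq0.
apply: (@lt_le_trans _ _ (cabs (r i0 + sqrtc (r i0 + 1) * sqrtc (r i0 - 1)) *
  \prod_(i < n | i != i0) cabs (r i + (-1) ^+ ([ffun=> true] : {ffun 'I_n -> bool}) i * (sqrtc (r i + 1) * sqrtc (r i - 1))))).
  by rewrite ltr_pM2r ?joukowski_lt // prodr_gt0.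
apply: ler_wpM2l; first exact: cabs_ge0.
by apply: ler_prod => i _; rewrite (ltW (pos i)) le.
Qed.

End Joukowski.

Section MinimalRoot.
Context {R : realType} {VX EX : finType} {VY EY : choiceType}.
Variables (X : graph VX EX) (Y : graph VY EY) (act : free_Zaction Y).
Variables (pV : VY -> VX) (pE : EY -> EX) (lift : VX -> VY) (q : nat).
Hypothesis q_gt0 : (0 < q)%N.
Hypothesis covering : quotient_map act X pV pE.
Hypothesis liftK : cancel lift pV.
Hypothesis X_regular : regular_graph X q.+1.
Variable P : {poly {poly int}}.
Hypothesis detP : determinant_poly (R := R) act lift q P.

(** Take [t] on the unit circle with real part [x]. A zero of the determinant gives an eigenvector
    of the Hermitian adjacency matrix with eigenvalue (1 + q u^2) / u, which is therefore real and
    at most [q + 1] in modulus; so [u] is critical. *)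
Lemma specialize_neq0 (u : R[i]) (x : R) : ~ critical_set (R := R) q u ->
  -1 <= x <= 1 -> (specialize P u).[x%:C] != 0.
Proof.
move=> uC x1; pose t : R[i] := (x +i* Num.sqrt (1 - x ^+ 2))%C.
have s2 : Num.sqrt (1 - x ^+ 2) ^+ 2 = 1 - x ^+ 2 by rewrite sqr_sqrtr //; nra.
have t1 : cabs t = 1.
  by rewrite cabsE /= s2 addrC subrK sqrtr1.
have t0 : t != 0 by rewrite -cabs_gt0 t1.
have tV : t^-1 = conjc t by rewrite invc_norm normE t1 expr1n invr1 mul1r.
have tx : (t + t^-1) / 2 = x%:C.
  rewrite tV addcJ /= mulrC mulKf //; by rewrite pnatr_eq0.
have := detP u t0; rewrite tx => <-.
apply/negP => /det0P[v v0 vD]; apply: uC; apply/set_mem.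
pose B : 'M[R[i]]_#|VX| := adjacency_mx act lift t.
have vE : v + (q%:R * u ^+ 2) *: v = u *: (v *m B).
  move: vD; rewrite /Delta_mx mulmxDr mulmxBr mulmx1 -!scalemxAr mulmx1 => /eqP.
  by rewrite addrAC subr_eq0 => /eqP.
(* At [u = 0] the matrix is the identity and has no kernel. *)
have u0 : u != 0.
  apply: contraNneq v0 => u0; move: vE.
  by rewrite u0 expr0n mulr0 !scale0r addr0 => ->.
pose l := (1 + q%:R * u ^+ 2) / u.
have vB : v *m B = l *: v.
  apply: (scalerI u0); rewrite -vE scalerA.
  have -> : u * l = 1 + q%:R * u ^+ 2 by rewrite /l mulrC divfK.
  by rewrite scalerDl scale1r.
have hB i j : conjc (B i j) = B j i by exact: (adjacency_hermitian lift covering i j t1).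
have lr := hermitian_eigenvalue_real hB v0 vB.
have lM : cabs l <= q.+1%:R.
  apply: eigenvalue_bound v0 vB => j.
  have -> : \sum_i cabs (B i j) = \sum_i cabs (B j i).
    by apply: eq_bigr => i _; rewrite -(hB i j) -[RHS]/(cabs _); case: (B i j) => a b /=; rewrite sqrrN.
  by have := adjacency_row_bound covering liftK X_regular j t1.
have lE : l = (complex.Re l)%:C.
  by move: lr; case: (l) => a b [E]; have -> : b = 0 by lra.
apply: (critical_quadratic (l := complex.Re l)) => //.
  by move: lM; rewrite lE cabs_real.
by rewrite -lE /l divfK.
Qed.

Lemma specialize0 : exists c, (specialize P (0 : R[i])).[c] = 1.
Proof.
exists ((1 + 1^-1) / 2); rewrite -(detP 0 (oner_neq0 _)) /Delta_mx.
by rewrite scale0r subr0 expr0n mulr0 scale0r addr0 det1.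
Qed.

Lemma P_neq0 : P != 0.
Proof.
apply/eqP => P0; have [c] := specialize0.
by rewrite P0 /specialize map_poly0 horner0 => /eqP; rewrite eq_sym oner_eq0.
Qed.

Variable Om : {poly {fraction {poly R[i]}}}.
Hypothesis OmP : is_Omega P Om.

(** The excluded [u] are the zeros of the leading coefficient in [x] of [P]: elsewhere [P_u] has its
    full degree, and thus the factorization that [is_Omega] asks for. *)
Lemma minimal_root_generic : generic (fun u => ~ critical_set (R := R) q u ->
  forall g, poly_relation (value_at u) Om g ->
  exists w0, g.[w0] = 0 /\ forall w, g.[w] = 0 -> w <> w0 -> cabs w0 < cabs w).
Proof.
pose lc : {poly R[i]} := map_poly intr (lead_coef P).
have lc0 : lc != 0.
  by rewrite map_poly_eq0_id0 ?lead_coef_eq0 ?P_neq0 // intr_eq0 lead_coef_eq0 lead_coef_eq0 P_neq0.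
exists lc => // u lu uC g Og.
have s0 : (fun a : {poly int} => (map_poly intr a).[u]) 0 = 0 by rewrite map_poly0 horner0.
have sz : size (specialize P u) = size P by rewrite size_map_poly_id0.
pose n := (size P).-1.
have [rs rsE] := closed_field_poly_normal (specialize P u).
have lcu : lead_coef (specialize P u) != 0.
  by rewrite lead_coef_eq0 -size_poly_eq0 sz size_poly_eq0 P_neq0.
have srs : size rs = n.
  have := congr1 (fun p : {poly R[i]} => size p) rsE.
  by rewrite size_scale // size_prod_XsubC sz /n => ->.
pose r (i : 'I_n) := rs`_i.
(* The sign turns the factors ['X - r_i] into [r_i - 'X]. *)
have rE : specialize P u = (lead_coef (specialize P u) * (-1) ^+ n) *: \prod_(i < n) ((r i)%:P - 'X).
  rewrite {1}rsE -scalerA; congr (_ *: _).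
  rewrite (big_nth 0) srs big_mkord.
  have -> : \prod_(i < n) ((r i)%:P - 'X) = \prod_(i < n) ((-1) * ('X - (r i)%:P)).
    by apply: eq_bigr => i _; rewrite mulN1r opprB.
  rewrite big_split /= prodr_const card_ord.
  rewrite -mul_polyC rmorphXn rmorphN rmorph1 mulrA -exprMn mulrNN mulr1 expr1n mul1r.
  by [].
have al0 : lead_coef (specialize P u) * (-1) ^+ n != 0 by rewrite mulf_neq0 // signr_eq0.
have [_ /(_ u _ r g al0 rE Og) gE] := OmP.
have rn i : ~ (exists2 x : R, -1 <= x <= 1 & r i = x%:C).
  move=> [x x1 rx]; have := specialize_neq0 uC x1; rewrite -rx rE.
  by rewrite hornerZ horner_prod (bigD1 i) //= hornerD hornerN hornerC hornerX subrr mul0r mulr0 eqxx.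
exists (W_ r [ffun=> true]); split.
  by rewrite gE horner_prod (bigD1 [ffun=> true]) //= hornerXsubC subrr mul0r.
move=> w; rewrite gE horner_prod => /eqP /prodf_eq0[I _].
rewrite hornerXsubC subr_eq0 => /eqP -> nW; apply: W_min => // IE.
by apply: nW; rewrite IE.
Qed.

End MinimalRoot.

(** * Injectivity near a point outside of the critical set *)

Section PuncturedDisc.
Context {R : realType}.
Implicit Types x y z w : R[i].

(** Along a segment that avoids the centre [j] is constant by the mean value inequality; a punctured
    disc is connected by at most two such segments. *)
Lemma locally_constant_punctured (j : R[i] -> nat) z0 (r : R) :
  (forall z, z != z0 -> cabs (z - z0) < r -> exists2 t : R, 0 < t &
    forall w, cabs (w - z) < t -> j w = j z) ->
  forall z w, z != z0 -> cabs (z - z0) < r -> w != z0 -> cabs (w - z0) < r -> j z = j w.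
Proof.
move=> jl; pose avoid x y := forall t : R, 0 <= t <= 1 -> x + t%:C * (y - x) != 0.
have seg x y : cabs x < r -> cabs y < r -> avoid x y -> j (z0 + x) = j (z0 + y).
  move=> xr yr xy; pose c (t : R) := z0 + (x + t%:C * (y - x)).
  have cr (t : R) : 0 <= t <= 1 -> c t != z0 /\ cabs (c t - z0) < r.
    move=> t01; rewrite /c -subr_eq0 addrC addKr; split; first exact: xy.
    have -> : x + t%:C * (y - x) = (1 - t)%:C * x + t%:C * y by rewrite rmorphB rmorph1 /=; ring.
    apply: le_lt_trans (cabsD _ _) _; rewrite !cabsM !cabs_real !ger0_norm; try lra.
    have [t0|t0] := eqVneq t 0; first by rewrite t0 subr0 mul1r mul0r addr0.
    have tp : 0 < t by move: t01; rewrite lt_def t0 => /andP[->].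
    have h1 : (1 - t) * cabs x <= (1 - t) * r by apply: ler_wpM2l; lra.
    have h2 : t * cabs y < t * r by rewrite ltr_pM2l.
    lra.
  have h : cabs ((j (c 1))%:R - (j (c 0))%:R : R[i]) <= 0.
    (* The bound is 0, as the increments of [j] vanish near each [t]. *)
    apply: (@mean_value_bound R (fun t => (j (c t))%:R)) => t t01 e e0.
    have [cz cR] := cr t t01; have [d d0 dj] := jl _ cz cR.
    have l0 : 0 < cabs (y - x) + 1 by have := cabs_ge0 (y - x); lra.
    exists (d / (cabs (y - x) + 1)); first by rewrite divr_gt0.
    move=> s s01; rewrite ltr_pdivlMr // => st.
    rewrite (dj (c s)); first by rewrite subrr cabs0 add0r mulr_ge0 // ltW.
    have -> : c s - c t = (s - t)%:C * (y - x) by rewrite /c rmorphB /=; ring.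
    rewrite cabsM cabs_real; have := normr_ge0 (s - t); lra.
  have : (j (c 1))%:R - (j (c 0))%:R == 0 :> R[i] by rewrite -cabs_eq0 eq_le h cabs_ge0.
  rewrite subr_eq0 eqr_nat => /eqP; rewrite /c mul1r mul0r addr0 => <-; congr (j _); ring.
move=> z w zz zr wz wr; set x := z - z0 in zr; set y := w - z0 in wr.
have x0 : x != 0 by rewrite subr_eq0.
have y0 : y != 0 by rewrite subr_eq0.
have -> : z = z0 + x by rewrite /x; ring.
have -> : w = z0 + y by rewrite /y; ring.
have [|n] := pselect (avoid x y); first exact: seg.
have {n}[t t01 E] : exists2 t : R, 0 <= t <= 1 & x + t%:C * (y - x) = 0.
  apply: contrapT => h; apply: n => t t01; apply/eqP => E; apply: h; by exists t.
(* The segment runs through the centre, so [y] is a real multiple of [x], and the detour through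
   ['i * x] avoids the centre. *)
have ix : cabs ('i * x) < r by rewrite cabsM cabs_i mul1r.
have t0 : t != 0 by apply: contraNneq x0 => t0; rewrite -E t0 mul0r addr0.
have yE : y = (- (1 - t) / t)%:C * x.
  have tc : t%:C != 0 :> R[i] by rewrite eq_complex /= eqxx andbT.
  apply: (mulfI tc); rewrite mulrA -rmorphM /= [t * _]mulrC divfK //.
  apply/eqP; rewrite -subr_eq0 -E rmorphN rmorphB rmorph1; apply/eqP; ring.
rewrite (seg x ('i * x)) //; first apply: seg => //.
- move=> s _; rewrite yE; set k := - (1 - t) / t in yE *.
  have -> : 'i * x + s%:C * (k%:C * x - 'i * x) = ((s * k) +i* (1 - s))%C * x.
    case: (x) => a b; rewrite -complexiE; apply/eqP; rewrite eq_complex /=; apply/andP; split; apply/eqP; ring.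
  rewrite mulf_neq0 // eq_complex /= negb_and; have [s1|s1] := eqVneq s 1.
    by rewrite s1 mul1r; apply/orP; left; apply: contraNneq y0 => k0; rewrite yE k0 mul0r.
  by apply/orP; right; rewrite subr_eq0 eq_sym.
- move=> s _; have -> : x + s%:C * ('i * x - x) = ((1 - s) +i* s)%C * x.
    by case: (x) => a b; rewrite -complexiE; apply/eqP; rewrite eq_complex /=; apply/andP; split; apply/eqP; ring.
  rewrite mulf_neq0 // eq_complex /= negb_and; have [s0|s0] := eqVneq s 0.
    by rewrite s0 subr0 oner_eq0.
  by rewrite orbT.
Qed.

Lemma critical_set_closed (q : nat) z : ~ critical_set (R := R) q z ->
  exists2 r : R, 0 < r & forall w, cabs (w - z) < r -> ~ critical_set (R := R) q w.
Proof.
move=> zC; pose c : R := (Num.sqrt q%:R)^-1.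
have n1 : cabs z != c.
  by apply/eqP => E; apply: zC; left; left; rewrite /= normE E.
have itv (a b : R) : ~ [set x%:C | x in `[a, b]] z -> exists2 r : R, 0 < r &
    forall w, cabs (w - z) < r -> ~ [set x%:C | x in `[a, b]] w.
  case: z {zC n1} => x y nz.
  have [y0|y0] := eqVneq y 0; last first.
    exists `|y|; first by rewrite normr_gt0.
    move=> w wz [s _ sw]; rewrite -{w}sw in wz; have := le_lt_trans (cabs_Im _) wz.
    by rewrite /= sub0r normrN ltxx.
  have : x < a \/ b < x.
    have [xa|xa] := ltP x a; [by left|right; rewrite ltNge; apply/negP => xb].
    by apply: nz; exists x; rewrite ?y0 //= in_itv /= xa.
  case=> h; [exists (a - x)|exists (x - b)]; rewrite ?subr_gt0 // => w wz [s];
    rewrite /= in_itv /= => /andP[s1 s2] sw; rewrite -{w}sw in wz; have := le_lt_trans (cabs_Re _) wz;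
    rewrite /= ltr_norml => /andP[]; lra.
have [r1 r10 h1] := itv (-1) (- q%:R^-1) (fun h => zC (or_introl (or_intror h))).
have [r2 r20 h2] := itv (q%:R^-1) 1 (fun h => zC (or_intror h)).
exists (Num.min `|cabs z - c| (Num.min r1 r2)).
  by rewrite !lt_min normr_gt0 subr_eq0 n1 r10.
move=> w; rewrite !lt_min => /and3P[wz w1 w2] [[|]|]; [|exact: h1|exact: h2].
rewrite /= normE => -[wc]; move: wz; rewrite ltNge => /negP; apply.
have := cabs_sub w z; have := cabs_sub z w; rewrite [cabs (z - w)]cabsC wc -/c => h h'.
by rewrite ler_norml; apply/andP; split; lra.
Qed.

Lemma critical_set_bounded (q : nat) z : (0 < q)%N -> critical_set (R := R) q z -> cabs z <= 1.
Proof.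
move=> q0; have q1 : 1 <= q%:R :> R by rewrite ler1n.
have qV : q%:R^-1 <= 1 :> R by rewrite invf_le1 // (lt_le_trans ltr01).
have qV0 : 0 <= q%:R^-1 :> R by rewrite invr_ge0 (le_trans ler01).
case=> [[]|].
- rewrite /= normE => -[->]; rewrite invf_le1; last by rewrite sqrtr_gt0 (lt_le_trans ltr01).
  by rewrite -[leLHS]sqrtr1 ler_wsqrtr.
- by move=> [x]; rewrite /= in_itv /= => /andP[x1 x2] <-; rewrite cabs_real ler_norml; lra.
- by move=> [x]; rewrite /= in_itv /= => /andP[x1 x2] <-; rewrite cabs_real ler_norml; lra.
Qed.

End PuncturedDisc.

Section RootBound.
Context {R : realType}.

(** Cauchy's bound: for a root outside of the unit disc, isolate the leading term and divide by the
    power [n] of the modulus. *)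
Lemma monic_root_bound (g : {poly R[i]}) n w : g \is monic -> size g = n.+2 ->
  g.[w] = 0 -> cabs w <= 1 + \sum_(k < n.+2) cabs g`_k.
Proof.
move=> mg sg; rewrite horner_coef sg big_ord_recr /=.
have -> : g`_n.+1 = 1 by rewrite -(monicP mg) lead_coefE sg.
rewrite mul1r => /eqP; rewrite addr_eq0 => /eqP/esym wE.
have g0 m : 0 <= \sum_(k < m) cabs g`_k by apply: sumr_ge0 => k _; exact: cabs_ge0.
have [w1|w1] := leP (cabs w) 1; first by have := g0 n.+2; lra.
have w0 : 0 < cabs w by lra.
suff : cabs w <= \sum_(k < n.+1) cabs g`_k.
  by rewrite [X in _ -> _ <= 1 + X]big_ord_recr /=; have := cabs_ge0 g`_n.+1; lra.
rewrite -(ler_pM2r (exprn_gt0 n w0)) -exprS -cabsX -cabsN wE.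
apply: le_trans (cabs_sum _ _ _) _; rewrite mulr_suml; apply: ler_sum => k _.
rewrite cabsM cabsX; apply: ler_wpM2l; first exact: cabs_ge0.
by apply: ler_weXn2l; [exact: ltW|rewrite -ltnS].
Qed.

Lemma double_root_deriv n (w : 'I_n -> R[i]) i j : i != j -> w i = w j ->
  (\prod_i ('X - (w i)%:P))^`().[w i] = 0.
Proof.
move=> ij wE; rewrite (bigD1 i) //= (bigD1 j) 1?eq_sym //= -wE.
by rewrite !derivM derivXsubC !(hornerXsubC, hornerD, hornerM) subrr; ring.
Qed.

End RootBound.

(** * The function [f] separates the points of almost all fibres *)

Section GenericFibre.
Context {R : realType} (S : topologicalType).
Hypothesis hausS : hausdorff_space S.
Local Notation Cu := {fraction {poly R[i]}}.
Variables (Om : {poly Cu}) (irr : irreducible_poly Om) (mon : Om \is monic).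
Variables (Pi f : S -> CP1 (R := R)).
Let N := (size Om).-1.
Hypothesis fibre_card : forall c, (forall p, Pi p = c -> ~ branch_point Pi p) ->
  (Pi @^-1` [set c] #= `I_N)%card.
Hypothesis bad_fin : finite_set [set p | ~ regular_point Pi f p].
Hypothesis Om_f : forall (p : S) (u w : R[i]) (g : {poly R[i]}),
  Pi p = Some u -> f p = Some w -> polyfun_value Om u g -> g.[w] = 0.

Let sOm : size Om = N.-1.+2.
Proof. by rewrite /N; have [+ _] := irr; case: (size Om) => [|[]]. Qed.

Let chi := fibre_poly Pi f N.

Lemma good_finite_value u p : ~ bad_value Pi f u -> Pi p = Some u -> f p = Some (finite_value f p).
Proof.
by move=> ub pu; have [? [w [? [_ fw _ _ _]]]] := good_regular ub pu; rewrite /finite_value fw.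
Qed.

Lemma fibre_poly_fraction : exists q : {poly Cu}, generic (fun u =>
  ~ bad_value Pi f u /\ poly_relation (value_at u) q (chi u)).
Proof.
pose D := common_den Om.
(* The polynomial [D] times the coefficient of index [k] of [Om]. Cauchy's bound for the root [f p],
   multiplied by [D], then has polynomial growth. *)
pose C (k : 'I_(size Om)) := frac_num Om`_k * \prod_(l < size Om | l != k) frac_den Om`_l.
pose B u := cabs D.[u] + \sum_k cabs (C k).[u].
have B0 u : 0 <= B u by rewrite addr_ge0 ?cabs_ge0 // sumr_ge0 // => k _; exact: cabs_ge0.
have Bg : poly_growth B.
  by apply: poly_growthD; [|apply: poly_growth_sum => k]; exact: poly_growth_horner.
have DB u p : ~ bad_value Pi f u -> Pi p = Some u -> cabs (D.[u] * finite_value f p) <= B u.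
  move=> ub pu; have [D0|D0] := eqVneq D.[u] 0; first by rewrite D0 mul0r cabs0.
  have Og := specializedP D0; have [mg sg] := monic_poly_value Og mon.
  have gw := Om_f pu (good_finite_value ub pu) Og.
  rewrite sOm in sg; have := monic_root_bound mg sg gw.
  rewrite -sOm cabsM => /(ler_wpM2l (cabs_ge0 D.[u])) h; apply: le_trans h _.
  rewrite mulrDr mulr1 lerD2l mulr_sumr; apply: ler_sum => k _; rewrite -cabsM.
  rewrite coef_poly ltn_ord {1}/D /common_den horner_prod (bigD1 k) //= -horner_prod.
  have dk : (frac_den Om`_k).[u] != 0 by exact: common_den_coef.
  by rewrite mulrC mulrA divfK // hornerM.
have [E [E0 Eb EQ]] := fibre_poly_rational hausS fibre_card bad_fin (common_den_neq0 Om) B0 Bg DB.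
have [Q QP] := choice EQ.
exists (\poly_(k < N.+1) (tofrac (Q k) / tofrac E)), E => // u Eu.
have ub : ~ bad_value Pi f u by move=> /Eb E'; rewrite E' eqxx in Eu.
split=> // k; rewrite coef_poly; case: ltnP => kN.
  exists (Q k), E; split=> //.
  by apply: (mulfI Eu); rewrite QP [RHS]mulrC divfK.
have [e he] := good_fibre_enum fibre_card ub.
rewrite /chi (fibre_polyE f he) nth_default; first exact: rr0 (value_at_ring u).
by rewrite /fibre_prod -big_enum size_prod_XsubC size_enum_ord.
Qed.

Lemma fibre_poly_generic : generic (fun u => ~ bad_value Pi f u /\
  forall g, poly_relation (value_at u) Om g -> chi u = g).
Proof.
have [q gq] := fibre_poly_fraction.
have chiP u : ~ bad_value Pi f u -> chi u \is monic /\ size (chi u) = N.+1.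
  move=> /(good_fibre_enum fibre_card)[e he]; rewrite /chi (fibre_polyE f he).
  rewrite /fibre_prod -big_enum /= monic_prod_XsubC size_prod_XsubC.
  by rewrite size_enum_ord.
have sN : size Om = N.+1 by rewrite sOm /N sOm.
have h : generic (fun u => exists q' : {poly R[i]}, [/\ poly_relation (value_at u) q q',
    q' \is monic, size q' = N.+1 & forall g, poly_relation (value_at u) Om g ->
      exists w, g.[w] = 0 /\ q'.[w] = 0]).
  apply: generic_sub gq => u [ub qu]; have [mc sc] := chiP u ub.
  exists (chi u); split=> // g Og.
  have [e he] := good_fibre_enum fibre_card ub; have [_ eP _] := he.
  have i0 : 'I_N by rewrite /N sOm; exact: ord0.
  exists (finite_value f (e i0)); split.
    exact: Om_f (eP i0) (good_finite_value ub (eP i0)) Og.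
  rewrite /chi (fibre_polyE f he) /fibre_prod horner_prod (bigD1 i0) //=.
  by rewrite hornerXsubC subrr mul0r.
apply: generic_sub (generic_and gq (divides_generic irr mon sN h)) => u [[ub qu] hu].
split=> // g Og; have [mc sc] := chiP u ub; exact: hu.
Qed.

Lemma fibre_separated : generic (fun u => forall p p', Pi p = Some u -> Pi p' = Some u ->
  f p = f p' -> p = p').
Proof.
apply: generic_sub (generic_and (generic_and fibre_poly_generic (separable_generic irr mon))
  (specialized_generic Om)) => u [[[ub cu] su] Og] p p' pu pu' fpp.
have [e he] := good_fibre_enum fibre_card ub; have [ei eP eS] := he.
have [i iE] := eS p pu; have [j jE] := eS p' pu'.
have [ij|ij] := eqVneq i j; first by rewrite -iE -jE ij.
have gE := cu _ Og; rewrite /chi (fibre_polyE f he) /fibre_prod in gE.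
have wE : finite_value f (e i) = finite_value f (e j) by rewrite iE jE /finite_value fpp.
have [] := su _ Og (finite_value f (e i)).
  exact: Om_f (eP i) (good_finite_value ub (eP i)) Og.
by rewrite -gE (double_root_deriv ij wE).
Qed.

End GenericFibre.

Section Continuity.
Context {R : realType}.
Local Notation Cu := {fraction {poly R[i]}}.

Lemma ccont_horner (p : {poly R[i]}) (g : R[i] -> R[i]) z : ccont g z -> ccont (fun x => p.[g x]) z.
Proof.
move=> gc; have -> : (fun x => p.[g x]) = (fun x => \sum_(k < size p) p`_k * g x ^+ k).
  by apply/funext => x; rewrite horner_coef.
by apply: ccont_sum => k; apply: ccontM; [exact: ccont_cst|exact: ccontX].
Qed.

Lemma ccont_specialized (h : {poly Cu}) (g k : R[i] -> R[i]) z : ccont g z -> ccont k z ->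
  (common_den h).[g z] != 0 -> ccont (fun x => (specialized h (g x)).[k x]) z.
Proof.
move=> gc kc hz.
have -> : (fun x => (specialized h (g x)).[k x]) = (fun x => \sum_(l < size h)
    (frac_num h`_l).[g x] * ((frac_den h`_l).[g x])^-1 * k x ^+ l).
  by apply/funext => x; rewrite /specialized horner_poly.
apply: ccont_sum => l; apply: ccontM; last exact: ccontX.
apply: ccontM; first exact: ccont_horner.
by apply: ccontV; [exact: ccont_horner|exact: common_den_coef].
Qed.

Lemma ccont_lt (a b : R[i] -> R[i]) z : ccont a z -> ccont b z -> cabs (a z) < cabs (b z) ->
  exists2 t : R, 0 < t & forall x, cabs (x - z) < t -> cabs (a x) < cabs (b x).
Proof.
move=> ac bc ab; have e0 : 0 < (cabs (b z) - cabs (a z)) / 2 by lra.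
have [s s0 sP] := ac _ e0; have [t t0 tP] := bc _ e0.
exists (Num.min s t); first by rewrite lt_min s0.
move=> x; rewrite lt_min => /andP[/sP h1 /tP h2].
by have := cabs_sub (a x) (a z); have := cabs_sub (b z) (b x); rewrite [cabs (b z - b x)]cabsC; lra.
Qed.

End Continuity.

Section Avoidance.
Context {R : realType} (S : topologicalType) (A : atlas (R := R) S).
Hypothesis surfA : riemann_surface A.
Variable Pi : S -> CP1 (R := R).
Hypotheses (holPi : holomorphic A CP1_atlas Pi) (Pi_nc : forall c, exists p, Pi p != c).
Variables (p : S) (i : chart A).
Hypothesis ip : dom i p.

(** If [Pi p] is finite, this is continuity and the openness of the complement of [K]. At a pole of
    [Pi] the chart 1/z is used: where 1 / Pi is smaller than [(1 + |M|)^-1], the value of [Pi]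
    exceeds the bound [M] of [K]. *)
Lemma avoid_near (K : set R[i]) (M : R) :
  (forall u, ~ K u -> exists2 r : R, 0 < r & forall w, cabs (w - u) < r -> ~ K w) ->
  (forall u, K u -> cabs u <= M) -> (forall u, Pi p = Some u -> ~ K u) ->
  exists2 r : R, 0 < r & forall z, cabs (z - coord i p) < r ->
    forall u, Pi (param i z) = Some u -> ~ K u.
Proof.
move=> Kc KM pK; case Ep : (Pi p) => [u0|].
  have jp : dom (true : chart (CP1_atlas (R := R))) (Pi p) by rewrite Ep; exists u0.
  have [r r0 [hr jr]] := local_expression surfA holPi ip jp.
  have zr : cabs (coord i p - coord i p) < r by rewrite subrr cabs0.
  have [d /cdiff_cont hc] := hr _ zr.
  have [e e0 eK] := Kc u0 (pK u0 Ep).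
  have [t t0 tP] := hc e e0; exists t => // z /tP.
  by rewrite /= paramK // Ep => h u Eu; apply: eK; rewrite Eu in h.
have jp : dom (false : chart (CP1_atlas (R := R))) (Pi p) by rewrite Ep => -[].
have [r r0 [hr jr]] := local_expression surfA holPi ip jp.
have zr : cabs (coord i p - coord i p) < r by rewrite subrr cabs0.
have [d /cdiff_cont hc] := hr _ zr.
have M1 : 0 < 1 + `|M| by rewrite ltr_pwDl.
have M0 : 0 < (1 + `|M|)^-1 by rewrite invr_gt0.
have [t t0 tP] := hc _ M0; exists (Num.min r t); first by rewrite lt_min r0.
move=> z; rewrite lt_min => /andP[/jr jz /tP].
rewrite /= paramK // Ep subr0 => h u Eu /KM uM; move: h jz; rewrite Eu /= => h u0.
have up : 0 < cabs u by rewrite cabs_gt0; apply/eqP => E; apply: u0; rewrite E.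
move: h; rewrite cabsV ltf_pV2 ?posrE //.
by have := ler_norm M; lra.
Qed.

Lemma avoid_roots (s : seq R[i]) : exists2 r : R, 0 < r & forall z, z != coord i p ->
  cabs (z - coord i p) < r -> forall u, Pi (param i z) = Some u -> u \notin s.
Proof.
elim: s => [|b s [r r0 rs]]; first by exists 1.
have [t t0 tb] : exists2 t : R, 0 < t & forall z, z != coord i p ->
    cabs (z - coord i p) < t -> Pi (param i z) <> Some b.
  have [Eb|nb] := pselect (Pi p = Some b).
    have [t t0 [g gP]] := nonconstant_punctured surfA holPi Pi_nc ip.
    by exists t => // z zp zt; rewrite -Eb; have [] := gP z zp zt.
  have [|u ->|u pu ub|t t0 tP] := @avoid_near [set b] (cabs b).
  - move=> u ub; exists (cabs (u - b)); first by rewrite cabs_gt0 subr_eq0; apply/eqP.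
    by move=> w wu wb; move: wu; rewrite wb cabsC ltxx.
  - by [].
  - by apply: nb; rewrite pu ub.
  - by exists t => // z _ zt E; apply: (tP z zt b E).
exists (Num.min r t); first by rewrite lt_min r0.
move=> z zp; rewrite lt_min => /andP[zr zt] u Eu; rewrite inE negb_or (rs z zp zr u Eu) andbT.
by apply/eqP => ub; apply: (tb z zp zt); rewrite Eu ub.
Qed.

Lemma avoid_zeros (d : {poly R[i]}) : d != 0 -> exists2 r : R, 0 < r & forall z, z != coord i p ->
  cabs (z - coord i p) < r -> forall u, Pi (param i z) = Some u -> d.[u] != 0.
Proof.
move=> d0; have [s sE] := closed_field_poly_normal d.
have [r r0 rP] := avoid_roots s; exists r => // z zp zr u Eu.
have := rP z zp zr u Eu; apply: contra => du.
by rewrite -root_prod_XsubC -(@rootZ _ _ (lead_coef d)) ?lead_coef_eq0 // -sE.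
Qed.

End Avoidance.

Section Unbranched.
Context {R : realType} (S : topologicalType) (A : atlas (R := R) S).
Hypothesis surfA : riemann_surface A.
Local Notation Cu := {fraction {poly R[i]}}.
Variables (Om : {poly Cu}) (hs : seq {poly Cu}).
Variables (Pi f : S -> CP1 (R := R)).
Hypotheses (holPi : holomorphic A CP1_atlas Pi) (Pi_nc : forall c, exists p, Pi p != c).
Hypothesis merf : meromorphic A f.
Variables (K : set R[i]) (M : R).
Hypothesis Kc : forall u, ~ K u -> exists2 r : R, 0 < r & forall w, cabs (w - u) < r -> ~ K w.
Hypothesis KM : forall u, K u -> cabs u <= M.

(* For all but finitely many [u] outside of [K], exactly one of the roots [hs] of
   [Om], evaluated at [T = f], has least modulus, and this value determines the
   point of the fibre. *)
Hypothesis minimal_root : generic (fun u => ~ K u ->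
  (forall h, h \in hs -> (common_den h).[u] != 0) /\
  forall p w, Pi p = Some u -> f p = Some w ->
    let v (j : 'I_(size hs)) := (specialized (nth 0 hs j) u).[w] in
    exists j, (forall l, l != j -> cabs (v j) < cabs (v l)) /\
    forall p' w', Pi p' = Some u -> f p' = Some w' ->
      let v' (j : 'I_(size hs)) := (specialized (nth 0 hs j) u).[w'] in
      (forall l, l != j -> cabs (v' j) < cabs (v' l)) -> p = p').

Lemma unbranched p0 : (forall u, Pi p0 = Some u -> ~ K u) -> ~ branch_point Pi p0.
Proof.
move=> p0K; have [i ip0] := chart_at surfA p0; set z0 := coord i p0.
have [r1 r10 [g gP]] := nonconstant_punctured surfA holPi Pi_nc ip0.
have [r2 r20 [k kP]] := meromorphic_punctured surfA merf ip0.
have [r3 r30 aK] := avoid_near surfA holPi ip0 Kc KM p0K.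
have [d d0 dP] := minimal_root.
have [r4 r40 ad] := avoid_zeros surfA holPi Pi_nc ip0 d0.
pose r := Num.min (Num.min r1 r2) (Num.min r3 r4).
have r0 : 0 < r by rewrite !lt_min r10 r20 r30.
have near z : z != z0 -> cabs (z - z0) < r -> [/\ Pi (param i z) <> Pi p0,
    Pi (param i z) = Some (g z), f (param i z) = Some (k z), ccont g z /\ ccont k z &
    ~ K (g z) /\ d.[g z] != 0].
  move=> zz0; rewrite /r !lt_min => /andP[/andP[z1 z2] /andP[z3 z4]].
  have [n Pz [dg _ /cdiff_cont gc]] := gP z zz0 z1.
  have [fz [dk /cdiff_cont kc]] := kP z zz0 z2.
  by split=> //; split; [exact: (aK z z3)|exact: (ad z zz0 z4)].
clearbody r.
pose v z (j : 'I_(size hs)) := (specialized (nth 0 hs j) (g z)).[k z].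
pose least z j := forall l, l != j -> cabs (v z j) < cabs (v z l).
have least_uniq z j l : least z j -> least z l -> j = l.
  move=> jm lm; apply/eqP/negPn/negP => jl.
  by have := jm l; have := lm j jl; rewrite eq_sym => h /(_ jl) /(lt_trans h); rewrite ltxx.
have ex_least z : z != z0 -> cabs (z - z0) < r -> exists j, least z j.
  move=> zz0 zr; have [_ Pz fz _ [nK dz]] := near z zz0 zr.
  by have [_ /(_ _ _ Pz fz)[j [jm _]]] := dP _ dz nK; exists j.
(* The index of the least root as a total function on the plane, with value 0 outside of the
   punctured disc. *)
have [J JP] : exists J : R[i] -> nat, forall z, z != z0 -> cabs (z - z0) < r ->
    exists2 j : 'I_(size hs), J z = j & least z j.
  suff /choice[J JP] : forall z, exists n : nat, z != z0 -> cabs (z - z0) < r ->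
    exists2 j : 'I_(size hs), n = j & least z j by exists J.
  move=> z; have [[zz0 zr]|n] := pselect (z != z0 /\ cabs (z - z0) < r).
    by have [j jm] := ex_least z zz0 zr; exists j => _ _; exists j.
  by exists 0%N => zz0 zr; case: n.
have Jc z w : z != z0 -> cabs (z - z0) < r -> w != z0 -> cabs (w - z0) < r -> J z = J w.
  apply: locally_constant_punctured => {}z zz0 zr; have [j Jz jm] := JP z zz0 zr.
  have [_ Pz fz [gc kc] [nK dz]] := near z zz0 zr; have [hd _] := dP _ dz nK.
  have vc l : ccont (fun x => v x l) z.
    by apply: ccont_specialized => //; apply: hd; exact: mem_nth.
  have : forall s : seq 'I_(size hs), exists2 t : R, 0 < t & forall w, cabs (w - z) < t ->
      forall l, l \in s -> l != j -> cabs (v w j) < cabs (v w l).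
    elim=> [|l s [t t0 IH]]; first by exists 1.
    have [lj|lj] := eqVneq l j.
      exists t => // x xt m; rewrite inE => /orP[/eqP->|]; first by rewrite lj eqxx.
      exact: IH.
    have [t' t'0 tP] := ccont_lt (vc j) (vc l) (jm l lj).
    exists (Num.min t t'); first by rewrite lt_min t0.
    move=> x; rewrite lt_min => /andP[xt xt'] m; rewrite inE => /orP[/eqP-> _|]; first exact: tP.
    exact: IH.
  move=> /(_ (enum 'I_(size hs)))[t t0 tP].
  have m0 : 0 < Num.min t (Num.min (cabs (z - z0)) (r - cabs (z - z0))).
    by rewrite !lt_min t0 cabs_gt0 subr_eq0 zz0 subr_gt0.
  exists (Num.min t (Num.min (cabs (z - z0)) (r - cabs (z - z0)))) => // x.
  rewrite !lt_min => /and3P[xt x1 x2].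
  have xz0 : x != z0 by apply: contraTneq x1 => ->; rewrite cabsC ltxx.
  have xr : cabs (x - z0) < r.
    have -> : x - z0 = (x - z) + (z - z0) by ring.
    by apply: le_lt_trans (cabsD _ _) _; lra.
  have [l Jx lm] := JP x xz0 xr; rewrite Jz Jx; congr nat_of_ord.
  by apply: (least_uniq x) => // m mj; apply: tP => //; rewrite mem_enum.
have nV := nbhs_chart surfA ip0 r0.
move=> /(_ _ nV); apply.
have coord0 x : param i (coord i x) = x -> coord i x = z0 -> x = p0.
  by move=> xE E; rewrite -xE E paramK.
move=> x y /set_mem[ix xr xE] /set_mem[iy yr yE] Pxy.
(* In the mixed cases [Pi] would take the value [Pi p0] in the punctured disc; only two points off
   the centre remain to be compared. *)
have [xz|xz] := eqVneq (coord i x) z0; have [yz|yz] := eqVneq (coord i y) z0.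
- by rewrite (coord0 x) // (coord0 y).
- by have [+ _ _ _ _] := near _ yz yr; rewrite yE -Pxy (coord0 x).
- by have [+ _ _ _ _] := near _ xz xr; rewrite xE Pxy (coord0 y).
have [_ Px fx _ [nK dx]] := near _ xz xr; have [_ Py fy _ _] := near _ yz yr.
have [j Jx jm] := JP _ xz xr; have [l Jy lm] := JP _ yz yr.
have jl : j = l by apply/val_inj; rewrite /= -Jx -Jy; exact: Jc.
have [gxy] : Some (g (coord i x)) = Some (g (coord i y)) by rewrite -Px -Py xE yE.
have [_ /(_ _ _ Px fx)[j' [jm' inj]]] := dP _ dx nK.
have jj : j' = j by exact: (least_uniq (coord i x)).
rewrite -xE -yE; apply: inj fy _; first by rewrite Py gxy.
by rewrite jj jl => m /lm; rewrite /v gxy.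
Qed.

End Unbranched.

Lemma nth_prod_XsubC_root (F : idomainType) (T : Type) (hs : seq T) (x0 : T) (v : T -> F) w :
  (\prod_(h <- hs) ('X - (v h)%:P)).[w] = 0 <->
  exists j : 'I_(size hs), w = v (nth x0 hs j).
Proof.
rewrite (big_nth x0) big_mkord horner_prod; split=> [/eqP/prodf_eq0[j _]|[j wE]].
  by rewrite hornerXsubC subr_eq0 => /eqP; exists j.
by apply/eqP/prodf_eq0; exists j => //; rewrite hornerXsubC wE subrr.
Qed.

Theorem theorem3p2 (R : realType) (q : nat) (q_gt0 : (0 < q)%N)
    (VX EX : finType) (X : graph VX EX) (X_regular : regular_graph X q.+1)
    (VY EY : choiceType) (Y : graph VY EY) (act : free_Zaction Y)
    (pV : VY -> VX) (pE : EY -> EX) (covering : quotient_map act X pV pE)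
    (lift : VX -> VY) (liftK : cancel lift pV)
    (P : {poly {poly int}}) (detP : determinant_poly (R := R) act lift q P)
    (Om : {poly {fraction {poly R[i]}}}) (OmP : is_Omega P Om)
    (Om_irr : monic_irreducible_poly Om)
    (Om_galois : galois_extension {poly %/ Om with Om_irr})
    (S : topologicalType) (A : atlas (R := R) S) (Pi f : S -> CP1 (R := R))
    (SPf : algebraic_function Om A Pi f) :
  [set Pi p | p in [set p | branch_point Pi p]] `<=`
    [set Some u | u in critical_set (R := R) q].
Proof.
have [cS surfA [holPi Pi_nc fibre_card] merf Om_f] := SPf.
have [_ _ hausS _ _] := surfA.
have [irr mon] := Om_irr.
have bad_fin := irregular_finite surfA holPi Pi_nc merf cS.
have [hs hsP] := galois_generic Om_galois.
have min := minimal_root_generic q_gt0 covering liftK X_regular detP OmP.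
have sep := fibre_separated hausS irr mon fibre_card bad_fin Om_f.
have all := generic_and (generic_and (generic_and hsP min) (generic_and sep (separable_generic irr mon)))
  (specialized_generic Om).
move=> _ [p0 bp <-]; apply: contrapT => p0K.
apply: (@unbranched R S A surfA hs Pi f holPi Pi_nc merf (critical_set q) 1) bp.
- exact: critical_set_closed.
- by move=> u; exact: critical_set_bounded.
- apply: generic_sub all => u [[[[hd hP] mP] [sP dP]] Og] uK; split=> // p w pu fw v.
  have [hfac hinj] := hP _ Og; have [w0 [gw0 w0min]] := mP uK _ Og.
  have gw := Om_f _ _ _ _ pu fw Og.
  have fac := hfac w gw.
  have rootP x : (specialized Om u).[x] = 0 <-> exists j, x = v j.
    by rewrite fac; exact: nth_prod_XsubC_root.
  (* By separability the least root occurs at a single index: at two indices it would be a double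
     root. *)
  have [j w0E] := (rootP w0).1 gw0; exists j; split=> [l lj|p' w' pu' fw' v' jm].
    rewrite -w0E; apply: w0min; first by apply/rootP; exists l.
    move=> vl; have := dP _ Og w0 gw0; apply.
    rewrite fac (big_nth 0) big_mkord w0E; apply: (double_root_deriv (j := l)).
      by rewrite eq_sym.
    by rewrite -/(v l) -/(v j) vl.
  have gw' := Om_f _ _ _ _ pu' fw' Og; have fac' := hfac w' gw'.
  have rootP' x : (specialized Om u).[x] = 0 <-> exists j, x = v' j.
    by rewrite fac'; exact: nth_prod_XsubC_root.
  (* The values [v] and [v'] enumerate the same roots, in possibly different orders. As [v j] and
     [v' j] are both strictly least among them, they agree. *)
  have vv : v j = v' j.
    apply: contrapT => n; have [l vl] := (rootP' (v j)).1 ((rootP _).2 (ex_intro _ j erefl)).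
    have lj : l != j by apply/eqP => lj; apply: n; rewrite vl lj.
    have := jm l lj; rewrite -vl -w0E.
    have gv' : (specialized Om u).[v' j] = 0 by apply/rootP'; exists j.
    by move=> /lt_trans/(_ (w0min _ gv' _)); rewrite ltxx => h; apply: notF; apply: h => E; apply: n; rewrite -w0E.
  (* The polynomial of index [j] is injective on the roots, so [f] agrees at [p] and [p']; as [f]
     separates the fibre, the points agree. *)
  apply: sP => //; rewrite fw fw'; congr Some.
  by apply: (hinj (nth 0 hs j)) => //; exact: mem_nth.
by move=> u p0u uK; apply: p0K; exists u.
Qed.
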